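(* Let $\Gamma$ be a bridgeless tropical curve of genus $g=3$ without cut vertices. Then each maximal Weierstrass locus of $\Gamma$ is isolated, i.e. consists of a single point. Let $\{p_1,\dots,p_m\}$ denote the set of maximal Weierstrass points of $\Gamma$. (1) If $\Gamma$ is hyperelliptic, then $m=4$ and \[ \sum_{i=1}^4\operatorname{wt}_K(p_i)=12=(g^3-g)/2 . \] (2) If $\Gamma$ is non-hyperelliptic, then $4\le m\le 8$ and \[ \sum_{i=1}^m\operatorname{wt}_K(p_i)=8=g^2-1 . \]
   Context: A tropical curve (metric graph) $\Gamma$ is a compact connected metric space with the path metric in which every point $p$ has an open neighborhood isometric to a star with $m=\operatorname{val}(p)\ge 1$ branches of some radius $\varepsilon>0$ centered at $p$ (equivalently, it is obtained from a finite connected graph with positive edge lengths). Its genus is $\dim_{\mathbb R}H_1(\Gamma,\mathbb R)$. $T_p\Gamma$ is the set of outgoing tangent directions at $p$. $\operatorname{Div}(\Gamma)$ is the free abelian group on the points of $\Gamma$; $D=\sum_p D(p)(p)$, $\deg D=\sum_p D(p)$, and $D$ is effective if all $D(p)\ge 0$. A rational function is a continuous piecewise affine function $f:\Gamma\to\mathbb R$ with integer slopes; $\operatorname{sl}_{p,\nu}(f)$ is its outgoing slope at $p$ along $\nu\in T_p\Gamma$, and $\operatorname{div}(f)=\sum_p\bigl(-\sum_{\nu\in T_p\Gamma}\operatorname{sl}_{p,\nu}(f)\bigr)(p)$. $D\sim E$ means $D-E=\operatorname{div}(f)$ for some rational function $f$. The (Baker–Norine) rank $\mathbf r(D)$ is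 the maximum among $-1$ and the integers $k\ge0$ such that for all $p_1,\dots,p_k\in\Gamma$ the divisor $D-(p_1)-\cdots-(p_k)$ is linearly equivalent to an effective divisor. The canonical divisor is $K=\sum_p(\operatorname{val}(p)-2)(p)$; it has degree $2g-2$ and rank $g-1$. $\Gamma$ is bridgeless if removing any segment of $\Gamma$ consisting entirely of points of valence two yields a connected space. A cut vertex is a point $v\in\Gamma$ such that $\Gamma\setminus\{v\}$ is disconnected. $\Gamma$ (of genus $\ge2$) is hyperelliptic if it has a divisor of degree $2$ and rank $1$. Gap sequences: for $p\in\Gamma$, $\underline n_K(p)=(n_1<\cdots<n_g)$ lists the positive integers $m$ with $\mathbf r(K-m(p))<\mathbf r(K-(m-1)(p))$ (exactly $g$ of them, all $\le 2g-1$), and $\operatorname{wt}_K(p)=\sum_{i=1}^g(n_i-i)$. Let $\mathcal S(g)=\{(n_1,\dots,n_g)\in\mathbb Z^g\mid 1\le n_1<\cdots<n_g\le 2g-1\}$ with the coordinatewise partial order, and for $\underline n\in\mathcal S(g)$ let $\operatorname{WL}_{\ge\underline n}(K)=\{p\in\Gamma\mid\underline n_K(p)\ge\underline n\}$. A closed subset $B\subseteq\Gamma$ is a maximal Weierstrass locus if there is $\underline n\in\mathcal S(g)$ such that $B$ is a connected component of $\operatorname{WL}_{\ge\underline n}(K)$ and $\underline n_K(p)=\underline n$ for all $p\in B$. A maximal Weierstrass point is a point belonging to some maximal Weierstrass locus. *)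

(* Defs.v *)
From HB Require Import structures.
From mathcomp Require Import all_boot all_order all_algebra.
From mathcomp Require Import all_classical all_reals all_analysis.
From mathcomp Require Import freeg.

Set Implicit Arguments.
Unset Strict Implicit.
Unset Printing Implicit Defensive.

Import Order.TTheory GRing.Theory Num.Theory.
Import numFieldNormedType.Exports.

Local Open Scope classical_set_scope.
Local Open Scope ring_scope.

(* A tropical curve is given by a finite connected multigraph (loops allowed) *)
(* with positive edge lengths. Each edge is arbitrarily oriented. The graph   *)
(* must have an edge, so that no point of the curve has valence 0.            *)
Record tropical_curve (R : realType) := TropicalCurve {
  vertex : finType;
  edge : finType;
  src : edge -> vertex;
  tgt : edge -> vertex;
  len : edge -> R;
  len_gt0 : forall e, 0 < len e;
  edge_inhabited : (0 < #|edge|)%N;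
  graph_connected : forall u v : vertex,
    connect (fun x y => [exists e, ((src e == x) && (tgt e == y))
                                || ((src e == y) && (tgt e == x))]) u v
}.

Section Points.
Context {R : realType} (Gamma : tropical_curve R).

(* [inl v] is a vertex; [inr (e, t)] is the point of the open edge e at       *)
(* distance t from src e.                                                     *)
Definition is_point (x : vertex Gamma + edge Gamma * R) : bool :=
  if x is inr (e, t) then 0 < t < len e else true.

Definition point := {x : vertex Gamma + edge Gamma * R | is_point x}.

HB.instance Definition _ := Choice.on point.

Definition vpoint (v : vertex Gamma) : point := exist is_point (inl v) isT.

(* The parametrization of the closed edge e by [0, len e], extended to all of *)
(* R so as to be constant on both sides.                                      *)
Definition edge_path (e : edge Gamma) (t : R) : point :=
  insubd (if t <= 0 then vpoint (src e) else vpoint (tgt e)) (inr (e, t)).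

(* The topology of the length metric: the final topology for the edge         *)
(* parametrizations, i.e. the quotient topology of the gluing of the segments *)
(* [0, len e] along their endpoints.                                          *)
Definition point_open : set_system point :=
  [set U | forall e, open (edge_path e @^-1` U)].

Let point_openT : point_open setT.
Proof. by move=> e; rewrite preimage_setT; exact: openT. Qed.

Let point_openI : setI_closed point_open.
Proof. by move=> A B oA oB e; rewrite preimage_setI; exact: openI. Qed.

Let point_open_bigU (I : Type) (f : I -> set point) :
  (forall i, point_open (f i)) -> point_open (\bigcup_i f i).
Proof.
by move=> of_ e; rewrite preimage_bigcup; apply: bigcup_open => i _; exact: of_.
Qed.

HB.instance Definition _ :=
  isOpenTopological.Build point point_openT point_openI point_open_bigU.

End Points.

Coercion point : tropical_curve >-> Sortclass.

Section TropicalCurve.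
Context {R : realType} {Gamma : tropical_curve R}.
Implicit Types (p : Gamma) (f : Gamma -> R) (D E : {freeg Gamma / int}).

(* A tangent direction is an edge together with a sense of travel: [false]    *)
(* towards tgt, [true] towards src. A loop gives two directions at its vertex. *)
Definition tangent p : {set edge Gamma * bool} :=
  match val p with
  | inl v => finset (fun nu => (if nu.2 then tgt nu.1 else src nu.1) == v)
  | inr (e, _) => finset (fun nu => nu.1 == e)
  end.

Definition valence p : nat := #|tangent p|.

Definition edge_coord p (nu : edge Gamma * bool) : R :=
  match val p with
  | inl _ => if nu.2 then len nu.1 else 0
  | inr (_, t) => t
  end.

(* The point at distance h from p in direction nu, for nu \in tangent p and   *)
(* small h >= 0.                                                              *)
Definition move p (nu : edge Gamma * bool) (h : R) : Gamma :=
  edge_path nu.1 (if nu.2 then edge_coord p nu - h else edge_coord p nu + h).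

(* g is affine with integer slope between any two points of [a, b] that are   *)
(* not separated by one of the finitely many breakpoints in s.                *)
Definition piecewise_affine (g : R -> R) (a b : R) : Prop :=
  exists s : seq R, forall x y, a <= x -> x < y -> y <= b ->
    {in s, forall t, ~~ (x < t < y)} ->
    exists k : int, forall t, x <= t <= y -> g t = g x + k%:~R * (t - x).

Definition rational_function f : Prop :=
  continuous f /\
  forall e : edge Gamma, piecewise_affine (f \o edge_path e) 0 (len e).

(* The default value 0 is not used when f is a rational function.             *)
Definition slope f p (nu : edge Gamma * bool) : int :=
  xget 0 [set k : int | \forall h \near 0^'+, f (move p nu h) = f p + k%:~R * h].

(* The coefficient of div f at p.                                             *)
Definition ord f p : int := - \sum_(nu in tangent p) slope f p nu.

Definition effective D : Prop := forall p, 0 <= coeff p D.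

Definition lin_equiv D E : Prop :=
  exists2 f, rational_function f & forall p, coeff p (D - E) = ord f p.

Definition rank_ge D (k : nat) : Prop :=
  forall ps : k.-tuple Gamma,
    exists2 E, effective E & lin_equiv (D - \sum_(p <- ps) << p >>) E.

Definition rank_set D : set int :=
  [set r | r = -1 \/ exists2 k : nat, r = k%:Z & rank_ge D k].

(* The maximum of rank_set D, which exists since rank_ge D k implies          *)
(* k <= deg D.                                                                *)
Definition rank D : int := xget (-1) (rank_set D `&` ubound (rank_set D)).

(* The interior points of edges have valence 2 and do not contribute.         *)
Definition canonical_divisor : {freeg Gamma / int} :=
  \sum_(v : vertex Gamma) << (valence (vpoint v))%:Z - 2 *g vpoint v >>.

End TropicalCurve.

Section Weierstrass.
Context {R : realType} (Gamma : tropical_curve R).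

(* The cellular boundary map from 1-chains to 0-chains, acting on row vectors. *)
Definition boundary_mx : 'M[R]_(#|edge Gamma|, #|vertex Gamma|) :=
  \matrix_(i, j) ((tgt (enum_val i) == enum_val j)%:R
                  - (src (enum_val i) == enum_val j)%:R).

(* The dimension of H_1(Gamma, R), the space of 1-cycles.                     *)
Definition genus : nat := \rank (kermx boundary_mx).

Definition segment (S : set Gamma) : Prop :=
  exists (a b : R) (c : R -> Gamma),
    [/\ a < b, {within `[a, b], continuous c}, {in `[a, b] &, injective c}
      & S = c @` `[a, b]].

Definition bridgeless : Prop :=
  forall S : set Gamma, segment S -> (forall p, S p -> valence p = 2) ->
    connected (~` S).

Definition cut_vertex (v : Gamma) : Prop := ~ connected (~` [set v]).

Definition hyperelliptic : Prop :=
  (2 <= genus)%N /\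
  exists D : {freeg Gamma / int}, deg D = 2 /\ rank D = 1.

Definition is_gap (p : Gamma) (m : nat) : Prop :=
  (0 < m)%N /\
  rank (canonical_divisor - << m%:Z *g p >>)
    < rank (canonical_divisor - << m%:Z - 1 *g p >>).

(* The increasing list of the gaps at p, of which there are exactly genus; the *)
(* default value is not used.                                                 *)
Definition gap_seq (p : Gamma) : genus.-tuple nat :=
  xget [tuple of nseq genus 0%N]
    [set n : genus.-tuple nat |
      sorted ltn n /\ forall m, m \in n <-> is_gap p m].

(* The coordinates are indexed from 0, so that n_i - i is at index i.-1.      *)
Definition weight (p : Gamma) : int :=
  \sum_(i < genus) ((tnth (gap_seq p) i)%:Z - i.+1%:Z).

Definition tuple_le (g : nat) (n n' : g.-tuple nat) : Prop :=
  forall i, (tnth n i <= tnth n' i)%N.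

Definition gap_shape : set (genus.-tuple nat) :=
  [set n | sorted ltn n /\ {in n, forall k, 1 <= k <= (2 * genus).-1}%N].

Definition weierstrass_ge (n : genus.-tuple nat) : set Gamma :=
  [set p | tuple_le n (gap_seq p)].

Definition maximal_weierstrass_locus (B : set Gamma) : Prop :=
  closed B /\
  exists n, [/\ gap_shape n,
    exists2 x, weierstrass_ge n x & B = connected_component (weierstrass_ge n) x
    & forall p, B p -> gap_seq p = n].

Definition maximal_weierstrass_point (p : Gamma) : Prop :=
  exists2 B, maximal_weierstrass_locus B & B p.

End Weierstrass.

(* Main.v *)
From HB Require Import structures.
Require Import Defs.
From mathcomp Require Import all_boot all_order all_algebra.
From mathcomp Require Import all_classical all_reals all_analysis.
From mathcomp Require Import freeg ring lra zify.
Import Order.TTheory GRing.Theory Num.Theory.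
Import numFieldNormedType.Exports.
Local Open Scope classical_set_scope.
Local Open Scope ring_scope.
Set Implicit Arguments.
Unset Strict Implicit.
Unset Printing Implicit Defensive.

(** In genus 3 the canonical divisor [K] has degree 4 and rank 2, so the gaps at [p] depend only on
    whether [K - 3p] is equivalent to an effective divisor ([flex]), whether [K ~ 4p] ([hyperflex])
    and whether [K - 2p] has rank at least 1 ([branch]). Here [branch] implies [hyperflex], which
    implies [flex], and when there are finitely many hyperflexes the gap sequences are 1,2,3 or
    1,2,4 or 1,2,5 or 1,3,5, of weight 0, 1, 2, 3 ([is_gapE]). The rank of [K], and [K ~ 2D] for [D]
    of degree 2 and rank at least 1, come from [rr_core], the heart of Riemann-Roch: a divisor
    reduced by Dhar's burning algorithm is either effective or lies below the divisor of an acyclic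
    orientation.

    Suppose the hyperflexes are finite in number and share one gap sequence, and every other flex is
    either isolated among the flexes or joined to a hyperflex by a connected set of flexes. Then the
    maximal Weierstrass loci are exactly the single hyperflexes and the single isolated flexes
    ([locus_is_point], [point_is_locus]). It remains to find the flexes and to add up their weights.

    Without cut vertices the graph has neither loops nor leaves. Vertices of valence 2 can be erased
    ([smoothing_induction]), and Euler's relation then leaves at most four vertices. The graph is
    [K4], or it consists of two pairs of parallel edges (the legs) joined at both ends by two
    connectors, possibly of length 0 ([all_classified]). A principal divisor amounts to a potential
    on the vertices with integer slopes on the edges ([principal_balanced]), so [K ~ 3p + q] becomes
    a finite system.

    In [K4] a solution of that system has three vertices at one level and the fourth above them
    ([slopesK4]): the chips lie on the tripod of edges at the fourth vertex, and these edges,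
    shortened by the distances of their chips to the center, have equal lengths. A tripod carries
    either two isolated flexes or one hyperflex, hence weight 2 ([star_pointsP]), and four tripods
    give 8. With connectors of unequal lengths there are two tripods, centered at the ends of the
    longer connector ([raw_tripod]), and one further isolated flex on each of the four legs, at one
    third of its length ([flat_triple]): again 8. With connectors of equal length an involution
    reverses the legs and exchanges the connectors; the midpoints of the four legs are branch points
    of weight 3, the flexes fill the middle thirds of the legs, and the total is 12.

    In the first two cases some [z] admits no [z'] with [K ~ 2z + 2z'], which excludes a divisor of
    degree 2 and rank 1; in the last case [K - 2p] is such a divisor for any midpoint [p]. So the
    cases match the two alternatives of the theorem. *)

(** * Points of a tropical curve in edge coordinates *)

Section Points.
Context {R : realType} {Gamma : tropical_curve R}.
Implicit Types (e : edge Gamma) (t : R) (v : vertex Gamma) (p : Gamma).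

Lemma val_edge_path e t : 0 < t < len e -> val (edge_path e t) = inr (e, t).
Proof. by move=> te; rewrite /edge_path insubdK. Qed.

Lemma edge_path_le0 e t : t <= 0 -> edge_path e t = vpoint (src e).
Proof.
move=> t0; rewrite /edge_path /insubd insubF ?t0//=.
by rewrite ltNge t0.
Qed.

Lemma edge_path_ge e t : len e <= t -> edge_path e t = vpoint (tgt e).
Proof.
move=> tL; rewrite /edge_path /insubd insubF /=; last by rewrite (ltNge t) tL andbF.
by rewrite leNgt (lt_le_trans (len_gt0 e) tL).
Qed.

Variant point_spec : Gamma -> Type :=
  | VertexPoint v : point_spec (vpoint v)
  | EdgePoint e t of 0 < t < len e : point_spec (edge_path e t).

Lemma pointP p : point_spec p.
Proof.
case: p => -[v|[e t]] /= pP.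
  by rewrite (_ : exist _ _ _ = vpoint v); [exact: VertexPoint|exact: val_inj].
rewrite (_ : exist _ _ _ = edge_path e t); first exact: EdgePoint.
by apply: val_inj; rewrite val_edge_path.
Qed.

Lemma vpoint_inj : injective (@vpoint R Gamma).
Proof. by move=> u v /(congr1 val)[]. Qed.

Lemma edge_path_inj e t e' t' : 0 < t < len e -> 0 < t' < len e' ->
  edge_path e t = edge_path e' t' -> e = e' /\ t = t'.
Proof. by move=> te te' /(congr1 val); rewrite !val_edge_path// => -[]. Qed.

Lemma edge_path_eq_vpoint e t v : 0 <= t <= len e ->
  (edge_path e t == vpoint v) =
  ((t == 0) && (src e == v)) || ((t == len e) && (tgt e == v)).
Proof.
move=> /andP[t0 tL]; have L0 := len_gt0 e.
have [->|tn0] := eqVneq t 0.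
  by rewrite edge_path_le0// lt_eqF//= orbF (inj_eq vpoint_inj).
have [->|tnL] := eqVneq t (len e).
  by rewrite edge_path_ge//= (inj_eq vpoint_inj).
by rewrite -val_eqE /= val_edge_path// !lt_neqAle eq_sym tn0 t0 tnL tL.
Qed.

Lemma edge_path_eq e t e' t' : 0 <= t <= len e -> 0 < t' < len e' ->
  (edge_path e t == edge_path e' t') = (e == e') && (t == t').
Proof.
move=> /andP[t0 tL] t'P; rewrite -val_eqE /= (val_edge_path t'P).
have [->|tn0] := eqVneq t 0.
  by rewrite edge_path_le0//= (lt_eqF (proj1 (andP t'P))) andbF.
have [tnL|tnL] := eqVneq t (len e).
  rewrite edge_path_ge ?tnL//=; apply/esym/negP => /andP[/eqP ee' /eqP tt'].
  by move: t'P; rewrite -tt' ee' ltxx andbF.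
by rewrite val_edge_path// !lt_neqAle eq_sym tn0 t0 tnL tL.
Qed.

(** A pair of an edge and a boolean is read as a dart, with the convention of [tangent]; this is the
    vertex that the dart leaves. *)
Definition endpoint (nu : edge Gamma * bool) : vertex Gamma :=
  if nu.2 then tgt nu.1 else src nu.1.

Lemma mem_tangent v nu : (nu \in tangent (vpoint v)) = (endpoint nu == v).
Proof. by rewrite /tangent /= inE. Qed.

(** Since [edge_path e] is constant outside [[0, len e]], clamping carries facts about the closed
    edge over to all real parameters. *)
Definition clamp e t := Num.min (Num.max 0 t) (len e).

Lemma clampP e t : 0 <= clamp e t <= len e.
Proof.
by rewrite /clamp le_min le_max lexx (ltW (len_gt0 e))/= ge_min lexx orbT.
Qed.

Lemma clamp_id e t : 0 <= t <= len e -> clamp e t = t.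
Proof. by move=> /andP[t0 tL]; rewrite /clamp max_r// min_l. Qed.

Lemma edge_path_clamp e t : edge_path e (clamp e t) = edge_path e t.
Proof.
rewrite /clamp; have L0 := ltW (len_gt0 e).
have [t0|t0] := leP t 0.
  by rewrite min_l// !edge_path_le0.
have [tL|tL] := leP t (len e) => //.
by rewrite !edge_path_ge// ltW.
Qed.

Lemma continuous_clamp e : continuous (clamp e).
Proof.
move=> x; apply: continuous_min; last exact: cst_continuous.
by apply: continuous_max; [exact: cst_continuous|exact: cvg_id].
Qed.

Lemma edge_path_continuous e : continuous (@edge_path R Gamma e).
Proof. by apply/continuousP => A oA; exact: oA. Qed.

Lemma continuous_curve (T : topologicalType) (f : Gamma -> T) :
  (forall e, continuous (f \o edge_path e)) -> continuous f.
Proof.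
move=> fe; apply/continuousP => A oA.
suff : point_open (f @^-1` A) by [].
by move=> e; have /continuousP/(_ A oA) := fe e.
Qed.

End Points.

(** * One-sided slopes of piecewise affine functions *)

Section PiecewiseAffine.
Context {R : realType}.
Implicit Types (g h : R -> R) (a b t x y : R) (k : int).

(** Both one-sided slopes are measured in the direction of increasing parameter, so they agree at a
    smooth point. *)
Definition right_slope g t k :=
  exists2 eps, 0 < eps & forall d, 0 <= d <= eps -> g (t + d) = g t + k%:~R * d.

Definition left_slope g t k :=
  exists2 eps, 0 < eps & forall d, 0 <= d <= eps -> g (t - d) = g t - k%:~R * d.

Lemma right_slopeD g h t k l : right_slope g t k -> right_slope h t l ->
  right_slope (fun x => g x + h x) t (k + l).
Proof.
move=> [e e0 ge] [e' e'0 he]; exists (Num.min e e'); first by rewrite lt_min e0.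
move=> d /andP[d0]; rewrite le_min => /andP[de de'].
by rewrite ge ?d0// he ?d0// intrD; ring.
Qed.

Lemma left_slopeD g h t k l : left_slope g t k -> left_slope h t l ->
  left_slope (fun x => g x + h x) t (k + l).
Proof.
move=> [e e0 ge] [e' e'0 he]; exists (Num.min e e'); first by rewrite lt_min e0.
move=> d /andP[d0]; rewrite le_min => /andP[de de'].
by rewrite ge ?d0// he ?d0// intrD; ring.
Qed.

Lemma right_slope_affine (m : int) b t : right_slope (fun x => b + m%:~R * x) t m.
Proof. by exists 1 => // d _; ring. Qed.

Lemma left_slope_affine (m : int) b t : left_slope (fun x => b + m%:~R * x) t m.
Proof. by exists 1 => // d _; ring. Qed.

Lemma right_slope_kink (n : int) c t :
  right_slope (fun x => n%:~R * Num.max 0 (x - c)) t (n *+ (c <= t)%R).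
Proof.
have [ct|tc] := leP c t.
  exists 1 => // d /andP[d0 _]; rewrite !max_r; [by rewrite mulr1n; ring|lra|lra].
exists (c - t); rewrite ?subr_gt0// => d /andP[d0 dc].
by rewrite !max_l; [rewrite mulr0n; ring|lra|lra].
Qed.

Lemma left_slope_kink (n : int) c t :
  left_slope (fun x => n%:~R * Num.max 0 (x - c)) t (n *+ (c < t)%R).
Proof.
have [tc|ct] := leP t c.
  exists 1 => // d /andP[d0 _]; rewrite !max_l; [by rewrite mulr0n; ring|lra|lra].
exists (t - c); rewrite ?subr_gt0// => d /andP[d0 dc].
by rewrite !max_r; [rewrite mulr1n; ring|lra|lra].
Qed.

(** The standard piecewise affine function whose slope jumps by [c.2] at each [c.1] and which
    vanishes to the left of all breakpoints. *)
Definition kinks (cs : seq (R * int)) x : R :=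
  \sum_(c <- cs) c.2%:~R * Num.max 0 (x - c.1).

Lemma right_slope_kinks cs t :
  right_slope (kinks cs) t (\sum_(c <- cs) c.2 *+ (c.1 <= t)%R).
Proof.
elim: cs => [|c cs IH].
  by exists 1 => // d _; rewrite /kinks !big_nil; ring.
rewrite big_cons; case: (right_slopeD (right_slope_kink c.2 c.1 t) IH) => e e0 ge.
by exists e => // d de; rewrite /kinks !big_cons; apply: ge.
Qed.

Lemma left_slope_kinks cs t :
  left_slope (kinks cs) t (\sum_(c <- cs) c.2 *+ (c.1 < t)%R).
Proof.
elim: cs => [|c cs IH].
  by exists 1 => // d _; rewrite /kinks !big_nil; ring.
rewrite big_cons; case: (left_slopeD (left_slope_kink c.2 c.1 t) IH) => e e0 ge.
by exists e => // d de; rewrite /kinks !big_cons; apply: ge.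
Qed.

Lemma piecewise_affineD g h a b : piecewise_affine g a b ->
  piecewise_affine h a b -> piecewise_affine (fun x => g x + h x) a b.
Proof.
move=> [s sP] [s' s'P]; exists (s ++ s') => x y ax xy yb nxy.
have [|k gk] := sP x y ax xy yb; first by move=> t ts; apply: nxy; rewrite mem_cat ts.
have [|l hl] := s'P x y ax xy yb.
  by move=> t ts; apply: nxy; rewrite mem_cat ts orbT.
by exists (k + l) => t txy; rewrite gk// hl// intrD; ring.
Qed.

Lemma piecewise_affine_affine (m : int) c a b :
  piecewise_affine (fun x => c + m%:~R * x) a b.
Proof. by exists [::] => x y _ _ _ _; exists m => t _; ring. Qed.

Lemma piecewise_affine_kinks cs a b : piecewise_affine (kinks cs) a b.
Proof.
elim: cs => [|c cs IH].
  by exists [::] => x y _ _ _ _; exists 0 => t _; rewrite /kinks !big_nil; ring.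
rewrite (_ : kinks _ = fun x => c.2%:~R * Num.max 0 (x - c.1) + kinks cs x); last first.
  by apply/funext => x; rewrite /kinks big_cons.
apply: piecewise_affineD IH; exists [:: c.1] => x y ax xy yb /(_ c.1).
rewrite inE eqxx => /(_ isT); rewrite negb_and -!leNgt => /orP[cx|yc].
  exists c.2 => t /andP[xt ty]; rewrite !max_r; [by ring|lra|lra].
by exists 0 => t /andP[xt ty]; rewrite !max_l; [by ring|lra|lra].
Qed.

Lemma eq_piecewise_affine g h a b : (forall t, a <= t <= b -> g t = h t) ->
  piecewise_affine g a b -> piecewise_affine h a b.
Proof.
move=> gh [s sP]; exists s => x y ax xy yb nxy; have [k gk] := sP x y ax xy yb nxy.
exists k => t txy; rewrite -!gh; [exact: gk|lra|lra].
Qed.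

Lemma right_gap (s : seq R) t b : t < b ->
  exists2 y, t < y <= b & {in s, forall u, ~~ (t < u < y)}.
Proof.
move=> tb; elim: s => [|u s [y /andP[ty yb] ys]].
  by exists b => //; rewrite tb lexx.
have [tu|ut] := ltP t u; last first.
  exists y => [|v]; first by rewrite ty.
  by rewrite inE => /orP[/eqP->|/ys//]; rewrite ltNge ut.
exists (Num.min u y) => [|v]; first by rewrite lt_min tu ty ge_min yb orbT.
rewrite inE => /orP[/eqP->|/ys]; rewrite lt_min ?ltxx ?andbF//.
by apply: contra => /and3P[-> _ ->].
Qed.

Lemma left_gap (s : seq R) a t : a < t ->
  exists2 x, a <= x < t & {in s, forall u, ~~ (x < u < t)}.
Proof.
move=> at_; elim: s => [|u s [x /andP[ax xt] xs]].
  by exists a => //; rewrite at_ lexx.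
have [ut|tu] := ltP u t; last first.
  exists x => [|v]; first by rewrite ax.
  by rewrite inE => /orP[/eqP->|/xs//]; rewrite (ltNge u) tu andbF.
exists (Num.max u x) => [|v]; first by rewrite gt_max ut xt le_max ax orbT.
rewrite inE => /orP[/eqP->|/xs]; rewrite gt_max ?ltxx//.
by apply: contra => /andP[/andP[_ ->] ->].
Qed.

Lemma piecewise_affine_right_slope g a b t : piecewise_affine g a b ->
  a <= t -> t < b -> exists k, right_slope g t k.
Proof.
move=> [s sP] at_ tb; have [y /andP[ty yb] ys] := right_gap s tb.
have [k gk] := sP t y at_ ty yb ys; exists k, (y - t); first by rewrite subr_gt0.
move=> d dy; rewrite gk; [by ring|lra].
Qed.

Lemma piecewise_affine_left_slope g a b t : piecewise_affine g a b ->
  a < t -> t <= b -> exists k, left_slope g t k.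
Proof.
move=> [s sP] at_ tb; have [x /andP[ax xt] xs] := left_gap s at_.
have [k gk] := sP x t ax xt tb xs; exists k, (t - x); first by rewrite subr_gt0.
move=> d dx; rewrite (gk (t - d)) ?(gk t); [by ring|lra|lra].
Qed.

Lemma right_slope_unique g t k l : right_slope g t k -> right_slope g t l -> k = l.
Proof.
move=> [e e0 ge] [e' e'0 ge'].
have m0 : 0 < Num.min e e' by rewrite lt_min e0.
have := ge (Num.min e e'); rewrite ge'; last by rewrite ltW//= ge_min lexx orbT.
rewrite ltW//= ge_min lexx => /(_ isT) /addrI /(mulIf (lt0r_neq0 m0)).
by move=> /eqP; rewrite eqr_int => /eqP.
Qed.

Lemma left_slope_unique g t k l : left_slope g t k -> left_slope g t l -> k = l.
Proof.
move=> [e e0 ge] [e' e'0 ge'].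
have m0 : 0 < Num.min e e' by rewrite lt_min e0.
have := ge (Num.min e e'); rewrite ge'; last by rewrite ltW//= ge_min lexx orbT.
rewrite ltW//= ge_min lexx => /(_ isT) /addrI /oppr_inj /(mulIf (lt0r_neq0 m0)).
by move=> /eqP; rewrite eqr_int => /eqP.
Qed.

(** Breakpoints are removed one at a time: where the two one-sided slopes agree, the affine pieces
    on both sides form a single one. *)
Lemma piecewise_affine_smooth g a b : a < b -> piecewise_affine g a b ->
  (forall t, a < t < b -> exists2 k, left_slope g t k & right_slope g t k) ->
  exists k : int, forall t, a <= t <= b -> g t = g a + k%:~R * (t - a).
Proof.
move=> ab [s sP] smooth; elim: s sP => [|c s IH] sP.
  by have [|k gk] := sP a b (lexx _) ab (lexx _); [|exists k].
apply: IH => x y ax xy yb nxy.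
have [/andP[xc cy]|ncxy] := boolP (x < c < y); last first.
  by apply: sP => // t; rewrite inE => /orP[/eqP->|/nxy].
have [||k1 gk1] := sP x c ax xc; first lra.
  move=> t; rewrite inE => /orP[/eqP->|/nxy]; first by rewrite ltxx andbF.
  by apply: contra => /andP[-> /lt_trans]; apply.
have [||k2 gk2] := sP c y _ cy yb; first lra.
  move=> t; rewrite inE => /orP[/eqP->|/nxy]; first by rewrite ltxx.
  by apply: contra => /andP[ct ->]; rewrite (lt_trans xc).
have [|k lk rk] := smooth c; first lra.
have e1 : k = k1.
  apply: left_slope_unique lk _; exists (c - x); first lra.
  by move=> d dcx; rewrite (gk1 c) ?(gk1 (c - d)); [ring|lra|lra].
have e2 : k = k2.
  apply: right_slope_unique rk _; exists (y - c); first lra.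
  by move=> d dcx; rewrite gk2; [ring|lra].
subst k1 k2; exists k => t /andP[xt ty]; have [tc|ct] := leP t c.
  by rewrite gk1// xt.
rewrite gk2 ?(ltW ct)// gk1; [by ring|lra].
Qed.

End PiecewiseAffine.

Lemma continuous_kinks (R : realType) (cs : seq (R * int)) : continuous (kinks cs).
Proof.
elim: cs => [|c cs IH] x.
  rewrite (_ : kinks _ = cst 0); first exact: cvg_cst.
  by apply/funext => t; rewrite /kinks big_nil.
rewrite (_ : kinks _ = fun t => c.2%:~R * Num.max 0 (t - c.1) + kinks cs t).
  apply: cvgD; last exact: IH.
  apply: cvgM; first exact: cvg_cst.
  apply: (@continuous_max _ _ (fun=> 0) (fun t => t - c.1)); first exact: cst_continuous.
  by apply: cvgB; [exact: cvg_id|exact: cvg_cst].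
by apply/funext => t; rewrite /kinks big_cons.
Qed.

(** * Principal divisors as potentials with integer slopes *)

Section Principal.
Context {R : realType} {Gamma : tropical_curve R}.
Implicit Types (e : edge Gamma) (t : R) (v : vertex Gamma) (p : Gamma).
Implicit Types (f : Gamma -> R) (cs : seq (edge Gamma * R * int)).
Implicit Types (Z D E : {freeg Gamma / int}).

Definition principal Z :=
  exists2 f, rational_function f & forall p, coeff p Z = ord f p.

(** [slope] selects some integer valid near [0]; any two such integers agree at a small positive
    [h], so exhibiting one determines the value. *)
Lemma slopeE f p nu (k : int) :
  (exists2 eps, 0 < eps &
     forall d, 0 <= d <= eps -> f (move p nu d) = f p + k%:~R * d) ->
  slope f p nu = k.
Proof.
move=> [eps eps0 feps].
have fk : \forall h \near 0^'+, f (move p nu h) = f p + k%:~R * h.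
  near=> h; apply: feps; apply/andP; split; first by near: h; exact: nbhs_right_ge.
  by near: h; exact: nbhs_right_le.
rewrite /slope; case: xgetP => [l _ /= fl|/(_ k)/= //].
have /filter_ex[h [h0 [fkh flh]]] : \forall h \near 0^'+, 0 < h /\
    (f (move p nu h) = f p + k%:~R * h /\ f (move p nu h) = f p + l%:~R * h).
  by near=> h; do 2?[split]; near: h => //; exact: nbhs_right_gt.
move: fkh; rewrite flh => /addrI /(mulIf (lt0r_neq0 h0)) /eqP.
by rewrite eqr_int => /eqP.
Unshelve. all: by end_near. Qed.

Lemma ord_edge f e t : 0 < t < len e -> ord f (edge_path e t) =
  - (slope f (edge_path e t) (e, false) + slope f (edge_path e t) (e, true)).
Proof.
move=> te; have pv := val_edge_path te.
rewrite /ord (_ : tangent _ = [set (e, false); (e, true)]%SET).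
  by rewrite big_setU1 ?big_set1 ?inE ?xpair_eqE ?andbF.
by apply/setP => -[e' b]; rewrite /tangent pv !inE !xpair_eqE; case: b; case: eqP.
Qed.

Definition chips_on cs e : seq (R * int) :=
  [seq (c.1.2, c.2) | c <- cs & c.1.1 == e].

Lemma sum_chips_on (V : zmodType) cs e (F : R * int -> V) :
  \sum_(c <- chips_on cs e) F c = \sum_(c <- cs | c.1.1 == e) F (c.1.2, c.2).
Proof. by rewrite /chips_on big_map big_filter. Qed.

Definition on_curve cs := all (fun c => 0 <= c.1.2 <= len c.1.1) cs.

Lemma on_curveP cs c : on_curve cs -> c \in cs -> 0 <= c.1.2 <= len c.1.1.
Proof. by move=> /allP; apply. Qed.

Definition chip_div cs : {freeg Gamma / int} :=
  \sum_(c <- cs) << c.2 *g edge_path c.1.1 c.1.2 >>.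

Lemma coeff_chip_div cs p :
  coeff p (chip_div cs) = \sum_(c <- cs) c.2 *+ (edge_path c.1.1 c.1.2 == p).
Proof.
rewrite /chip_div raddf_sum; apply: eq_bigr => c _; rewrite /= coeffU.
by case: eqP => _; rewrite ?mulr1 ?mulr0.
Qed.

(** An interior point of [e] lies on no other edge, so the jump of the slope of [kinks] at [t]
    counts precisely the chips at that point. *)
Lemma sum_chips_at cs e t : on_curve cs -> 0 < t < len e ->
  \sum_(c <- cs | c.1.1 == e) c.2 *+ (c.1.2 <= t)%R
    - \sum_(c <- cs | c.1.1 == e) c.2 *+ (c.1.2 < t)%R =
  \sum_(c <- cs) c.2 *+ (edge_path c.1.1 c.1.2 == edge_path e t).
Proof.
move=> cs_on te; rewrite -sumrB big_mkcond /=.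
apply: eq_big_seq => c ccs; rewrite edge_path_eq ?(on_curveP cs_on ccs)//.
case: eqP => [ce|_]; last by rewrite mulr0n.
rewrite lt_neqAle; case: eqP => [->|_] /=; rewrite ?lexx ?subr0 ?mulr0n ?subrr ?andbF//.
Qed.

(* The slope leaving the end of e where the travel nu starts, of the function *)
(* a e * t + kinks (chips_on cs e) t, if no chip is at that end.              *)
Definition out_slope cs (a : edge Gamma -> int) (nu : edge Gamma * bool) : int :=
  if nu.2 then - a nu.1 - \sum_(c <- cs | c.1.1 == nu.1) c.2 else a nu.1.

Section OrdFormula.
Variables (f : Gamma -> R) (cs : seq (edge Gamma * R * int)).
Variable a : edge Gamma -> int.
Hypothesis cs_on : on_curve cs.
Hypothesis fE : forall e t, 0 <= t <= len e -> f (edge_path e t) =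
  f (vpoint (src e)) - ((a e)%:~R * t + kinks (chips_on cs e) t).

Let g e t := f (vpoint (src e)) - ((a e)%:~R * t + kinks (chips_on cs e) t).

Let right_g e t :
  right_slope (g e) t (- (a e + \sum_(c <- cs | c.1.1 == e) c.2 *+ (c.1.2 <= t)%R)).
Proof.
have [eps eps0 He] := right_slopeD (right_slope_affine (a e) 0 t)
  (right_slope_kinks (chips_on cs e) t).
exists eps => // d /He; rewrite /g sum_chips_on /= !add0r => ->.
by rewrite mulrNz; ring.
Qed.

Let left_g e t :
  left_slope (g e) t (- (a e + \sum_(c <- cs | c.1.1 == e) c.2 *+ (c.1.2 < t)%R)).
Proof.
have [eps eps0 He] := left_slopeD (left_slope_affine (a e) 0 t)
  (left_slope_kinks (chips_on cs e) t).
exists eps => // d /He; rewrite /g sum_chips_on /= !add0r => ->.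
by rewrite mulrNz; ring.
Qed.

Lemma slope_forward p e t k : 0 <= t < len e -> p = edge_path e t ->
  edge_coord p (e, false) = t -> right_slope (g e) t k -> slope f p (e, false) = k.
Proof.
move=> /andP[t0 tL] pE pt [eps eps0 ge]; apply: slopeE.
exists (Num.min eps (len e - t)); first by rewrite lt_min eps0 subr_gt0.
move=> d /andP[d0]; rewrite le_min => /andP[de dt].
have fg u : 0 <= u <= len e -> f (edge_path e u) = g e u by exact: fE.
by rewrite /move /= pt pE !fg ?ge ?d0//; lra.
Qed.

Lemma slope_backward p e t k : 0 < t <= len e -> p = edge_path e t ->
  edge_coord p (e, true) = t -> left_slope (g e) t k -> slope f p (e, true) = - k.
Proof.
move=> /andP[t0 tL] pE pt [eps eps0 ge]; apply: slopeE.
exists (Num.min eps t); first by rewrite lt_min eps0.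
move=> d /andP[d0]; rewrite le_min => /andP[de dt].
have fg u : 0 <= u <= len e -> f (edge_path e u) = g e u by exact: fE.
by rewrite /move /= pt pE !fg ?ge ?d0// ?mulrNz ?mulNr//; lra.
Qed.

(** [ord] is minus the sum of the outgoing slopes, hence the minus sign in [fE]: a chip of
    multiplicity [n] lowers the slope of [f] by [n]. *)
Lemma edgewise_ord_edge e t : 0 < t < len e ->
  ord f (edge_path e t) = coeff (edge_path e t) (chip_div cs).
Proof.
move=> te; have [t0 tL] := andP te.
have pv := val_edge_path te.
rewrite ord_edge//.
rewrite (slope_forward _ _ _ (@right_g e t))// ?(ltW t0) ?tL//; last first.
  by rewrite /edge_coord pv.
rewrite (slope_backward _ _ _ (@left_g e t))// ?(ltW tL) ?t0//; last first.
  by rewrite /edge_coord pv.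
rewrite coeff_chip_div opprD !opprK.
by rewrite opprD addrACA subrr add0r sum_chips_at.
Qed.



(** A chip may sit at an end of its edge, where it alters the outgoing slope of [f]. [out_slope]
    disregards such chips, and the correction is the coefficient of [chip_div cs] at [v]. *)
Lemma edgewise_ord_vertex v : ord f (vpoint v) =
  coeff (vpoint v) (chip_div cs) + \sum_(nu in tangent (vpoint v)) out_slope cs a nu.
Proof.
have slopeV nu : nu \in tangent (vpoint v) -> - slope f (vpoint v) nu =
    out_slope cs a nu + \sum_(c <- cs)
      c.2 *+ ((c.1.1 == nu.1) && (c.1.2 == if nu.2 then len nu.1 else 0)).
  rewrite mem_tangent; case: nu => e [] /eqP/= ve.
  - rewrite (slope_backward _ _ _ (@left_g e (len e))) ?lexx ?len_gt0//; last first.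
      by rewrite edge_path_ge// -ve.
    rewrite opprK /out_slope /= opprD -addrA; congr (_ + _).
    rewrite [X in _ = - X + _]big_mkcond [X in - X = _]big_mkcond.
    rewrite -!sumrN -big_split; apply: eq_big_seq => c ccs /=.
    have := on_curveP cs_on ccs; case: eqP => [->|_ _]; last by rewrite oppr0 addr0.
    move=> /andP[_ cL]; rewrite lt_neqAle cL andbT.
    by case: eqP => _; rewrite ?mulr0n ?mulr1n ?oppr0 ?addNr ?addr0.
  - rewrite (slope_forward _ _ _ (@right_g e 0)) ?lexx ?len_gt0//; last first.
      by rewrite edge_path_le0// -ve.
    rewrite opprK /out_slope /=; congr (_ + _).
    rewrite big_mkcond; apply: eq_big_seq => c ccs /=.
    have := on_curveP cs_on ccs; case: eqP => //= _ /andP[c0 _].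
    by rewrite eq_le c0 andbT.
rewrite /ord -sumrN (eq_bigr _ slopeV) big_split addrC; congr (_ + _).
rewrite exchange_big coeff_chip_div; apply: eq_big_seq => c ccs /=.
rewrite edge_path_eq_vpoint ?(on_curveP cs_on ccs)//.
rewrite big_mkcond /=.
rewrite (eq_bigr (fun nu : edge Gamma * bool => if (nu.1, nu.2) \in tangent (vpoint v) then
  c.2 *+ ((c.1.1 == nu.1) && (c.1.2 == if nu.2 then len nu.1 else 0)) else 0)); last by case.
rewrite -(pair_bigA _ (fun e b => if (e, b) \in tangent (vpoint v) then
  c.2 *+ ((c.1.1 == e) && (c.1.2 == if b then len e else 0)) else 0)) /=.
rewrite (bigD1 c.1.1)//= [X in _ + X]big1 => [|e /negbTE]; last first.
  by rewrite eq_sym => ne; rewrite big1// => b _; rewrite ne mulr0n if_same.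
rewrite addr0 big_bool eqxx !mem_tangent /endpoint /=.
have := len_gt0 c.1.1; case: (c.1.2 =P 0) => [->|_] L0 /=.
  by rewrite lt_eqF//= mulr0n if_same add0r orbF; case: eqP.
by rewrite !mulr0n !if_same addr0; case: eqP => //= _; case: eqP.
Qed.

Lemma edgewise_rational : rational_function f.
Proof.
have fC e t : f (edge_path e t) = g e (clamp e t).
  by rewrite -edge_path_clamp fE// clampP.
split=> [|e]; last first.
  apply: (@eq_piecewise_affine _ (g e)) => [t te|]; first by rewrite /= fE.
  rewrite (_ : g e = fun t => (f (vpoint (src e)) + (- a e)%:~R * t) +
    kinks [seq (c.1, - c.2) | c <- chips_on cs e] t).
    by apply: piecewise_affineD; [exact: piecewise_affine_affine|exact: piecewise_affine_kinks].
  apply/funext => t; rewrite /g /kinks [in RHS]big_map /= opprD mulrNz mulNr addrA; congr (_ + _).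
  by rewrite -sumrN; apply: eq_bigr => c _; rewrite mulrNz mulNr.
apply: continuous_curve => e.
rewrite (_ : _ \o _ = g e \o clamp e); last by apply/funext => t /=; rewrite fC.
move=> x; apply: continuous_comp; first exact: continuous_clamp.
apply: cvgB; first exact: cvg_cst.
apply: cvgD; first by apply: cvgM; [exact: cvg_cst|exact: cvg_id].
exact: continuous_kinks.
Qed.

End OrdFormula.

Lemma kinks_chips_on_len cs e : on_curve cs ->
  kinks (chips_on cs e) (len e) = \sum_(c <- cs | c.1.1 == e) c.2%:~R * (len e - c.1.2).
Proof.
move=> cs_on; rewrite /kinks sum_chips_on [LHS]big_mkcond [RHS]big_mkcond.
apply: eq_big_seq => c ccs /=; have := on_curveP cs_on ccs.
by case: eqP => // -> /andP[_ cL]; rewrite max_r// subr_ge0.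
Qed.

Lemma kinks_chips_on0 cs e t : on_curve cs -> t <= 0 -> kinks (chips_on cs e) t = 0.
Proof.
move=> cs_on t0; rewrite /kinks sum_chips_on big_mkcond big1_seq// => c /andP[_ ccs].
have := on_curveP cs_on ccs; case: eqP => //= _ /andP[c0 _].
by rewrite max_l ?mulr0//; lra.
Qed.

(* A vertex chip may also be listed as a chip at an end of an edge. *)
Definition vertex_div (z : vertex Gamma -> int) : {freeg Gamma / int} :=
  \sum_(v : vertex Gamma) << z v *g vpoint v >>.

Lemma coeff_vertex_div z v : coeff (vpoint v) (vertex_div z) = z v.
Proof.
rewrite raddf_sum (bigD1 v)//= coeffU eqxx mulr1 big1 ?addr0// => u uv.
by rewrite coeffU (inj_eq vpoint_inj) (negbTE uv) mulr0.
Qed.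

Lemma coeff_vertex_div_edge z e t : 0 < t < len e ->
  coeff (edge_path e t) (vertex_div z) = 0.
Proof.
move=> te; rewrite raddf_sum big1//= => v _; rewrite coeffU eq_sym.
rewrite edge_path_eq_vpoint; last by move: te => /andP[/ltW-> /ltW->].
by move: te => /andP[/gt_eqF-> /lt_eqF->]; rewrite mulr0.
Qed.

(** [G] is minus the rational function at the vertices and [a e] the slope of minus the function
    leaving [src e], apart from chips at that end. The first clause integrates this slope along
    [e]. *)
Definition balanced cs (z : vertex Gamma -> int) (G : vertex Gamma -> R)
    (a : edge Gamma -> int) : Prop :=
  (forall e, G (tgt e) = G (src e) + (a e)%:~R * len e
     + \sum_(c <- cs | c.1.1 == e) c.2%:~R * (len e - c.1.2)) /\
  forall v, \sum_(nu in tangent (vpoint v)) out_slope cs a nu = z v.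

(** Linear equivalence becomes a finite system because a rational function with a prescribed divisor
    is determined on each edge by its value and slope at [src]. *)
Lemma principal_balanced cs z : on_curve cs ->
  principal (vertex_div z + chip_div cs) <-> exists G a, balanced cs z G a.
Proof.
move=> cs_on; split=> [[f [fC fpa] ford]|[G [a [GE az]]]]; last first.
  pose f (p : Gamma) : R := match val p with
    | inl v => - G v
    | inr (e, t) => - (G (src e) + (a e)%:~R * t + kinks (chips_on cs e) t)
    end.
  have fE e t : 0 <= t <= len e -> f (edge_path e t) =
      f (vpoint (src e)) - ((a e)%:~R * t + kinks (chips_on cs e) t).
    move=> /andP[t0 tL]; have [->|tn0] := eqVneq t 0.
      by rewrite edge_path_le0// kinks_chips_on0//; ring.
    have [->|tnL] := eqVneq t (len e).
      by rewrite edge_path_ge// kinks_chips_on_len// /f /= GE; ring.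
    by rewrite {1}/f val_edge_path ?lt_neqAle 1?eq_sym ?tn0 ?t0 ?tnL//= /f /=; ring.
  exists f; first exact: edgewise_rational fE.
  move=> p; case: (pointP p) => [v|e t te]; rewrite coeffD.
    by rewrite (edgewise_ord_vertex cs_on fE) az coeff_vertex_div addrC.
  by rewrite (edgewise_ord_edge cs_on fE)// coeff_vertex_div_edge// add0r.
have /choice[a fE] : forall e, exists k : int, forall t, 0 <= t <= len e ->
    f (edge_path e t) = f (vpoint (src e)) - (k%:~R * t + kinks (chips_on cs e) t).
  (* Adding the kinks of the prescribed chips cancels every change of slope of [f] inside [e], so
     [h] is affine on the whole edge. *)
  move=> e; pose h t := f (edge_path e t) + kinks (chips_on cs e) t.
  have hpa : piecewise_affine h 0 (len e).
    by apply: piecewise_affineD; [exact: fpa|exact: piecewise_affine_kinks].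
  have [|k hk] := piecewise_affine_smooth (len_gt0 e) hpa; last first.
    exists (- k) => t te; have H := hk t te.
    rewrite /h subr0 (kinks_chips_on0 _ cs_on (lexx 0)) addr0 (edge_path_le0 e (lexx 0)) in H.
    by rewrite -[LHS](addrK (kinks (chips_on cs e) t)) H mulrNz; ring.
  move=> t /[dup] te /andP[t0 tL].
  have [kr fr] := piecewise_affine_right_slope (fpa e) (ltW t0) tL.
  have [kl fl] := piecewise_affine_left_slope (fpa e) t0 (ltW tL).
  have pv := val_edge_path te.
  have sr : slope f (edge_path e t) (e, false) = kr.
    apply: slopeE; case: fr => eps eps0 He; exists eps => // d /He.
    by rewrite /move /edge_coord pv.
  have sl : slope f (edge_path e t) (e, true) = - kl.
    apply: slopeE; case: fl => eps eps0 He; exists eps => // d /He.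
    by rewrite /move /edge_coord pv mulrNz mulNr.
  have ordE := ord_edge f te; rewrite sr sl in ordE.
  have := ford (edge_path e t); rewrite coeffD coeff_vertex_div_edge// add0r ordE.
  rewrite coeff_chip_div => nE.
  exists (kl + \sum_(c <- chips_on cs e) c.2 *+ (c.1 < t)%R).
    exact: left_slopeD fl (left_slope_kinks _ _).
  rewrite (_ : _ + _ = kr + \sum_(c <- chips_on cs e) c.2 *+ (c.1 <= t)%R).
    exact: right_slopeD fr (right_slope_kinks _ _).
  have := sum_chips_at cs_on te; rewrite !sum_chips_on nE /=.
by set S1 := \sum_(c <- cs | _) _; set S2 := \sum_(c <- cs | _) _; lia.
exists (fun v => - f (vpoint v)), a; split=> [e|v].
  have := fE e (len e); rewrite lexx (ltW (len_gt0 e)) kinks_chips_on_len// => /(_ isT).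
  by rewrite edge_path_ge// => ->; ring.
have := ford (vpoint v); rewrite coeffD coeff_vertex_div (edgewise_ord_vertex cs_on fE).
by rewrite addrC => /addrI.
Qed.

End Principal.

(** * The group of principal divisors, and effective divisors *)

Section Divisors.
Context {R : realType} {Gamma : tropical_curve R}.
Implicit Types (e : edge Gamma) (t : R) (v : vertex Gamma) (p : Gamma).
Implicit Types (cs : seq (edge Gamma * R * int)).
Implicit Types (Z D E : {freeg Gamma / int}) (s : seq Gamma).

Lemma div_decomp Z : exists z cs, on_curve cs /\ Z = vertex_div z + chip_div cs.
Proof.
rewrite -[Z]freeg_sumE; elim: (dom Z) => [|p s [z [cs [cs_on IH]]]].
  exists (fun=> 0), [::]; split=> //; rewrite big_nil /chip_div big_nil addr0.
  by rewrite /vertex_div big1// => v _; rewrite freegU0.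
rewrite big_cons IH; case: (pointP p) => [v|e t te]; last first.
  exists z, ((e, t, coeff (edge_path e t) Z) :: cs); split.
    by rewrite /= cs_on andbT; move: te => /andP[/ltW-> /ltW->].
  by rewrite /chip_div big_cons /= addrCA.
exists (fun u => z u + coeff (vpoint v) Z *+ (v == u)), cs; split=> //.
rewrite addrA; congr (_ + _); rewrite /vertex_div.
under [RHS]eq_bigr do rewrite -freegUD; rewrite big_split addrC /=; congr (_ + _).
rewrite (bigD1 v)//= eqxx big1 ?addr0// => u; rewrite eq_sym => /negbTE->.
by rewrite mulr0n freegU0.
Qed.

Lemma balanced_cat cs cs' z z' G G' a a' : balanced cs z G a -> balanced cs' z' G' a' ->
  balanced (cs ++ cs') (fun v => z v + z' v) (fun v => G v + G' v) (fun e => a e + a' e).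
Proof.
move=> [GE zE] [G'E z'E]; split=> [e|v].
  by rewrite GE G'E big_cat /= intrD; ring.
rewrite -zE -z'E -big_split; apply: eq_bigr => nu _; rewrite /out_slope /=.
by case: nu.2; rewrite // big_cat /= !opprD addrACA.
Qed.

Definition chip_opp cs := [seq (c.1, - c.2) | c <- cs].

Lemma balanced_opp cs z G a : balanced cs z G a ->
  balanced (chip_opp cs) (fun v => - z v) (fun v => - G v) (fun e => - a e).
Proof.
move=> [GE zE]; split=> [e|v].
  rewrite GE big_map /= mulrNz mulNr !opprD -sumrN; congr (_ + _).
  by apply: eq_bigr => c _; rewrite mulrNz mulNr.
rewrite -zE -sumrN; apply: eq_bigr => nu _; rewrite /out_slope.
by case: nu.2; rewrite // big_map sumrN opprD.
Qed.

Lemma chip_div_cat cs cs' : chip_div (cs ++ cs') = chip_div cs + chip_div cs'.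
Proof. exact: big_cat. Qed.

Lemma chip_div_opp cs : chip_div (chip_opp cs) = - chip_div cs.
Proof. by rewrite /chip_div big_map -sumrN; apply: eq_bigr => c _; rewrite freegUN. Qed.

Lemma vertex_divD (z z' : vertex Gamma -> int) :
  vertex_div (fun v => z v + z' v) = vertex_div z + vertex_div z'.
Proof. by rewrite /vertex_div -big_split; apply: eq_bigr => v _; rewrite /= freegUD. Qed.

Lemma vertex_divN (z : vertex Gamma -> int) :
  vertex_div (fun v => - z v) = - vertex_div z.
Proof. by rewrite /vertex_div -sumrN; apply: eq_bigr => v _; rewrite freegUN. Qed.

Lemma on_curve_opp cs : on_curve (chip_opp cs) = on_curve cs.
Proof. by rewrite /on_curve all_map. Qed.

Lemma principalD Z Z' : principal Z -> principal Z' -> principal (Z + Z').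
Proof.
have [z [cs [cs_on ->]]] := div_decomp Z; have [z' [cs' [cs'_on ->]]] := div_decomp Z'.
move=> /(principal_balanced z cs_on)[G [a b]] /(principal_balanced z' cs'_on)[G' [a' b']].
rewrite addrACA -vertex_divD -chip_div_cat; apply/principal_balanced.
  by rewrite /on_curve all_cat -!/(on_curve _) cs_on.
by exists (fun v => G v + G' v), (fun e => a e + a' e); exact: balanced_cat.
Qed.

Lemma principalN Z : principal Z -> principal (- Z).
Proof.
have [z [cs [cs_on ->]]] := div_decomp Z.
move=> /(principal_balanced z cs_on)[G [a b]].
rewrite opprD -vertex_divN -chip_div_opp; apply/principal_balanced.
  by rewrite on_curve_opp.
by exists (fun v => - G v), (fun e => - a e); exact: balanced_opp.
Qed.

Lemma principalB Z Z' : principal Z -> principal Z' -> principal (Z - Z').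
Proof. by move=> pZ /principalN; exact: principalD. Qed.

Lemma deg_vertex_div (z : vertex Gamma -> int) : deg (vertex_div z) = \sum_v z v.
Proof. by rewrite raddf_sum; apply: eq_bigr => v _; rewrite /= degU. Qed.

Lemma deg_chip_div cs : deg (chip_div cs) = \sum_(c <- cs) c.2.
Proof. by rewrite raddf_sum; apply: eq_bigr => c _; rewrite /= degU. Qed.

Lemma sum_tangent (M : zmodType) (F : edge Gamma * bool -> M) :
  \sum_v \sum_(nu in tangent (vpoint v)) F nu = \sum_e (F (e, true) + F (e, false)).
Proof.
rewrite (exchange_big_dep xpredT)//= (eq_bigr F) => [|nu _]; last first.
  by apply: big_pred1 => v; rewrite mem_tangent eq_sym.
by rewrite (eq_bigr (fun nu => F (nu.1, nu.2))) => [|[]//]; rewrite -(pair_bigA _ (fun e b => F (e, b)));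
  apply: eq_bigr => e _; rewrite big_bool.
Qed.

(** The slopes leaving the two ends of an edge add up to minus the chips on it, so the vertex
    coefficients and the chips cancel in total. *)
Lemma deg_principal Z : principal Z -> deg Z = 0.
Proof.
have [z [cs [cs_on ->]]] := div_decomp Z.
move=> /(principal_balanced z cs_on)[G [a [_ zE]]].
rewrite degD deg_vertex_div deg_chip_div -(eq_bigr _ (fun v _ => zE v)).
rewrite sum_tangent (eq_bigr (fun e => - \sum_(c <- cs | c.1.1 == e) c.2)); last first.
  by move=> e _; rewrite /out_slope /=; ring.
rewrite sumrN [X in - X](exchange_big_dep xpredT)//=; apply/eqP; rewrite addrC subr_eq0; apply/eqP.
by apply: eq_bigr => c _; rewrite (big_pred1 c.1.1)// => e; rewrite eq_sym.
Qed.

Definition points s : {freeg Gamma / int} := \sum_(p <- s) << p >>.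

Lemma points_cons p s : points (p :: s) = << p >> + points s.
Proof. exact: big_cons. Qed.

Lemma points1 p : points [:: p] = << p >>.
Proof. exact: big_seq1. Qed.

Lemma points_nil : points [::] = 0.
Proof. exact: big_nil. Qed.

Lemma deg_points s : deg (points s) = (size s)%:Z.
Proof.
rewrite raddf_sum /= (eq_bigr (fun=> 1)) => [|p _]; last by rewrite degU.
by rewrite big_const_seq count_predT; elim: (size s) => //= n ->; lia.
Qed.

Lemma effective_points s : effective (points s).
Proof.
move=> p; rewrite raddf_sum; apply: sumr_ge0 => q _; rewrite /= coeffU mul1r.
exact: ler0n.
Qed.

Lemma effectiveP E : effective E -> exists s, E = points s.
Proof.
move=> E0; rewrite -[E]freeg_sumE; elim: (dom E) => [|p s [s' IH]].
  by exists [::]; rewrite big_nil points_nil.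
have := E0 p; rewrite big_cons IH; case: (coeff p E) => // n _.
exists (nseq n p ++ s'); rewrite /points big_cat /=; congr (_ + _).
elim: n => [|n IHn]; first by apply/eqP; rewrite big_nil freegU_eq0.
by rewrite big_cons -IHn freegUD.
Qed.

End Divisors.

(** * Firing and reduced divisors *)

Lemma finite_lower_bound (R : realType) (T : finType) (f : T -> R) :
  (forall x, 0 < f x) -> exists2 eps, 0 < eps & forall x, eps <= f x.
Proof.
move=> f0; exists (\big[Num.min/1]_x f x).
  by apply: (big_ind (fun y => 0 < y)) => // x y x0 y0; rewrite lt_min x0.
by move=> x; rewrite (bigD1 x)//= ge_min lexx.
Qed.

Section RiemannRoch.
Context {R : realType} {Gamma : tropical_curve R}.
Implicit Types (e : edge Gamma) (t : R) (v w : vertex Gamma) (p : Gamma).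
Implicit Types (cs : seq (edge Gamma * R * int)) (nu : edge Gamma * bool).
Implicit Types (F G : vertex Gamma -> R) (d : vertex Gamma -> int).

Definition other nu : vertex Gamma := endpoint (nu.1, ~~ nu.2).

Definition grad F nu : R := (F (other nu) - F (endpoint nu)) / len nu.1.

(** [F] is extended into each edge with slope [ceil (grad F nu)] leaving either end. The two pieces
    coincide when the gradient is an integer and otherwise meet at one interior point. [firing F v]
    is the number of chips that [v] gives away. *)
Definition firing F v : int := \sum_(nu in tangent (vpoint v)) Num.ceil (grad F nu).

(** After firing, [d - firing F] has no debt away from the base vertex [v0]. *)
Definition fires_off d v0 F := forall v, v != v0 -> firing F v <= d v.

Lemma grad_rev F e : grad F (e, true) = - grad F (e, false).
Proof. by rewrite /grad -mulNr opprB. Qed.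

Lemma ceilN_ge0 (x : R) : 0 <= Num.ceil x + Num.ceil (- x).
Proof.
rewrite -(ler_int R) intrD; have := ceil_ge x; have := ceil_ge (- x); lra.
Qed.

Lemma ceilN_le1 (x : R) : Num.ceil x + Num.ceil (- x) <= 1.
Proof.
rewrite -ltzD1 -(ltr_int R) !intrD.
have := ceilB1_lt x; have := ceilB1_lt (- x).
rewrite !intrD; lra.
Qed.

(** The edges whose gradient is not an integer; firing leaves one chip inside each of them. *)
Definition broken F e : bool := Num.ceil (grad F (e, false)) + Num.ceil (grad F (e, true)) != 0.

Lemma brokenE F e :
  Num.ceil (grad F (e, false)) + Num.ceil (grad F (e, true)) = (broken F e)%:Z.
Proof.
rewrite /broken grad_rev; set x := grad _ _.
have := ceilN_ge0 x; have := ceilN_le1 x; case: eqP => [->//|/=]; lia.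
Qed.

Lemma broken_lt F nu : broken F nu.1 -> grad F nu < (Num.ceil (grad F nu))%:~R.
Proof.
move=> br; rewrite lt_neqAle ceil_ge andbT; apply: contraTneq br => gE.
rewrite /broken negbK; case: nu gE => e [] /= gE; last first.
  by rewrite grad_rev gE -intrN !intrKceil subrr.
have -> : grad F (e, false) = - grad F (e, true) by rewrite grad_rev opprK.
by rewrite gE -intrN !intrKceil addNr.
Qed.

Section Bounded.
Variables (d : vertex Gamma -> int) (v0 : vertex Gamma).

Let M := \sum_v `|d v|.

(** The vertices below level [c] give away at most [M] chips altogether. Edges between two of them
    contribute at least 0 and edges leaving the level set contribute a positive amount, so no single
    one of these exceeds [M]. *)
Lemma flux_bound F c nu : fires_off d v0 F -> c <= F v0 ->
  F (endpoint nu) < c -> c <= F (other nu) -> Num.ceil (grad F nu) <= M.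
Proof.
move=> Fd c0 nuc cnu.
pose H mu := if F (endpoint mu) < c then Num.ceil (grad F mu) else 0.
have pos e : 0 <= H (e, true) + H (e, false).
  rewrite /H; case: ltP => ct; case: ltP => cs_; rewrite ?add0r ?addr0//.
  - by rewrite grad_rev addrC ceilN_ge0.
  - apply/ltW; rewrite -(ltr_int R); apply: lt_le_trans (ceil_ge _).
    by rewrite divr_gt0 ?len_gt0// subr_gt0 (lt_le_trans ct).
  - apply/ltW; rewrite -(ltr_int R); apply: lt_le_trans (ceil_ge _).
    by rewrite divr_gt0 ?len_gt0// subr_gt0 (lt_le_trans cs_).
have sumH : \sum_v \sum_(mu in tangent (vpoint v)) H mu <= M.
  apply: ler_sum => v _; have [vc|cv] := ltP (F v) c.
    apply: le_trans (ler_norm (d v)); apply: le_trans (Fd v _).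
      by apply: ler_sum => mu; rewrite mem_tangent /H => /eqP->; rewrite vc.
    by apply: contraTneq vc => ->; rewrite -leNgt.
  rewrite big1// => mu; rewrite mem_tangent /H => /eqP->.
  by rewrite ltNge cv.
apply: le_trans sumH; rewrite sum_tangent (bigD1 nu.1)//=.
rewrite -[leLHS]addr0 lerD//; last exact: sumr_ge0.
rewrite /H; move: nuc cnu; case: nu => e [] /= ec ce; rewrite ec ltNge ce /=;
  by rewrite ?addr0 ?add0r.
Qed.

(** The bound spreads along a path from [v0]: over one edge the potential falls below earlier bounds
    by at most [M] times the length. *)
Lemma fires_off_bounded v : exists B : R, forall F, fires_off d v0 F -> F v0 = 0 -> B <= F v.
Proof.
have step u w : (exists e, ((src e == u) && (tgt e == w)) || ((src e == w) && (tgt e == u))) ->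
    (exists B : R, forall F, fires_off d v0 F -> F v0 = 0 -> B <= F u) ->
    (exists B : R, forall F, fires_off d v0 F -> F v0 = 0 -> B <= F w).
  move=> [e ee] [B HB].
  have [nu [nuw nuu]] : exists nu, endpoint nu = w /\ other nu = u.
    case/orP: ee => /andP[/eqP se /eqP te].
      by exists (e, true); rewrite /other /endpoint /=.
    by exists (e, false); rewrite /other /endpoint /=.
  exists (Num.min B 0 - `|M%:~R| * len nu.1) => F Fd F0.
  have Mlen : 0 <= `|M%:~R| * len nu.1 by rewrite mulr_ge0// ltW// len_gt0.
  have [Fw|Fw] := leP (Num.min (F u) 0) (F w).
    apply: le_trans Fw; rewrite -[leRHS]subr0 lerB//.
    by rewrite le_min !ge_min lexx orbT HB.
  (* This level is at most [F v0 = 0] and at most [F u], as [flux_bound] requires. *)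
  have := flux_bound Fd _ _ _ (nu := nu) (c := Num.min (F u) 0).
  rewrite F0 nuw nuu !ge_min !lexx orbT => /(_ isT Fw isT) cM.
  have gM : grad F nu <= `|M%:~R|.
    apply: le_trans (ceil_ge _) _; apply: le_trans (ler_norm _).
    by rewrite ler_int.
  move: gM; rewrite /grad ler_pdivrMr ?len_gt0// nuw nuu lerBlDr => FuM.
  have : Num.min B 0 <= F u by apply: le_trans (HB _ Fd F0); rewrite ge_min lexx.
  by move: Mlen FuM; lra.
have base : exists B : R, forall F, fires_off d v0 F -> F v0 = 0 -> B <= F v0.
  by exists 0 => F _ ->.
have /connectP[p] := graph_connected v0 v.
suff gen q u : path (fun x y => [exists e, ((src e == x) && (tgt e == y))
      || ((src e == y) && (tgt e == x))]) u q ->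
    (exists B : R, forall F, fires_off d v0 F -> F v0 = 0 -> B <= F u) ->
    exists B : R, forall F, fires_off d v0 F -> F v0 = 0 -> B <= F (last u q).
  by move=> /gen/(_ base) ? ->.
elim: q u => [|w q IH] u //= /andP[/existsP uw wq] Hu.
by apply: IH => //; exact: step Hu.
Qed.

(** The pointwise infimum of the admissible potentials is itself admissible: at a given [v], an
    admissible [G] with [G v] close to the infimum has ceilings at [v] no smaller than those of the
    infimum, so it fires at least as much there. *)
Lemma fires_off_min F0 : fires_off d v0 F0 -> exists F,
  [/\ fires_off d v0 F, F v0 = 0 &
    forall G, fires_off d v0 G -> G v0 = 0 -> forall v, F v <= G v].
Proof.
move=> F0d; pose S v := [set x : R | exists F, [/\ fires_off d v0 F, F v0 = 0 & F v = x]].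
have Sinf v : has_inf (S v).
  split; last by have [B HB] := fires_off_bounded v; exists B => _ [F [Fd F0' <-]]; exact: HB.
  exists (F0 v - F0 v0), (fun v => F0 v - F0 v0); split; rewrite ?subrr// => u uv0.
  rewrite (_ : firing _ _ = firing F0 u); first exact: F0d.
  by apply: eq_bigr => nu _; rewrite /grad opprB addrA subrK.
pose F v := inf (S v); have Fle G v : fires_off d v0 G -> G v0 = 0 -> F v <= G v.
  move=> Gd G0; apply: ge_inf; last by exists G.
  by case: (Sinf v).
exists F; split=> [v vv0||G Gd G0 v]; last exact: Fle.
(* [eps] is small enough that lowering the rise along any edge by less than [eps] keeps the gradient
   above the integer below its ceiling. *)
- have [eps eps0 Heps] : exists2 eps, 0 < eps & forall nu,
      eps <= (grad F nu - (Num.ceil (grad F nu) - 1)%:~R) * len nu.1.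
    apply: finite_lower_bound => nu; rewrite mulr_gt0 ?len_gt0// subr_gt0.
    exact: ceilB1_lt.
  have [_ [G [Gd G0 <-]] Glt] := inf_adherent eps0 (Sinf v).
  apply: le_trans (Gd v vv0); apply: ler_sum => nu; rewrite mem_tangent => /eqP nuv.
  rewrite -ltzD1 -ltrBlDr ceil_gt_int -(ltr_pM2r (len_gt0 nu.1)).
  have := Heps nu; rewrite /grad mulrBl !divfK ?gt_eqF ?len_gt0// nuv.
  have := Fle _ (other nu) Gd G0; rewrite -/(F v) in Glt; move: Glt; lra.
- apply/eqP; rewrite eq_le; apply/andP; split.
    have [[_ [G [Gd G0 _]]] _] := Sinf v0; rewrite -[leRHS]G0; exact: Fle.
  by apply: lb_le_inf => [|_ [G [_ G0 <-]]]; [by case: (Sinf v0)|rewrite G0].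
Qed.
End Bounded.
End RiemannRoch.

(** * Dhar's burning algorithm *)

Lemma cardZ_sum (T : finType) (A : {set T}) (P : pred T) :
  #|[set x in A | P x]%SET|%:Z = \sum_(x in A) (P x)%:Z.
Proof.
rewrite -[LHS]natz -sum1_card natr_sum big_mkcond [RHS]big_mkcond.
by apply: eq_bigr => x _; rewrite inE; case: (x \in A) => //=; case: (P x).
Qed.

Section Burning.
Context {R : realType} {Gamma : tropical_curve R}.
Implicit Types (e : edge Gamma) (t : R) (v w : vertex Gamma) (p : Gamma).
Implicit Types (cs : seq (edge Gamma * R * int)) (nu : edge Gamma * bool).
Implicit Types (F G : vertex Gamma -> R) (d : vertex Gamma -> int).

Definition loopless := forall e, src e != tgt e :> vertex Gamma.

(** The edges along which fire reaches [v] from the burnt set [A]; on a broken edge the interior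
    chip stops the fire. *)
Definition fires_toward F (A : {set vertex Gamma}) v : {set edge Gamma * bool} :=
  [set nu in tangent (vpoint v) | ~~ broken F nu.1 & other nu \in A]%SET.

(* Dhar's criterion: a set A that could fire would make F smaller on A. *)
Lemma burns d v0 F (A : {set vertex Gamma}) : fires_off d v0 F -> F v0 = 0 ->
  (forall G, fires_off d v0 G -> G v0 = 0 -> forall v, F v <= G v) ->
  v0 \notin A -> A != finset.set0 ->
  exists2 v, v \in A & d v - firing F v < #|fires_toward F (~: A) v|%:Z.
Proof.
move=> Fd F0 Fmin v0A /set0Pn[a aA]; apply/exists_inP; apply: contraT.
rewrite negb_exists_in => /forall_inP stuck.
(* Lowering [F] by [eps] on [A] keeps the ceiling of every gradient leaving [A] along a broken edge,
   and raises it by at most 1 along an unbroken one. *)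
have [eps eps0 Heps] : exists2 eps, 0 < eps & forall nu, eps <=
    (if broken F nu.1 then (Num.ceil (grad F nu))%:~R - grad F nu else 1) * len nu.1.
  apply: finite_lower_bound => nu; rewrite mulr_gt0 ?len_gt0//.
  by case: ifP => // /broken_lt; rewrite subr_gt0.
pose G v := F v - eps *+ (v \in A).
suff Gd : fires_off d v0 G.
  have := Fmin G Gd _ a; rewrite /G F0 (negbTE v0A) subr0 aA => /(_ erefl).
  by rewrite lerBrDr gerDl leNgt eps0.
move=> v vv0; have gradG nu : endpoint nu = v -> grad G nu =
    grad F nu + eps / len nu.1 * ((v \in A)%:R - (other nu \in A)%:R).
  by move=> nuv; rewrite /grad /G nuv -!(mulr_natr eps); field; rewrite gt_eqF// len_gt0.
have epsL nu : 0 < eps / len nu.1 by rewrite divr_gt0// len_gt0.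
have [vA|vA] := boolP (v \in A); last first.
  apply: le_trans (Fd v vv0); apply: ler_sum => nu; rewrite mem_tangent => /eqP nuv.
  rewrite le_ceil// gradG// (negbTE vA) sub0r mulrN gerDl oppr_le0 mulr_ge0//.
  by rewrite ltW.
have := stuck v vA; rewrite -leNgt lerBrDl => /(le_trans _); apply.
rewrite /fires_toward cardZ_sum /firing.
rewrite -big_split; apply: ler_sum => nu; rewrite mem_tangent => /eqP nuv /=.
rewrite ceil_le_int intrD gradG// vA inE; have [oA|oA] := boolP (other nu \in A).
  by rewrite subrr mulr0 andbF !addr0 ceil_ge.
have := Heps nu; rewrite -ler_pdivrMr ?len_gt0// subr0 mulr1 andbT.
have := ceil_ge (grad F nu); case: ifP => _ /=; lra.
Qed.

(** Fire set at [v0] burns all vertices one after the other, by [burns] applied to the set not yet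
    burnt; [rho] is the time of burning. *)
Lemma burning_order d v0 F : fires_off d v0 F -> F v0 = 0 ->
  (forall G, fires_off d v0 G -> G v0 = 0 -> forall v, F v <= G v) ->
  exists rho : vertex Gamma -> nat, [/\ injective rho, rho v0 = 0%N &
    forall v, v != v0 ->
      d v - firing F v < #|fires_toward F [set w | (rho w < rho v)%N] v|%:Z].
Proof.
move=> Fd F0 Fmin.
suff [s [us s0 sall sb]] : exists s : seq (vertex Gamma), [/\ uniq s, index v0 s = 0%N,
    #|vertex Gamma|  = size s & forall v, v \in s -> v != v0 ->
    d v - firing F v < #|fires_toward F [set w | (index w s < index v s)%N] v|%:Z].
  have sT v : v \in s.
    have /subset_cardP : #|s| = #|vertex Gamma| by rewrite (card_uniqP us).
    by move=> /(_ (subset_predT _)) ->.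
  exists (index^~ s); split=> // [v w vw|v vv0]; last exact: sb.
  by rewrite -(nth_index v0 (sT v)) vw nth_index.
have card0 : (0 < #|vertex Gamma|)%N by apply/card_gt0P; exists v0.
suff : forall n, (n < #|vertex Gamma|)%N -> exists s : seq (vertex Gamma),
    [/\ uniq s, v0 \in s /\ index v0 s = 0%N, size s = n.+1 & forall v, v \in s -> v != v0 ->
    d v - firing F v < #|fires_toward F [set w | (index w s < index v s)%N] v|%:Z].
  move=> /(_ #|vertex Gamma|.-1); rewrite prednK// => /(_ (leqnn _)) [s [? [_ ?] ? ?]].
  by exists s.
elim=> [_|n IH nV].
  exists [:: v0]; split=> //=; first by rewrite inE eqxx.
  by move=> v; rewrite inE => ->.
have [s [us [v0s s0] ss sb]] := IH (ltnW nV).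
have [||v] := @burns d v0 F (~: [set v in s]) Fd F0 Fmin.
- by rewrite !inE v0s.
- rewrite -card_gt0 cardsCs finset.setCK subn_gt0 (leq_ltn_trans _ nV)//.
  by rewrite cardsE (card_uniqP us) ss.
rewrite finset.setCK !inE => vs vb; exists (rcons s v); split.
- by rewrite rcons_uniq vs.
- by rewrite mem_rcons inE v0s orbT -cats1 index_cat v0s.
- by rewrite size_rcons ss.
move=> w; rewrite mem_rcons inE => /orP[/eqP->|ws wv0].
  rewrite (_ : [set w | _]%SET = [set w in s]%SET)//; apply/setP => u.
  rewrite !inE -cats1 !index_cat (negbTE vs) /= eqxx addn0.
  by case: ifP => us'; rewrite ?index_mem// ltnNge leq_addr.
rewrite (_ : [set u | _]%SET = [set u | index u s < index w s]%N%SET); first exact: sb.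
apply/setP => u; rewrite !inE -cats1 !index_cat ws.
case: ifP => // /negbT us'; rewrite (memNindex us').
by have iw := index_size w s; rewrite !ltnNge iw (leq_trans iw)// leq_addr.
Qed.

End Burning.

(** * The divisor of a firing *)

Section Core.
Context {R : realType} {Gamma : tropical_curve R}.
Implicit Types (e : edge Gamma) (t : R) (v w : vertex Gamma) (p : Gamma).
Implicit Types (cs : seq (edge Gamma * R * int)) (nu : edge Gamma * bool).
Implicit Types (F G : vertex Gamma -> R) (d : vertex Gamma -> int) (s : seq Gamma).

Lemma balanced_other cs z G a nu : balanced cs z G a ->
  G (other nu) = G (endpoint nu) + (out_slope cs a nu)%:~R * len nu.1 +
    \sum_(c <- cs | c.1.1 == nu.1) c.2%:~R * (if nu.2 then c.1.2 else len nu.1 - c.1.2).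
Proof.
case=> GE _; case: nu => e [] /=; rewrite /other /endpoint /out_slope /=; last exact: GE.
have -> : \sum_(c <- cs | c.1.1 == e) c.2%:~R * c.1.2 =
    (\sum_(c <- cs | c.1.1 == e) c.2)%:~R * len e
    - \sum_(c <- cs | c.1.1 == e) c.2%:~R * (len e - c.1.2) :> R.
  rewrite rmorph_sum /= mulr_suml -sumrB; apply: eq_bigr => c _; ring.
rewrite GE intrB intrN; ring.
Qed.

(** Chips of nonpositive multiplicity only decrease the slope of [G] along a dart, so the mean slope
    is at most the initial one; a negative chip inside the edge makes the inequality strict. *)
Lemma grad_le_out_slope cs z G a nu : on_curve cs -> all (fun c => c.2 <= 0) cs ->
  balanced cs z G a -> grad G nu <= (out_slope cs a nu)%:~R.
Proof.
move=> cs_on /allP n0 bal; rewrite /grad ler_pdivrMr ?len_gt0// (balanced_other nu bal).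
suff : \sum_(c <- cs | c.1.1 == nu.1)
    c.2%:~R * (if nu.2 then c.1.2 else len nu.1 - c.1.2) <= 0 by lra.
rewrite big_seq_cond; apply: sumr_le0 => c /andP[ccs /eqP ce].
have /andP[c0 cL] := on_curveP cs_on ccs; have := n0 c ccs.
rewrite -(ler_int R) => cn; rewrite mulr_le0_ge0//; case: ifP => // _.
by rewrite subr_ge0 -ce.
Qed.

Lemma grad_lt_out_slope cs z G a c nu : on_curve cs -> all (fun c => c.2 <= 0) cs ->
  balanced cs z G a -> c \in cs -> c.1.1 = nu.1 -> 0 < c.1.2 < len nu.1 -> c.2 < 0 ->
  grad G nu < (out_slope cs a nu)%:~R.
Proof.
move=> cs_on /allP n0 bal ccs cnu /andP[c0 cL] c2.
rewrite /grad ltr_pdivrMr ?len_gt0// (balanced_other nu bal).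
suff : \sum_(c <- cs | c.1.1 == nu.1)
    c.2%:~R * (if nu.2 then c.1.2 else len nu.1 - c.1.2) < 0 by lra.
rewrite (big_rem c)//= cnu eqxx; apply: (@le_lt_trans _ _
  (c.2%:~R * (if nu.2 then c.1.2 else len nu.1 - c.1.2))).
  rewrite gerDl big_seq_cond; apply: sumr_le0 => c' /andP[/mem_rem c'cs /eqP ce].
  have /andP[c'0 c'L] := on_curveP cs_on c'cs; have := n0 c' c'cs.
  rewrite -(ler_int R) => cn; rewrite mulr_le0_ge0//; case: ifP => // _.
  by rewrite subr_ge0 -ce.
rewrite pmulr_llt0 ?ltrz0//; case: ifP => // _; rewrite subr_gt0//.
Qed.

Lemma points_decomp s : exists z cs, [/\ on_curve cs, points s = vertex_div z + chip_div cs,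
  forall v, 0 <= z v & all (fun c => 0 <= c.2) cs].
Proof.
elim: s => [|p s [z [cs [cs_on IH z0 n0]]]].
  exists (fun=> 0), [::]; split=> //; rewrite points_nil /chip_div big_nil addr0.
  by rewrite /vertex_div big1// => v _; rewrite freegU0.
rewrite points_cons IH; case: (pointP p) => [v|e t te]; last first.
  exists z, ((e, t, 1) :: cs); split=> //.
    by rewrite /= cs_on andbT; move: te => /andP[/ltW-> /ltW->].
  by rewrite /chip_div big_cons /= addrCA.
exists (fun u => z u + (u == v)%:Z), cs; split=> //; last by move=> u; rewrite addr_ge0.
rewrite addrA vertex_divD [X in X + _ = _]addrC; congr (_ + _ + _).
rewrite /vertex_div (bigD1 v)//= eqxx big1 ?addr0// => u /negbTE->.
by rewrite freegU0.
Qed.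

Lemma effective_vertex_div (z : vertex Gamma -> int) :
  (forall v, 0 <= z v) -> effective (vertex_div z).
Proof.
move=> z0 p; rewrite raddf_sum; apply: sumr_ge0 => v _; rewrite /= coeffU.
by rewrite mulr_ge0.
Qed.

Lemma effective_chip_div cs : all (fun c => 0 <= c.2) cs -> effective (chip_div cs).
Proof.
move=> /allP n0 p; rewrite coeff_chip_div big_seq; apply: sumr_ge0 => c ccs.
by rewrite mulrn_wge0// n0.
Qed.

Lemma effectiveD (D E : {freeg Gamma / int}) : effective D -> effective E -> effective (D + E).
Proof. by move=> D0 E0 p; rewrite coeffD addr_ge0. Qed.

(** The outgoing slopes of the potential are integers that bound its gradients, hence also the
    ceilings of the gradients. *)
Lemma principal_fires d s : principal (vertex_div d - points s) ->
  exists F, forall v, firing F v <= d v.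
Proof.
have [z [cs [cs_on -> z0 n0]]] := points_decomp s.
rewrite opprD addrA -vertex_divN -vertex_divD -chip_div_opp => /principal_balanced[].
  by rewrite on_curve_opp.
move=> G [a bal]; exists G => v; have [_ zE] := bal.
apply: (@le_trans _ _ (d v - z v)); last by rewrite gerBl.
rewrite -zE; apply: ler_sum => nu _; rewrite ceil_le_int.
apply: grad_le_out_slope bal; first by rewrite on_curve_opp.
by rewrite all_map; apply: sub_all n0 => c /=; rewrite oppr_le0.
Qed.

(** The parameter at which the two pieces of the extension of [F], drawn from the ends of [e],
    meet. *)
Definition break F e : R := len e * (1 - (Num.ceil (grad F (e, false)))%:~R + grad F (e, false)).

Definition break_chips (n : int) F : seq (edge Gamma * R * int) :=
  [seq (e, break F e, n) | e <- enum (edge Gamma) & broken F e].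

Lemma break_itv F e : broken F e -> 0 < break F e < len e.
Proof.
move=> br; have := broken_lt (nu := (e, false)) br.
have := ceilB1_lt (grad F (e, false)); rewrite intrB /break => b1 b2.
by rewrite mulr_gt0 ?len_gt0//= ?gtr_pMr ?len_gt0//; lra.
Qed.

Lemma on_curve_break_chips n F : on_curve (break_chips n F).
Proof.
rewrite /on_curve all_map; apply/allP => e; rewrite mem_filter => /andP[br _] /=.
by have /andP[/ltW-> /ltW->] := break_itv br.
Qed.

Lemma sum_break_chips (V : zmodType) n F e (H : edge Gamma * R * int -> V) :
  \sum_(c <- break_chips n F | c.1.1 == e) H c =
  if broken F e then H (e, break F e, n) else 0.
Proof.
rewrite big_map big_filter_cond big_enum_cond /=; case: ifP => br.
  by rewrite (big_pred1 e)// => e' /=; case: eqP => [->|]; rewrite ?br ?andbF.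
by rewrite big1// => e' /andP[br' /eqP ee']; rewrite ee' br in br'.
Qed.

(** The rational function is minus the extension of [F] described at [firing], which bends only at
    the breaks of broken edges. *)
Lemma principal_firing F :
  principal (vertex_div (firing F) + chip_div (break_chips (-1) F)).
Proof.
apply/principal_balanced; first exact: on_curve_break_chips.
pose a e := Num.ceil (grad F (e, false)); exists F, a; split=> [e|v].
  rewrite sum_break_chips /a; case: ifP => br /=.
    rewrite mulrN1z mulN1r /break.
    rewrite /grad /other /endpoint /=; set c := (Num.ceil _)%:~R.
    by field; rewrite gt_eqF ?len_gt0.
  have /eqP := brokenE F e; rewrite br grad_rev => /eqP H.
  have : (Num.ceil (grad F (e, false)))%:~R = grad F (e, false).
    have /eqP := H; rewrite addr_eq0 => /eqP H'; apply/eqP; rewrite eq_le ceil_ge andbT.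
    by rewrite H' intrN lerNl ceil_ge.
  move=> ->; rewrite /grad /other /endpoint /= addr0 divfK ?gt_eqF ?len_gt0//.
  by rewrite addrC subrK.
apply: eq_bigr => -[e []] _ //; rewrite /out_slope sum_break_chips /a /=.
by have := brokenE F e; case: ifP => _ /=; lia.
Qed.

End Core.

(** * Acyclic orientations and the core of Riemann-Roch *)

Section RRCore.
Context {R : realType} {Gamma : tropical_curve R}.
Implicit Types (e : edge Gamma) (v w : vertex Gamma) (nu : edge Gamma * bool).
Implicit Types (F : vertex Gamma -> R) (d : vertex Gamma -> int) (s : seq Gamma).
Variable Gamma_loopless : loopless (Gamma := Gamma).

Section Acyclic.
Variables (F : vertex Gamma -> R) (rho : vertex Gamma -> nat).
Hypothesis rho_inj : injective rho.

Definition indegree v := #|fires_toward F [set w | (rho w < rho v)%N] v|.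

(** Indegree minus one for the orientation by burning time of the graph subdivided at the breaks. A
    break is entered from both sides, so it has coefficient 1. *)
Definition acyclic_div : {freeg Gamma / int} :=
  vertex_div (fun v => (indegree v)%:Z - 1) + chip_div (break_chips 1 F).

Let rho_other nu : (rho (other nu) == rho (endpoint nu)) = false.
Proof.
rewrite (inj_eq rho_inj) /other /endpoint; apply/negbTE.
by case: nu => e []/=; rewrite // eq_sym.
Qed.

(** Each unbroken edge counts once, at its end that burns later, and each broken edge once, through
    its break. *)
Lemma deg_acyclic_div : deg acyclic_div = #|edge Gamma|%:Z - #|vertex Gamma|%:Z.
Proof.
rewrite degD deg_vertex_div deg_chip_div sumrB sumr_const -mulr_natl mulr1 natz.
have -> : \sum_v (indegree v)%:Z = \sum_e (~~ broken F e)%:Z.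
  under eq_bigr do rewrite /indegree /fires_toward cardZ_sum.
  rewrite (eq_bigr (fun v => \sum_(nu in tangent (vpoint v))
    (~~ broken F nu.1 && (rho (other nu) < rho (endpoint nu))%N)%:Z)); last first.
    move=> v _; apply: eq_bigr => nu; rewrite mem_tangent => /eqP->.
    by rewrite inE.
  rewrite sum_tangent; apply: eq_bigr => e _; case: broken => //=.
  have := rho_other (e, true); rewrite /other /endpoint /=.
  by case: ltngtP.
have -> : \sum_(c <- break_chips 1 F) c.2 = \sum_e (broken F e)%:Z.
  rewrite big_map big_filter big_enum_cond /= big_mkcond.
  by apply: eq_bigr => e _; case: broken.
rewrite addrAC -big_split (eq_bigr (fun=> 1)) => [|e _]; last by case: broken.
by rewrite sumr_const -mulr_natl mulr1 natz.
Qed.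

(* At the last vertex v where the potential is minimal, it climbs along every *)
(* edge except those that burnt toward v.                                     *)
Lemma canonical_minus_acyclic s :
  ~ principal (canonical_divisor - acyclic_div - points s).
Proof.
have [z [cs [cs_on -> z0 n0]]] := points_decomp s.
pose kz v := ((valence (vpoint v))%:Z - 2 - ((indegree v)%:Z - 1)) - z v.
have -> : canonical_divisor - acyclic_div - (vertex_div z + chip_div cs) =
    vertex_div kz + chip_div (chip_opp (break_chips 1 F ++ cs)).
  rewrite /kz vertex_divD vertex_divD !vertex_divN chip_div_opp chip_div_cat /acyclic_div.
  rewrite -[canonical_divisor]/(vertex_div _).
  by rewrite !opprD !addrA; congr (_ + _); rewrite -!addrA; congr (_ + (_ + _)); rewrite addrC.
set cs' := chip_opp _.
have cs'_on : on_curve cs'.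
  by rewrite on_curve_opp /on_curve all_cat -!/(on_curve _) on_curve_break_chips.
move=> /(principal_balanced _ cs'_on)[G [a bal]].
have n'0 : all (fun c => c.2 <= 0) cs'.
  rewrite all_map all_cat; apply/andP; split; last first.
    by apply: sub_all n0 => c /=; rewrite oppr_le0.
  by apply/allP => c /mapP[e _ ->].
have /card_gt0P[e0 _] := edge_inhabited Gamma; pose v0 := src e0.
have [v1 _ Gmin] := @arg_minP _ _ _ v0 xpredT G isT.
have [v /eqP Gv rmax] := @arg_maxnP _ v1 (fun v => G v == G v1) rho (eqxx _).
have out_ge0 nu : nu \in tangent (vpoint v) -> 0 <= out_slope cs' a nu.
  rewrite mem_tangent => /eqP nuv; rewrite -(ler_int R).
  apply: le_trans (grad_le_out_slope nu cs'_on n'0 bal).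
  by rewrite divr_ge0 ?(ltW (len_gt0 _))// nuv Gv subr_ge0 Gmin.
have out_ge1 nu : nu \in tangent (vpoint v) ->
    ~~ (~~ broken F nu.1 && (other nu \in [set w | (rho w < rho v)%N]%SET)) ->
    1 <= out_slope cs' a nu.
  rewrite mem_tangent => /eqP nuv; rewrite negb_and negbK inE -gtz0_ge1 -(ltr_int R).
  move=> /orP[br|].
    apply: (@le_lt_trans _ _ (grad G nu)).
      by rewrite divr_ge0 ?(ltW (len_gt0 _))// nuv Gv subr_ge0 Gmin.
    apply: (grad_lt_out_slope (c := (nu.1, break F nu.1, - 1)) cs'_on n'0 bal) => //.
      rewrite /cs' /chip_opp map_cat mem_cat; apply/orP; left.
      rewrite -map_comp; apply/mapP; exists nu.1 => //.
      by rewrite mem_filter br mem_enum.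
    exact: break_itv.
  rewrite -leqNgt leq_eqVlt eq_sym -nuv rho_other /= nuv => lt_rho.
  apply: lt_le_trans (grad_le_out_slope nu cs'_on n'0 bal).
  rewrite divr_gt0 ?len_gt0// nuv Gv subr_gt0 lt_neqAle Gmin// andbT.
  by apply: contraTneq lt_rho => /esym /eqP /rmax /=; rewrite -leqNgt.
have [_ /(_ v) sumE] := bal.
have : \sum_(nu in tangent (vpoint v)) out_slope cs' a nu >=
    (valence (vpoint v))%:Z - (indegree v)%:Z.
  rewrite /indegree /fires_toward cardZ_sum /valence -[X in X - _]natz -sum1_card natr_sum -sumrB.
  apply: ler_sum => nu nuT; have := out_ge0 nu nuT; have := out_ge1 nu nuT.
  by case: (_ && _) => /= [_|]; rewrite ?subrr ?subr0// => /(_ isT).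
by rewrite sumE /kz; have := z0 v; lia.
Qed.

End Acyclic.

(** For the least [F], the divisor [d - firing F] plus the break chips is equivalent to [d] and
    reduced at [v0]. If it is not effective, it is negative at [v0] and smaller than the indegree
    elsewhere, so it lies below [acyclic_div], and [s] is the difference. *)
Lemma rr_core d v0 F0 : fires_off d v0 F0 ->
  (exists s, principal (vertex_div d - points s)) \/
  (exists N s, [/\ principal (vertex_div d + points s - N),
     deg N = #|edge Gamma|%:Z - #|vertex Gamma|%:Z &
     forall s', ~ principal (canonical_divisor - N - points s')]).
Proof.
move=> /fires_off_min[F [Fd Fv0 Fmin]].
have [rho [rho_inj rho0 rhoP]] := burning_order Fd Fv0 Fmin.
have chips0 : effective (chip_div (break_chips 1 F)).
  by apply: effective_chip_div; apply/allP => c /mapP[e _ ->].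
have chipsN : chip_div (break_chips (-1) F) = - chip_div (break_chips 1 F).
  rewrite -chip_div_opp; congr chip_div; rewrite /chip_opp -map_comp.
  exact: eq_map.
have [dv0|dv0] := leP 0 (d v0 - firing F v0).
  left; have [|s sE] := @effectiveP _ _ (vertex_div (fun v => d v - firing F v)
      + chip_div (break_chips 1 F)).
    apply: effectiveD => //; apply: effective_vertex_div => v.
    by have [->//|/Fd] := eqVneq v v0; rewrite subr_ge0.
  exists s; rewrite -sE vertex_divD vertex_divN !opprD !addrA subrr add0r opprK -chipsN.
  exact: principal_firing.
right; have [|s sE] := @effectiveP _ _ (vertex_div
    (fun v => ((indegree F rho v)%:Z - 1) - (d v - firing F v))).
  apply: effective_vertex_div => v; have [->|vv0] := eqVneq v v0.
    by move: dv0; lia.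
  by have := rhoP v vv0; rewrite /indegree; lia.
exists (acyclic_div F rho), s; split.
- rewrite -sE /acyclic_div opprD addrA -vertex_divN -!vertex_divD -chipsN.
  rewrite (_ : (fun _ => _) = firing F); first exact: principal_firing.
  by apply/funext => v; ring.
- exact: deg_acyclic_div.
- exact: canonical_minus_acyclic.
Qed.

End RRCore.

(** * Canonical divisors through given vertices *)

Lemma freeg_ext (K : choiceType) (D E : {freeg K / int}) :
  (forall p, coeff p D = coeff p E) -> D = E.
Proof. by move=> DE; apply/eqP/freeg_eqP. Qed.

Ltac freeg_ring := apply: freeg_ext => ?;
  rewrite ?(points_cons, points_nil) ?(coeffD, coeffN, coeff0); ring.

Lemma principal_eq (R : realType) (Gamma : tropical_curve R) (D E : {freeg Gamma / int}) :
  principal D -> D = E -> principal E.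
Proof. by move=> pD <-. Qed.

Section Canonical.
Context {R : realType} {Gamma : tropical_curve R}.
Implicit Types (e : edge Gamma) (u v w : vertex Gamma) (p q x : Gamma) (s : seq Gamma).

Definition canonical_equiv s := principal (canonical_divisor - points s).

Definition leafless := forall v : vertex Gamma, (2 <= valence (vpoint v))%N.

Lemma vertex_div_vpoint u : vertex_div (fun v => (v == u)%:Z) = << vpoint u >>.
Proof.
rewrite /vertex_div (bigD1 u)//= eqxx big1 ?addr0// => v /negbTE->.
by rewrite freegU0.
Qed.

Lemma deg_canonical :
  deg (canonical_divisor (Gamma := Gamma)) = (#|edge Gamma|%:Z - #|vertex Gamma|%:Z) * 2.
Proof.
rewrite -[canonical_divisor]/(vertex_div _) deg_vertex_div sumrB sumr_const.
rewrite (eq_bigr (fun v => \sum_(nu in tangent (vpoint v)) 1)) => [|v _]; last first.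
  by rewrite sumr_const -mulr_natl mulr1 natz.
rewrite sum_tangent !sumr_const !cardT -!cardE.
by rewrite -[1 + 1]natz -mulrnA -[2 *+ _]mulr_natr !natz; lia.
Qed.

Lemma canonical_equiv_perm s s' : perm_eq s s' -> canonical_equiv s -> canonical_equiv s'.
Proof. by move=> /(perm_big _) ss'; rewrite /canonical_equiv /points ss'. Qed.

Lemma principal_points_size (D : {freeg Gamma / int}) s :
  principal (D - points s) -> (size s)%:Z = deg D.
Proof. by move=> /deg_principal /eqP; rewrite degB deg_points subr_eq0 => /eqP. Qed.

Hypothesis Gamma_loopless : loopless (Gamma := Gamma).
Hypothesis Gamma_leafless : leafless.
Hypothesis Gamma_euler : #|edge Gamma|%:Z = #|vertex Gamma|%:Z + 2.

Let degK : deg (canonical_divisor (Gamma := Gamma)) = 4.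
Proof. by rewrite deg_canonical Gamma_euler addrAC subrr. Qed.

(** All valences are at least 2, so the constant potential is admissible for [K - u]. The second
    case of [rr_core] is impossible because [K - u] has degree 3, more than the degree 2 of [N]. *)
Lemma canonical_equiv_vertex1 u : exists s, canonical_equiv (vpoint u :: s).
Proof.
pose d v := (valence (vpoint v))%:Z - 2 - (v == u)%:Z.
have dE : vertex_div d = canonical_divisor - << vpoint u >>.
  by rewrite /d vertex_divD vertex_divN vertex_div_vpoint.
have [|[s]|[N [s [+ degN _]]]] := @rr_core _ Gamma Gamma_loopless d u (fun=> 0).
- move=> v /negbTE vu; rewrite /firing big1 => [|nu _]; last first.
    by rewrite /grad subrr mul0r ceil0.
  by rewrite /d vu subr0; have := Gamma_leafless v; lia.
- rewrite dE => KE; exists s; rewrite /canonical_equiv points_cons.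
  by rewrite opprD addrA.
- move=> /deg_principal; rewrite dE !degB degD !degB degK degU deg_points degN.
  by rewrite Gamma_euler; lia.
Qed.

(** Now the degree is that of [N], so the second case of [rr_core] would give [N ~ K - u - w], and
    [K - N ~ u + w] would be equivalent to an effective divisor. With the passage to all points this
    makes the rank of [K] at least 2. *)
Lemma canonical_equiv_vertex2 u w :
  exists q1 q2, canonical_equiv [:: vpoint u; vpoint w; q1; q2].
Proof.
pose d v := (valence (vpoint v))%:Z - 2 - (v == u)%:Z - (v == w)%:Z.
have dE : vertex_div d = canonical_divisor - << vpoint u >> - << vpoint w >>.
  by rewrite /d 2!vertex_divD !vertex_divN !vertex_div_vpoint.
have [s1 KE1] := canonical_equiv_vertex1 u.
have [F Fd] : exists F, forall v, firing F v <= (valence (vpoint v))%:Z - 2 - (v == u)%:Z.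
  apply: (@principal_fires _ _ _ s1).
  rewrite vertex_divD vertex_divN vertex_div_vpoint.
  by move: KE1; rewrite /canonical_equiv points_cons opprD addrA.
have [|[s KE]|[N [s [pN degN KN]]]] := @rr_core _ Gamma Gamma_loopless d w F.
- by move=> v /negbTE vw; rewrite /d vw subr0.
- have := principal_points_size KE; rewrite dE !degB degK !degU.
  case: s KE => [|q1 [|q2 [|]]] //= KE _; exists q1, q2.
  by apply: (principal_eq KE); rewrite dE; freeg_ring.
- have := deg_principal pN; rewrite dE degB degD !degB degK !degU degN deg_points Gamma_euler.
  case: s pN => [|x s] pN /= ds; last by exfalso; move: ds; lia.
  case: (KN [:: vpoint u; vpoint w]); apply: (principal_eq pN).
  by rewrite dE; freeg_ring.
Qed.

(** For [K - 2u - 2w] of degree 0 the second case of [rr_core] has two extra points [x], [y], and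
    [K - N ~ 2u + 2w - x - y ~ x' + y'], a contradiction. The first case gives an effective divisor
    of degree 0. *)
Lemma canonical_equiv_double u w :
  (forall x, exists x', principal (points [:: vpoint u; vpoint w] - points [:: x; x'])) ->
  canonical_equiv [:: vpoint u; vpoint u; vpoint w; vpoint w].
Proof.
move=> D1; pose d v := (valence (vpoint v))%:Z - 2 - (v == w)%:Z * 2 - (v == u)%:Z * 2.
have mul2 v : vertex_div (fun w => (w == v)%:Z * 2) = << vpoint v >> + << vpoint v >>.
  by rewrite -vertex_div_vpoint -vertex_divD; congr vertex_div; apply/funext => y; ring.
have [q1 [q2 KE]] := canonical_equiv_vertex2 w w.
have [F Fd] : exists F, forall v, firing F v <= (valence (vpoint v))%:Z - 2 - (v == w)%:Z * 2.
  apply: (@principal_fires _ _ _ [:: q1; q2]).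
  rewrite vertex_divD vertex_divN mul2 -[vertex_div _]/canonical_divisor.
  by apply: (principal_eq KE); freeg_ring.
have dE : vertex_div d = canonical_divisor - points [:: vpoint u; vpoint u; vpoint w; vpoint w].
  rewrite /d 2!vertex_divD !vertex_divN !mul2 -[vertex_div _]/canonical_divisor.
  freeg_ring.
have [|[s KE']|[N [s [pN degN KN]]]] := @rr_core _ Gamma Gamma_loopless d u F.
- by move=> v /negbTE vu; rewrite /d vu mul0r subr0.
- have := principal_points_size KE'; rewrite dE !degB degK deg_points.
  by case: s KE' => //= KE' _; move: KE'; rewrite dE points_nil subr0.
- have := deg_principal pN; rewrite dE degB degD degB degK !deg_points degN Gamma_euler.
  case: s pN => [|x [|y [|z s]]] pN /= ds; try by exfalso; move: ds; lia.
  have [x' px] := D1 x; have [y' py] := D1 y.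
  case: (KN [:: x'; y']); apply: (principal_eq (principalD pN (principalD px py))).
  by rewrite dE; freeg_ring.
Qed.


End Canonical.

(** * Balance along darts *)

Section DartForm.
Context {R : realType} {Gamma : tropical_curve R}.
Implicit Types (e : edge Gamma) (v : vertex Gamma) (nu : edge Gamma * bool).
Implicit Types (cs : seq (edge Gamma * R * int)).

Definition reverse nu := (nu.1, ~~ nu.2).

Definition dist_to_end nu t : R := if nu.2 then t else len nu.1 - t.

(* The orientation-free form of balanced: o nu is the slope leaving the end   *)
(* where nu starts.                                                           *)
Definition dart_balanced cs (z : vertex Gamma -> int) (G : vertex Gamma -> R)
    (o : edge Gamma * bool -> int) : Prop :=
  [/\ forall nu, o nu + o (reverse nu) = - \sum_(c <- cs | c.1.1 == nu.1) c.2,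
      forall nu, G (other nu) = G (endpoint nu) + (o nu)%:~R * len nu.1
        + \sum_(c <- cs | c.1.1 == nu.1) c.2%:~R * dist_to_end nu c.1.2
    & forall v, \sum_(nu in tangent (vpoint v)) o nu = z v].

Lemma dart_balancedP cs z :
  (exists G a, balanced cs z G a) <-> (exists G o, dart_balanced cs z G o).
Proof.
split=> [[G [a bal]]|[G [out [oN oG oz]]]].
  exists G, (out_slope cs a); split=> [nu|nu|].
  - by case: nu => e []; rewrite /out_slope /=; ring.
  - exact: balanced_other bal.
  - by case: bal.
exists G, (fun e => out (e, false)); split=> [e|v].
  by have := oG (e, false).
rewrite -oz; apply: eq_bigr => -[e []] _; rewrite /out_slope//=.
by have := oN (e, true); rewrite /reverse /=; lia.
Qed.

(** The equation along a dart and the one along its reverse are equivalent, so one dart per edge,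
    chosen by [b], suffices. *)
Lemma dart_balanced_half cs z G o (b : edge Gamma -> bool) :
  (forall nu, o nu + o (reverse nu) = - \sum_(c <- cs | c.1.1 == nu.1) c.2) ->
  (forall e, G (other (e, b e)) = G (endpoint (e, b e)) + (o (e, b e))%:~R * len e
        + \sum_(c <- cs | c.1.1 == e) c.2%:~R * dist_to_end (e, b e) c.1.2) ->
  (forall v, \sum_(nu in tangent (vpoint v)) o nu = z v) ->
  dart_balanced cs z G o.
Proof.
move=> oN oG oz; split=> // -[e b']; have [->|bb'] := eqVneq b' (b e); first exact: oG.
have -> : b' = ~~ b e by move: bb'; case: b'; case: (b e).
have := oG e; rewrite /other /endpoint /dist_to_end /= negbK => H.
have := oN (e, b e); rewrite /reverse /= => /eqP.
rewrite addrC -subr_eq0 opprK addrAC -addrA addr_eq0 => /eqP ->.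
rewrite -[in LHS](addrK ((o (e, b e))%:~R * len e) (G _)).
have -> : \sum_(c <- cs | c.1.1 == e) c.2%:~R * (if ~~ b e then c.1.2 else len e - c.1.2) =
    (\sum_(c <- cs | c.1.1 == e) c.2)%:~R * len e
    - \sum_(c <- cs | c.1.1 == e) c.2%:~R * (if b e then c.1.2 else len e - c.1.2) :> R.
  rewrite rmorph_sum /= mulr_suml -sumrB; apply: eq_bigr => c _; case: (b e) => /=; ring.
move: H; set G1 := G _; set G2 := G _; move=> ->.
rewrite !(intrD, intrN); ring.
Qed.

End DartForm.

(** * Refinement of a curve by one vertex *)

(** [F] is [C] with one vertex [mid] added inside [split_edge], which becomes [emap split_edge]
    followed by [new_edge]. The flips allow any orientation of the halves, so that both subdividing
    an edge and erasing a vertex of valence 2 are instances. *)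
Record refinement (R : realType) (C F : tropical_curve R) := Refinement {
  vmap : vertex C -> vertex F;
  vmap_inv : vertex F -> vertex C;
  mid : vertex F;
  emap : edge C -> edge F;
  emap_inv : edge F -> edge C;
  split_edge : edge C;
  new_edge : edge F;
  flip1 : bool;
  flip2 : bool;
  vmapK : cancel vmap vmap_inv;
  vmap_mid : forall u, vmap u != mid;
  vmap_invK : forall w, w != mid -> vmap (vmap_inv w) = w;
  emapK : cancel emap emap_inv;
  emap_new : forall e, emap e != new_edge;
  emap_invK : forall e, e != new_edge -> emap (emap_inv e) = e;
  emap_src : forall e, e != split_edge -> src (emap e) = vmap (src e);
  emap_tgt : forall e, e != split_edge -> tgt (emap e) = vmap (tgt e);
  emap_len : forall e, e != split_edge -> len (emap e) = len e;
  split_start : endpoint (emap split_edge, flip1) = vmap (src split_edge);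
  split_mid1 : endpoint (emap split_edge, ~~ flip1) = mid;
  split_mid2 : endpoint (new_edge, flip2) = mid;
  split_end : endpoint (new_edge, ~~ flip2) = vmap (tgt split_edge);
  split_len : len split_edge = len (emap split_edge) + len new_edge
}.

Section Refine.
Context {R : realType} {C F : tropical_curve R} (r : refinement C F).
Local Notation vmap := (vmap r).
Local Notation emap := (emap r).
Local Notation mid := (mid r).
Local Notation s0 := (split_edge r).
Local Notation n0 := (new_edge r).
Local Notation f1 := (flip1 r).
Local Notation f2 := (flip2 r).
Local Notation L1 := (len (emap s0)).
Local Notation L2 := (len n0).

Lemma vmap_inj : injective vmap. Proof. exact: can_inj (vmapK r). Qed.
Lemma emap_inj : injective emap. Proof. exact: can_inj (emapK r). Qed.

Definition dart_map (nu : edge C * bool) : edge F * bool :=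
  if nu.1 == s0 then (if nu.2 then (n0, ~~ f2) else (emap s0, f1)) else (emap nu.1, nu.2).

Lemma endpoint_dart_map nu : endpoint (dart_map nu) = vmap (endpoint nu).
Proof.
rewrite /dart_map; case: nu => e b /=; case: eqP => [->|/eqP es].
  by case: b; [exact: split_end|exact: split_start].
by rewrite /endpoint /=; case: b; [exact: emap_tgt|exact: emap_src].
Qed.

Lemma dart_map_inj : injective dart_map.
Proof.
have ks e : (emap e == n0) = false by apply/negbTE/emap_new.
move=> [e b] [e' b']; rewrite /dart_map /=.
case: eqP => [->|/eqP es]; case: eqP => [->|/eqP es'].
- by case: b; case: b' => // -[] /eqP; rewrite ?ks // eq_sym ks.
- case: b => -[] /eqP; first by rewrite eq_sym ks.
  by rewrite (inj_eq emap_inj) eq_sym (negbTE es').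
- case: b' => -[] /eqP; first by rewrite ks.
  by rewrite (inj_eq emap_inj) (negbTE es).
- by case=> /emap_inj-> ->.
Qed.

Lemma edgeF_cases (P : edge F -> Prop) :
  P n0 -> P (emap s0) -> (forall e, e != s0 -> P (emap e)) -> forall e, P e.
Proof.
move=> Pn Ps Pk e; have [->//|en] := eqVneq e n0.
rewrite -(emap_invK en); have [->//|] := eqVneq (emap_inv r e) s0; exact: Pk.
Qed.

Lemma bool_neq (b c : bool) : b != c -> b = ~~ c. Proof. by case: b; case: c. Qed.

Lemma tangent_vmap u :
  tangent (vpoint (vmap u)) = [set dart_map nu | nu in tangent (vpoint u)]%SET.
Proof.
apply/setP => -[e b]; rewrite mem_tangent; apply/eqP/imsetP => [|[nu]]; last first.
  by rewrite mem_tangent => /eqP <- ->; exact: endpoint_dart_map.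
move=> eu; suff [nu eE] : exists nu, (e, b) = dart_map nu.
  by exists nu => //; rewrite mem_tangent -(inj_eq vmap_inj) -endpoint_dart_map -eE eu.
have um := vmap_mid r u.
elim/edgeF_cases: e eu => [||e es] eu.
- exists (s0, true); rewrite /dart_map eqxx /=; congr pair; apply: bool_neq.
  by apply: contraNneq um => bf; rewrite -eu bf split_mid2.
- exists (s0, false); rewrite /dart_map eqxx /=; congr pair; apply/eqP.
  by apply: contraNT um => /bool_neq bf; rewrite -eu bf split_mid1.
- by exists (e, b); rewrite /dart_map (negbTE es).
Qed.

Lemma tangent_mid : tangent (vpoint mid) = [set (emap s0, ~~ f1); (n0, f2)]%SET.
Proof.
apply/setP => -[e b]; rewrite mem_tangent !inE !xpair_eqE.
elim/edgeF_cases: e => [||e es].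
- rewrite eqxx (eq_sym n0) (negbTE (emap_new _ _)) /=.
  have [->|/bool_neq->] := eqVneq b f2; first by rewrite split_mid2 eqxx.
  by rewrite split_end (negbTE (vmap_mid _ _)).
- rewrite eqxx (negbTE (emap_new _ _)) /= orbF.
  have [->|/bool_neq->] := eqVneq b (~~ f1); first by rewrite split_mid1 eqxx.
  by rewrite negbK split_start (negbTE (vmap_mid _ _)).
- rewrite (inj_eq emap_inj) (negbTE es) (negbTE (emap_new _ _)) /=.
  rewrite /endpoint /=; apply/negbTE.
  by case: b; rewrite ?emap_tgt// ?emap_src// vmap_mid.
Qed.

Lemma valence_vmap u : valence (vpoint (vmap u)) = valence (vpoint u).
Proof. by rewrite /valence tangent_vmap card_imset//; exact: dart_map_inj. Qed.

Lemma valence_mid : valence (vpoint mid) = 2.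
Proof.
by rewrite /valence tangent_mid cards2 xpair_eqE (negbTE (emap_new _ _)).
Qed.

Lemma sum_tangent_vmap u (out : edge F * bool -> int) :
  \sum_(nu in tangent (vpoint (vmap u))) out nu =
  \sum_(nu in tangent (vpoint u)) out (dart_map nu).
Proof. by rewrite tangent_vmap big_imset//= => ? ? _ _; exact: dart_map_inj. Qed.

Lemma sum_tangent_mid (out : edge F * bool -> int) :
  \sum_(nu in tangent (vpoint mid)) out nu = out (emap s0, ~~ f1) + out (n0, f2).
Proof.
by rewrite tangent_mid big_setU1 ?big_set1// inE xpair_eqE (negbTE (emap_new _ _)).
Qed.

Definition coord_map (e : edge C) (t : R) : edge F * R :=
  if e == s0 then
    if t <= L1 then (emap s0, if f1 then L1 - t else t)
    else (n0, if f2 then L2 - (t - L1) else t - L1)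
  else (emap e, t).

Definition chip_map (c : edge C * R * int) : edge F * R * int := (coord_map c.1.1 c.1.2, c.2).

Implicit Types (cs : seq (edge C * R * int)).

Lemma coord_map_itv e t : 0 <= t <= len e ->
  0 <= (coord_map e t).2 <= len (coord_map e t).1.
Proof.
rewrite /coord_map; case: eqP => [->|/eqP es]; last by rewrite /= emap_len.
rewrite split_len => /andP[t0 tL]; case: ifP => [tL1|/negbT]; last rewrite -ltNge => tL1.
  by case: f1; rewrite /= ?t0 ?tL1// subr_ge0 tL1 gerBl t0.
by case: f2 => /=; lra.
Qed.

Lemma on_curve_chip_map cs : on_curve cs -> on_curve (map chip_map cs).
Proof.
by move=> cs_on; rewrite /on_curve all_map; apply: sub_all cs_on => c; exact: coord_map_itv.
Qed.

Section ChipSums.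
Variables (V : zmodType) (H : edge F * R * int -> V) (cs : seq (edge C * R * int)).

Lemma sum_chip_map e : e != s0 -> \sum_(c <- map chip_map cs | c.1.1 == emap e) H c =
  \sum_(c <- cs | c.1.1 == e) H (emap e, c.1.2, c.2).
Proof.
move=> es; rewrite big_map big_mkcond [RHS]big_mkcond; apply: eq_bigr => c _.
rewrite /chip_map /coord_map /=; have [->|cs0] := eqVneq c.1.1 s0.
  have es' : (s0 == e) = false by rewrite eq_sym (negbTE es).
  rewrite es'; case: (c.1.2 <= L1) => /=; first by rewrite (inj_eq emap_inj) es'.
  by rewrite eq_sym (negbTE (emap_new _ _)).
by rewrite /= (inj_eq emap_inj); case: eqP => [->|].
Qed.

Lemma sum_chip_map1 : \sum_(c <- map chip_map cs | c.1.1 == emap s0) H c =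
  \sum_(c <- cs | (c.1.1 == s0) && (c.1.2 <= L1))
    H (emap s0, if f1 then L1 - c.1.2 else c.1.2, c.2).
Proof.
rewrite big_map big_mkcond [RHS]big_mkcond; apply: eq_bigr => c _.
rewrite /chip_map /coord_map /=; have [_|cs0] /= := eqVneq c.1.1 s0.
  by case: (c.1.2 <= L1) => /=; rewrite ?eqxx// eq_sym (negbTE (emap_new _ _)).
by rewrite (inj_eq emap_inj) (negbTE cs0).
Qed.

Lemma sum_chip_map2 : \sum_(c <- map chip_map cs | c.1.1 == n0) H c =
  \sum_(c <- cs | (c.1.1 == s0) && ~~ (c.1.2 <= L1))
    H (n0, if f2 then L2 - (c.1.2 - L1) else c.1.2 - L1, c.2).
Proof.
rewrite big_map big_mkcond [RHS]big_mkcond; apply: eq_bigr => c _.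
rewrite /chip_map /coord_map /=; have [_|cs0] /= := eqVneq c.1.1 s0.
  by case: (c.1.2 <= L1) => /=; rewrite ?eqxx// (negbTE (emap_new _ _)).
by rewrite (negbTE (emap_new _ _)).
Qed.
End ChipSums.

Definition push_vertex (z : vertex C -> int) (w : vertex F) : int :=
  if w == mid then 0 else z (vmap_inv r w).

Lemma push_vertex_vmap z u : push_vertex z (vmap u) = z u.
Proof. by rewrite /push_vertex (negbTE (vmap_mid _ _)) vmapK. Qed.

Lemma vertexF_cases (P : vertex F -> Prop) : P mid -> (forall u, P (vmap u)) -> forall w, P w.
Proof. by move=> Pm Pi w; have [->//|/vmap_invK <-] := eqVneq w mid. Qed.

Let K1 cs := \sum_(c <- cs | (c.1.1 == s0) && (c.1.2 <= L1)) c.2.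
Let K2 cs := \sum_(c <- cs | (c.1.1 == s0) && ~~ (c.1.2 <= L1)) c.2.
Let M1 cs := \sum_(c <- cs | (c.1.1 == s0) && (c.1.2 <= L1)) c.2%:~R * (L1 - c.1.2).
Let M2 cs := \sum_(c <- cs | (c.1.1 == s0) && ~~ (c.1.2 <= L1)) c.2%:~R * (len s0 - c.1.2).

Let K12 cs : \sum_(c <- cs | c.1.1 == s0) c.2 = K1 cs + K2 cs.
Proof. exact: bigID. Qed.

Let M12 cs : \sum_(c <- cs | c.1.1 == s0) c.2%:~R * (len s0 - c.1.2) =
  M1 cs + (K1 cs)%:~R * L2 + M2 cs.
Proof.
rewrite (bigID (fun c => c.1.2 <= L1)); congr (_ + _).
rewrite rmorph_sum /= mulr_suml -big_split; apply: eq_bigr => c _.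
by rewrite split_len /=; ring.
Qed.

Let dist1 cs : \sum_(c <- map chip_map cs | c.1.1 == emap s0)
  c.2%:~R * dist_to_end (emap s0, f1) c.1.2 = M1 cs.
Proof.
rewrite sum_chip_map1; apply: eq_bigr => c _; rewrite /dist_to_end /=.
by case: f1.
Qed.

Let dist2 cs : \sum_(c <- map chip_map cs | c.1.1 == n0)
  c.2%:~R * dist_to_end (n0, f2) c.1.2 = M2 cs.
Proof.
rewrite sum_chip_map2; apply: eq_bigr => c _; rewrite /dist_to_end /=.
by rewrite split_len; case: f2; ring.
Qed.

(** The vertex [mid] carries nothing itself, so the slope passes unchanged from one half to the
    other and the two equations add up to that of the split edge. *)
Lemma dart_balanced_coarsen cs z G out :
  dart_balanced (map chip_map cs) (push_vertex z) G out ->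
  dart_balanced cs z (G \o vmap) (out \o dart_map).
Proof.
move=> [oN oG oz].
have omid : out (n0, f2) = - out (emap s0, ~~ f1).
  have := oz mid; rewrite sum_tangent_mid /push_vertex eqxx => /eqP.
  by rewrite addrC addr_eq0 => /eqP.
have o1 := oN (emap s0, f1); rewrite /reverse /= sum_chip_map1 -/(K1 cs) in o1.
have o2 := oN (n0, f2); rewrite /reverse /= sum_chip_map2 -/(K2 cs) in o2.
apply: (@dart_balanced_half _ _ _ _ _ _ (fun=> false)) => [nu|e|v].
- case: nu => e b; rewrite /reverse /dart_map /=; case: eqP => [->|/eqP es].
    by rewrite K12; case: b => /=; lia.
  by rewrite (oN (emap e, b)) /= sum_chip_map.
- rewrite /dart_map /=; case: eqP => [->|/eqP es].
    rewrite M12 -dist2 -dist1 /other /endpoint /= -split_start -split_end.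
    have := oG (n0, f2); have := oG (emap s0, f1).
    rewrite /other /= split_mid1 split_mid2 => -> ->; rewrite omid.
    have -> : out (emap s0, ~~ f1) = - out (emap s0, f1) - K1 cs by lia.
    by rewrite split_len !(intrD, intrN); ring.
  have := oG (emap e, false); rewrite /other /endpoint /= emap_src// emap_tgt//.
  by rewrite emap_len// sum_chip_map// => ->; rewrite /dist_to_end /= emap_len.
- by rewrite -push_vertex_vmap -oz sum_tangent_vmap.
Qed.
End Refine.

Section RefineMap.
Context {R : realType} {C F : tropical_curve R} (r : refinement C F).
Local Notation vmap := (vmap r).
Local Notation emap := (emap r).
Local Notation mid := (mid r).
Local Notation s0 := (split_edge r).
Local Notation n0 := (new_edge r).
Local Notation f1 := (flip1 r).
Local Notation f2 := (flip2 r).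
Local Notation L1 := (len (emap s0)).
Local Notation L2 := (len n0).
Implicit Types (cs : seq (edge C * R * int)).

(** The value at [mid] and the slopes there are those of the function on the split edge at distance
    [L1]; [K1] and [M1] account for the chips met before. *)
Lemma dart_balanced_refine cs z G out : dart_balanced cs z G out ->
  exists G' out', dart_balanced (map (chip_map r) cs) (push_vertex r z) G' out'.
Proof.
move=> [oN oG oz].
pose K1 := \sum_(c <- cs | (c.1.1 == s0) && (c.1.2 <= L1)) c.2.
pose M1 := \sum_(c <- cs | (c.1.1 == s0) && (c.1.2 <= L1)) c.2%:~R * (L1 - c.1.2).
pose G' w := if w == mid then G (src s0) + (out (s0, false))%:~R * L1 + M1
             else G (vmap_inv r w).
pose out' (nu : edge F * bool) := 
  if nu.1 == n0 then (if nu.2 == f2 then out (s0, false) + K1 else out (s0, true))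
  else if emap_inv r nu.1 == s0 then
    (if nu.2 == f1 then out (s0, false) else - out (s0, false) - K1)
  else out (emap_inv r nu.1, nu.2).
have eN e : (emap e == n0) = false by apply/negbTE/emap_new.
have outn b : out' (n0, b) = if b == f2 then out (s0, false) + K1 else out (s0, true).
  by rewrite /out' eqxx.
have outs b : out' (emap s0, b) = if b == f1 then out (s0, false) else - out (s0, false) - K1.
  by rewrite /out' /= eN emapK eqxx.
have oute e b : e != s0 -> out' (emap e, b) = out (e, b).
  by move=> es; rewrite /out' /= eN emapK (negbTE es).
have G'v u : G' (vmap u) = G u by rewrite /G' (negbTE (vmap_mid _ _)) vmapK.
have G'm : G' mid = G (src s0) + (out (s0, false))%:~R * L1 + M1 by rewrite /G' eqxx.
have oNs : out (s0, true) = - out (s0, false) - K1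
    - \sum_(c <- cs | (c.1.1 == s0) && ~~ (c.1.2 <= L1)) c.2.
  have := oN (s0, true); rewrite (bigID (fun c => c.1.2 <= L1)) /reverse /= -/K1.
  by set K2 := \sum_(_ <- _ | _ && ~~ _) _; lia.
exists G', out'.
apply: (@dart_balanced_half _ _ _ _ _ _ (fun e => if e == n0 then f2 else
  if e == emap s0 then f1 else false)) => [[e b]|e|w].
- rewrite /reverse /=; elim/(edgeF_cases (r := r)): e => [||e es].
  + rewrite !outn sum_chip_map2 oNs /=; set K2 := \sum_(_ <- _ | _ && ~~ _) _.
    by case: b; case: f2 => /=; lia.
  + by rewrite !outs sum_chip_map1 /= -/K1; case: b; case: f1 => /=; lia.
  + by rewrite !oute// sum_chip_map//; exact: oN (e, b).
- elim/(edgeF_cases (r := r)): e => [||e es].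
  + rewrite eqxx split_mid2 /other split_end G'v G'm outn eqxx sum_chip_map2.
    have := oG (s0, false); rewrite /other /endpoint /= => ->.
    rewrite (bigID (fun c => c.1.2 <= L1)) /dist_to_end /=.
    have -> : \sum_(c <- cs | (c.1.1 == s0) && (c.1.2 <= L1)) c.2%:~R * (len s0 - c.1.2) =
        M1 + K1%:~R * L2.
      rewrite /K1 rmorph_sum /= mulr_suml -big_split; apply: eq_bigr => c _.
      by rewrite split_len /=; ring.
    rewrite [in LHS](eq_bigr (fun c => c.2%:~R * (L2 - (c.1.2 - L1)))); last first.
      by move=> c _; rewrite split_len; ring.
    rewrite [in RHS](eq_bigr (fun c => c.2%:~R * (L2 - (c.1.2 - L1)))); last first.
      by move=> c _; case: f2 => //; rewrite opprB addrC subrK.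
    by rewrite split_len intrD; ring.
  + rewrite eN eqxx split_start /other split_mid1 G'm G'v outs eqxx; congr (_ + _).
    rewrite sum_chip_map1; apply: eq_bigr => c _; rewrite /dist_to_end /=.
    by case: f1.
  + rewrite eN (inj_eq (@emap_inj _ _ _ r)) (negbTE es) /other /endpoint /=.
    rewrite emap_src// emap_tgt// !G'v oute// sum_chip_map// emap_len//.
    by have := oG (e, false); rewrite /other /endpoint /dist_to_end /= emap_len.
- elim/(vertexF_cases (r := r)): w => [|u].
    rewrite sum_tangent_mid outs outn eqxx /push_vertex eqxx.
    by case: f1 => /=; lia.
  rewrite push_vertex_vmap sum_tangent_vmap -oz; apply: eq_bigr => -[e b] _.
  rewrite /dart_map /=; case: eqP => [->|/eqP es]; last exact: oute.
  by case: b; rewrite ?outn ?outs ?eqxx//; case: f2.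
Qed.

End RefineMap.

(** * The homeomorphism of a refinement *)

Section RefineMap.
Context {R : realType} {C F : tropical_curve R} (r : refinement C F).
Local Notation vmap := (vmap r).
Local Notation emap := (emap r).
Local Notation mid := (mid r).
Local Notation s0 := (split_edge r).
Local Notation n0 := (new_edge r).
Local Notation f1 := (flip1 r).
Local Notation f2 := (flip2 r).
Local Notation L1 := (len (emap s0)).
Local Notation L2 := (len n0).
Implicit Types (cs : seq (edge C * R * int)).

Definition refine_map (p : C) : F :=
  match val p with
  | inl u => vpoint (vmap u)
  | inr (e, t) => edge_path (coord_map r e t).1 (coord_map r e t).2
  end.

Lemma edge_path_end (Gamma : tropical_curve R) (e : edge Gamma) (b : bool) :
  edge_path e (if b then len e else 0) = vpoint (endpoint (e, b)).
Proof. by case: b; [rewrite edge_path_ge|rewrite edge_path_le0]. Qed.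

Lemma edge_path_end' (Gamma : tropical_curve R) (e : edge Gamma) (b : bool) :
  edge_path e (if b then 0 else len e) = vpoint (endpoint (e, ~~ b)).
Proof. by case: b; [rewrite edge_path_le0|rewrite edge_path_ge]. Qed.

Lemma refine_map_vpoint u : refine_map (vpoint u) = vpoint (vmap u).
Proof. by []. Qed.

Lemma refine_map_edge_path e t : 0 <= t <= len e ->
  refine_map (edge_path e t) = edge_path (coord_map r e t).1 (coord_map r e t).2.
Proof.
move=> /andP[t0 tL]; have [->|tn0] := eqVneq t 0.
  rewrite edge_path_le0// refine_map_vpoint /coord_map; case: eqP => [->|/eqP es] /=.
    by rewrite (ltW (len_gt0 _)) subr0 edge_path_end split_start.
  by rewrite edge_path_le0// emap_src.
have [->|tnL] := eqVneq t (len e).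
  rewrite edge_path_ge// refine_map_vpoint /coord_map; case: eqP => [->|/eqP es] /=.
    rewrite leNgt split_len ltrDl len_gt0 /= addrAC subrr add0r subrr.
    by rewrite edge_path_end' split_end.
  by rewrite edge_path_ge ?emap_len// emap_tgt.
by rewrite /refine_map val_edge_path// !lt_neqAle eq_sym tn0 t0 tnL tL.
Qed.

Definition push (Z : {freeg C / int}) : {freeg F / int} :=
  fglift (fun p => << refine_map p >> : {freeg F / int}) Z.

Lemma pushU k p : push << k *g p >> = << k *g refine_map p >>.
Proof.
rewrite /push liftU; apply: freeg_ext => q; rewrite coeffZ !coeffU; ring.
Qed.

Lemma push_is_additive : additive push.
Proof. exact: lift_is_additive. Qed.

HB.instance Definition _ :=
  GRing.isAdditive.Build {freeg C / int} {freeg F / int} push push_is_additive.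

Lemma push_points (s : seq C) : push (points s) = points (map refine_map s).
Proof.
rewrite raddf_sum /points big_map; apply: eq_bigr => p _; exact: pushU.
Qed.

Lemma push_vertex_div z : push (vertex_div z) = vertex_div (push_vertex r z).
Proof.
rewrite raddf_sum /vertex_div [RHS](bigD1 mid)//= /push_vertex eqxx freegU0 add0r.
rewrite (reindex_onto vmap (vmap_inv r)) /=; last exact: vmap_invK.
apply: eq_big => [u|u _]; first by rewrite vmap_mid vmapK eqxx.
by rewrite (negbTE (vmap_mid r u)) vmapK; exact: pushU.
Qed.

Lemma push_chip_div cs : on_curve cs -> push (chip_div cs) = chip_div (map (chip_map r) cs).
Proof.
move=> cs_on; rewrite raddf_sum /chip_div big_map; apply: eq_big_seq => c ccs.
by rewrite -refine_map_edge_path ?(on_curveP cs_on)//; exact: pushU.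
Qed.

Lemma push_canonical : push canonical_divisor = canonical_divisor.
Proof.
rewrite -![canonical_divisor]/(vertex_div _) push_vertex_div; congr vertex_div.
apply/funext => w; elim/(vertexF_cases (r := r)): w => [|u].
  by rewrite /push_vertex eqxx valence_mid.
by rewrite push_vertex_vmap valence_vmap.
Qed.

Lemma principal_push Z : principal Z <-> principal (push Z).
Proof.
have [z [cs [cs_on ->]]] := div_decomp Z.
rewrite raddfD /= push_vertex_div push_chip_div//.
split=> /principal_balanced-/(_ _)/dart_balancedP[]; rewrite ?on_curve_chip_map//.
  move=> G [out /(dart_balanced_refine r) bal].
  by apply/principal_balanced; [exact: on_curve_chip_map|exact/dart_balancedP].
move=> G [out /dart_balanced_coarsen bal].
by apply/principal_balanced => //; apply/dart_balancedP; exists (G \o vmap), (out \o dart_map r).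
Qed.

Lemma canonical_equiv_push s : canonical_equiv s <-> canonical_equiv (map refine_map s).
Proof.
rewrite /canonical_equiv -push_points -push_canonical -raddfB /=.
exact: principal_push.
Qed.

Let coarse_param (nu : edge F * bool) (t : R) := if nu.2 then len nu.1 - t else t.

Definition refine_inv (p : F) : C :=
  match val p with
  | inl w => if w == mid then edge_path s0 L1 else vpoint (vmap_inv r w)
  | inr (e, t) =>
      if e == n0 then edge_path s0 (L1 + (if f2 then L2 - t else t))
      else if emap_inv r e == s0 then edge_path s0 (if f1 then L1 - t else t)
      else edge_path (emap_inv r e) t
  end.

Lemma L1_itv : 0 < L1 < len s0.
Proof. by rewrite len_gt0 split_len ltrDl len_gt0. Qed.

Lemma refine_map_mid : refine_map (edge_path s0 L1) = vpoint mid.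
Proof.
have /andP[L0 LL] := L1_itv; rewrite refine_map_edge_path ?ltW// /coord_map eqxx lexx.
by rewrite subrr edge_path_end' split_mid1.
Qed.

Lemma refine_mapK : cancel refine_map refine_inv.
Proof.
have eN e : (emap e == n0) = false by apply/negbTE/emap_new.
move=> p; case: (pointP p) => [u|e t te].
  by rewrite refine_map_vpoint /refine_inv /= (negbTE (vmap_mid _ _)) vmapK.
have /andP[t0 tL] := te; rewrite refine_map_edge_path ?ltW// /coord_map.
case: eqP te tL => [->|/eqP es] te tL; last first.
  rewrite /refine_inv val_edge_path /=; last by rewrite emap_len.
  by rewrite eN emapK (negbTE es).
have [tL1|tL1] := leP t L1.
  have [->|tn] := eqVneq t L1.
    by rewrite subrr edge_path_end' split_mid1 /refine_inv /= eqxx.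
  have tlt : t < L1 by rewrite lt_neqAle tn.
  rewrite /refine_inv val_edge_path /=; last by case: f1; lra.
  by rewrite eN emapK eqxx; case: f1; rewrite ?opprB ?(addrC L1) ?subrK.
rewrite split_len in tL.
rewrite /refine_inv val_edge_path /=; last by case: f2; lra.
by rewrite eqxx; congr edge_path; case: f2; ring.
Qed.

Lemma refine_inv_edge_path e t : 0 <= t <= len e ->
  refine_inv (edge_path e t) =
    if e == n0 then edge_path s0 (L1 + (if f2 then L2 - t else t))
    else if emap_inv r e == s0 then edge_path s0 (if f1 then L1 - t else t)
    else edge_path (emap_inv r e) t.
Proof.
have eN e' : (emap e' == n0) = false by apply/negbTE/emap_new.
have iv u : refine_inv (vpoint (vmap u)) = vpoint u.
  by rewrite /refine_inv /= (negbTE (vmap_mid _ _)) vmapK.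
have im : refine_inv (vpoint mid) = edge_path s0 L1 by rewrite /refine_inv /= eqxx.
move=> /andP[t0 tL]; have [te|] := boolP (0 < t < len e).
  by rewrite /refine_inv val_edge_path.
rewrite negb_and -!leNgt => te.
have {te t0 tL} : t = 0 \/ t = len e by case/orP: te => ?; [left|right]; lra.
elim/(edgeF_cases (r := r)): e => [||e es].
- rewrite eqxx; have := edge_path_end n0 f2; have := edge_path_end' n0 f2.
  have := edge_path_end' s0 false; rewrite split_mid2 split_end /endpoint /= split_len.
  case: f2 => /= e0 e1 e2 [] ->; rewrite ?subr0 ?subrr ?addr0 ?e0 ?e1 ?e2 ?iv ?im//.
- rewrite eN emapK eqxx; have := edge_path_end (emap s0) f1; have := edge_path_end' (emap s0) f1.
  have := edge_path_end s0 false; rewrite split_mid1 split_start /endpoint /=.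
  by case: f1 => /= e0 e1 e2 [] ->; rewrite ?subr0 ?subrr ?addr0 ?e0 ?e1 ?e2 ?iv ?im.
- rewrite eN emapK (negbTE es) => -[] ->.
    by rewrite !edge_path_le0// emap_src// iv.
  by rewrite !edge_path_ge// ?emap_len// emap_tgt// iv.
Qed.

Lemma refine_invK : cancel refine_inv refine_map.
Proof.
have eN e' : (emap e' == n0) = false by apply/negbTE/emap_new.
have /andP[L1_gt0 L1_lt] := L1_itv.
move=> p; case: (pointP p) => [w|e t te].
  elim/(vertexF_cases (r := r)): w => [|u].
    by rewrite /refine_inv /= eqxx refine_map_mid.
  by rewrite /refine_inv /= (negbTE (vmap_mid _ _)) vmapK.
have /andP[t0 tL] := te; rewrite refine_inv_edge_path ?ltW//.
elim/(edgeF_cases (r := r)): e te t0 tL => [||e es] te t0 tL.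
- rewrite eqxx refine_map_edge_path; last by rewrite split_len; case: f2; lra.
  rewrite /coord_map eqxx leNgt ltrDl; case: f2; rewrite ?subr_gt0 ?tL ?t0 /=.
    by congr edge_path; ring.
  by congr edge_path; ring.
- rewrite eN emapK eqxx refine_map_edge_path; last by rewrite split_len in L1_lt *; case: f1; lra.
  rewrite /coord_map eqxx; case: f1; last by rewrite ltW.
  have -> : L1 - t <= L1 by lra.
  by rewrite /= opprB addrC subrK.
- rewrite eN emapK (negbTE es) refine_map_edge_path ?/coord_map ?(negbTE es)//.
  by rewrite -(emap_len es) !ltW.
Qed.

Lemma refine_inv_continuous : continuous refine_inv.
Proof.
apply: continuous_curve => e.
have cE (f : R -> C) : continuous f -> (forall t, 0 <= t <= len e -> refine_inv (edge_path e t) = f t) ->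
    continuous (refine_inv \o edge_path e).
  move=> fC fE; rewrite (_ : _ \o _ = f \o clamp e); last first.
    by apply/funext => t /=; rewrite -edge_path_clamp fE// clampP.
  by move=> t; apply: continuous_comp; [exact: continuous_clamp|exact: fC].
apply: cE (fun t te => refine_inv_edge_path te).
have cB (a : R) : continuous (fun x => a - x).
  by move=> t; apply: cvgB; [exact: cvg_cst|exact: cvg_id].
case: (e == n0); last case: (emap_inv r e == s0); last exact: edge_path_continuous.
  move=> t; apply: (@continuous_comp _ _ _ (fun t => L1 + (if f2 then L2 - t else t))
    (edge_path s0)); last exact: edge_path_continuous.
  by apply: cvgD; [exact: cvg_cst|case: f2; [exact: cB|exact: cvg_id]].
move=> t; apply: (@continuous_comp _ _ _ (fun t => if f1 then L1 - t else t) (edge_path s0));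
  last exact: edge_path_continuous.
by case: f1; [exact: cB|exact: cvg_id].
Qed.

Let dart_path (nu : edge F * bool) (t : R) := edge_path nu.1 (if nu.2 then len nu.1 - t else t).

Let dart_path_continuous nu : continuous (dart_path nu).
Proof.
move=> t; apply: (@continuous_comp _ _ _ (fun t => if nu.2 then len nu.1 - t else t)
  (edge_path nu.1)); last exact: edge_path_continuous.
by case: nu.2; [apply: cvgB; [exact: cvg_cst|exact: cvg_id]|exact: cvg_id].
Qed.

Let refine_map_split t : refine_map (edge_path s0 t) =
  if t <= L1 then dart_path (emap s0, f1) t else dart_path (n0, f2) (t - L1).
Proof.
have /andP[L1_gt0 L1_lt] := L1_itv; have L2_gt0 := len_gt0 n0.
have [t0|t0] := leP t 0.
  rewrite edge_path_le0// refine_map_vpoint (le_trans t0) ?(ltW L1_gt0)// -split_start.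
  rewrite /dart_path /=; case: f1; rewrite /endpoint /=.
    by rewrite edge_path_ge// lerBrDr gerDl.
  by rewrite edge_path_le0.
have [tL|tL] := leP (len s0) t.
  rewrite edge_path_ge// refine_map_vpoint leNgt (lt_le_trans L1_lt tL) /= -split_end.
  rewrite split_len in tL; rewrite /dart_path /=; case: f2; rewrite /endpoint /=.
    by rewrite edge_path_le0//; lra.
  by rewrite edge_path_ge//; lra.
rewrite refine_map_edge_path; last by rewrite !ltW.
rewrite /coord_map eqxx /dart_path.
by case: ifP.
Qed.

Lemma refine_map_continuous : continuous refine_map.
Proof.
have L1_gt0 := len_gt0 (emap s0); have L2_gt0 := len_gt0 n0.
apply: continuous_curve => e; have [->|es] := eqVneq e s0; last first.
  rewrite (_ : _ \o _ = edge_path (emap e)); first exact: edge_path_continuous.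
  apply/funext => t /=; rewrite -(edge_path_clamp e) refine_map_edge_path ?clampP//.
  rewrite /coord_map (negbTE es) /= (_ : clamp e t = clamp (emap e) t) ?edge_path_clamp//.
  by rewrite /clamp emap_len.
have late t : L1 <= t -> dart_path (emap s0, f1) t = vpoint mid.
  move=> tL; rewrite /dart_path /= -(split_mid1 r); case: f1; rewrite /endpoint /=.
    by rewrite edge_path_le0// subr_le0.
  by rewrite edge_path_ge.
have early t : t <= L1 -> dart_path (n0, f2) (t - L1) = vpoint mid.
  move=> tL; rewrite /dart_path /= -(split_mid2 r); case: f2; rewrite /endpoint /=.
    by rewrite edge_path_ge//; lra.
  by rewrite edge_path_le0//; lra.
have c2 : continuous (fun t => dart_path (n0, f2) (t - L1)).
  move=> t; apply: (@continuous_comp _ _ _ (fun t => t - L1) (dart_path (n0, f2)));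
    last exact: dart_path_continuous.
  by apply: cvgB; [exact: cvg_id|exact: cvg_cst].
apply/continuousP => U oU.
have o1 : open (dart_path (emap s0, f1) @^-1` U).
  by have /continuousP := @dart_path_continuous (emap s0, f1); apply.
have o2 : open ((fun t => dart_path (n0, f2) (t - L1)) @^-1` U).
  by have /continuousP := c2; apply.
(* Each half, extended beyond its range, is constantly [mid]. So the preimage of [U] is the
   intersection of the two open preimages if [mid] is in [U], and their union otherwise. *)
have [mU|mU] := pselect (U (vpoint mid)).
  rewrite (_ : _ @^-1` U = (dart_path (emap s0, f1) @^-1` U) `&`
      ((fun t => dart_path (n0, f2) (t - L1)) @^-1` U)); first exact: openI.
  apply/seteqP; split=> t; rewrite /= refine_map_split; have [tL|tL] := leP t L1.
  - by rewrite early.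
  - by rewrite (late t)// ltW.
  - by case.
  - by case.
rewrite (_ : _ @^-1` U = (dart_path (emap s0, f1) @^-1` U) `|`
    ((fun t => dart_path (n0, f2) (t - L1)) @^-1` U)); first exact: openU.
apply/seteqP; split=> t; rewrite /= refine_map_split; have [tL|tL] := leP t L1.
- by left.
- by right.
- by case=> //; rewrite early.
- by case=> //; rewrite late// ltW.
Qed.

End RefineMap.

(** * Subdivision at an arbitrary point *)

(** The relation of [graph_connected] for bare incidence maps, usable before a new curve has been
    built. *)
Definition adjacent (V E : finType) (s t : E -> V) : rel V :=
  fun x y => [exists e, ((s e == x) && (t e == y)) || ((s e == y) && (t e == x))].

Lemma adjacentP (V E : finType) (s t : E -> V) x y :
  reflect (exists e, (s e = x /\ t e = y) \/ (s e = y /\ t e = x)) (adjacent s t x y).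
Proof.
apply: (iffP existsP) => -[e].
  by case/orP => /andP[/eqP se /eqP te]; exists e; [left|right].
by case=> -[se te]; exists e; rewrite se te !eqxx ?orbT.
Qed.

Lemma adjacent_sym (V E : finType) (s t : E -> V) : symmetric (adjacent s t).
Proof. by move=> x y; apply/adjacentP/adjacentP => -[e] []; exists e; tauto. Qed.

Lemma connect_ends (V E : finType) (s t : E -> V) e : connect (adjacent s t) (s e) (t e).
Proof. by apply/connect1/adjacentP; exists e; left. Qed.

Lemma connect_endsV (V E : finType) (s t : E -> V) e : connect (adjacent s t) (t e) (s e).
Proof. by apply/connect1/adjacentP; exists e; right. Qed.

Section Subdivide.
Context {R : realType} (C : tropical_curve R) (e0 : edge C) (t : R).
Hypothesis te0 : 0 < t < len e0.

(** [None] is the new vertex, and as an edge the second half of [e0]; [Some e0] is the first half,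
    of length [t]. *)
Let V : finType := option (vertex C).
Let E : finType := option (edge C).
Let s (e : E) : V := omap (@src R C) e.
Let g (e : E) : V :=
  if e is Some e' then (if e' == e0 then None else Some (tgt e')) else Some (tgt e0).
Let l (e : E) : R :=
  if e is Some e' then (if e' == e0 then t else len e') else len e0 - t.

Let l_gt0 e : 0 < l e.
Proof.
case: e => [e|] /=; last by rewrite subr_gt0; case/andP: te0.
by case: eqP => _; [case/andP: te0|exact: len_gt0].
Qed.

Let E_inhabited : (0 < #|{: E}|)%N.
Proof. by rewrite card_option. Qed.

Let connected_Some u v : connect (adjacent s g) (Some u) (Some v).
Proof.
have := graph_connected u v; rewrite -/(adjacent _ _) => /connectP[p].
elim: p u => [|w p IH] u /=; first by move=> _ ->; exact: connect0.
move=> /andP[uw wp vE]; apply: connect_trans (IH w wp vE).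
have st e : connect (adjacent s g) (Some (src e)) (Some (tgt e)).
  have [->|ne] := eqVneq e e0.
    apply: (connect_trans (connect_ends s g (Some e0))).
    by rewrite /= eqxx; exact: (connect_ends s g None).
  by have := connect_ends s g (Some e); rewrite /= (negbTE ne).
have /adjacentP[e [[<- <-]|[<- <-]]] := uw; first exact: st.
by rewrite (sym_connect_sym (adjacent_sym s g)) st.
Qed.

Let connected_all u v : connect (adjacent s g) u v.
Proof.
have reach w : connect (adjacent s g) (Some (src e0)) w.
  case: w => [w|]; first exact: connected_Some.
  by have := connect_ends s g (Some e0); rewrite /= eqxx.
apply: connect_trans (reach v).
by rewrite (sym_connect_sym (adjacent_sym s g)).
Qed.

Definition subdivision : tropical_curve R :=
  @TropicalCurve R V E s g l l_gt0 E_inhabited connected_all.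

Definition subdivision_refinement : refinement C subdivision.
Proof.
apply: (@Refinement R C subdivision (Some : vertex C -> vertex subdivision)
  (odflt (src e0)) None (Some : edge C -> edge subdivision) (odflt e0) e0 None false false) => //=.
- by case.
- by case.
- by move=> e /negbTE->.
- by move=> e /negbTE->.
- by rewrite /endpoint /= eqxx.
- by rewrite /endpoint /= eqxx addrC subrK.
Defined.

End Subdivide.

Section Refined.
Context {R : realType} {C F : tropical_curve R} (r : refinement C F).

Lemma refined_loopless : loopless (Gamma := C) -> loopless (Gamma := F).
Proof.
have neq (e : edge F) b : (src e == tgt e) = (endpoint (e, b) == endpoint (e, ~~ b)).
  by case: b; rewrite /endpoint //= eq_sym.
move=> lC; elim/(edgeF_cases (r := r)) => [||e es].
- by rewrite (neq _ (flip2 r)) split_mid2 split_end eq_sym vmap_mid.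
- by rewrite (neq _ (flip1 r)) split_mid1 split_start vmap_mid.
- by rewrite emap_src// emap_tgt// (inj_eq (@vmap_inj _ _ _ r)).
Qed.

Lemma refined_leafless : leafless (Gamma := C) -> leafless (Gamma := F).
Proof.
move=> lC; elim/(vertexF_cases (r := r)) => [|u]; first by rewrite valence_mid.
by rewrite valence_vmap.
Qed.

End Refined.

Definition good_curve (R : realType) (Gamma : tropical_curve R) :=
  [/\ loopless (Gamma := Gamma), leafless (Gamma := Gamma)
    & #|edge Gamma|%:Z = #|vertex Gamma|%:Z + 2].

Lemma good_subdivision (R : realType) (C : tropical_curve R) (e0 : edge C) t
    (te0 : 0 < t < len e0) : good_curve C -> good_curve (subdivision te0).
Proof.
case=> lC fC eC; split.
- exact: refined_loopless (subdivision_refinement te0) lC.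
- exact: refined_leafless (subdivision_refinement te0) fC.
- by rewrite /= !card_option; move: eC; lia.
Qed.

Lemma subdivision_mid (R : realType) (C : tropical_curve R) (e0 : edge C) t
    (te0 : 0 < t < len e0) :
  refine_map (subdivision_refinement te0) (edge_path e0 t) =
  vpoint (mid (subdivision_refinement te0)).
Proof.
rewrite -refine_map_mid; congr (refine_map _ (edge_path _ _)).
by rewrite /= eqxx.
Qed.

(** Subdividing at the two points turns them into vertices, and equivalence is invariant under
    refinement. *)
Lemma canonical_equiv2 (R : realType) (Gamma : tropical_curve R) (p1 p2 : Gamma) :
  good_curve Gamma -> exists q1 q2, canonical_equiv [:: p1; p2; q1; q2].
Proof.
have pull (C F : tropical_curve R) (r : refinement C F) (x1 x2 : C) :
    (exists q1 q2, canonical_equiv [:: refine_map r x1; refine_map r x2; q1; q2]) ->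
    exists q1 q2, canonical_equiv [:: x1; x2; q1; q2].
  move=> [q1 [q2 KE]]; exists (refine_inv r q1), (refine_inv r q2).
  by apply/(canonical_equiv_push r); rewrite /= !refine_invK.
have half (C : tropical_curve R) (u : vertex C) (x : C) : good_curve C ->
    exists q1 q2, canonical_equiv [:: vpoint u; x; q1; q2].
  case: (pointP x) => [w [? ? ?]|e t te gC]; first exact: canonical_equiv_vertex2.
  apply: (pull _ _ (subdivision_refinement te)); rewrite subdivision_mid refine_map_vpoint.
  by case: (good_subdivision te gC) => ? ? ?; exact: canonical_equiv_vertex2.
case: (pointP p1) => [u|e t te gC]; first exact: half.
apply: (pull _ _ (subdivision_refinement te)); rewrite subdivision_mid.
exact/half/good_subdivision.
Qed.

Lemma canonical_equiv_square (R : realType) (Gamma : tropical_curve R) (p q : Gamma) :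
  good_curve Gamma ->
  (forall x, exists x', principal (points [:: p; q] - points [:: x; x'])) ->
  canonical_equiv [:: p; p; q; q].
Proof.
pose P (C : tropical_curve R) (x y : C) := forall z, exists z', principal (points [:: x; y] - points [:: z; z']).
have pull (C F : tropical_curve R) (r : refinement C F) (x y : C) : P C x y ->
    (P F (refine_map r x) (refine_map r y) ->
     canonical_equiv [:: refine_map r x; refine_map r x; refine_map r y; refine_map r y]) ->
    canonical_equiv [:: x; x; y; y].
  move=> Pxy KE; apply/(canonical_equiv_push r); apply: KE => z.
  have [z' /(principal_push r)] := Pxy (refine_inv r z).
  by rewrite raddfB /= !push_points /= refine_invK; exists (refine_map r z').
have half (C : tropical_curve R) (u : vertex C) (x : C) : good_curve C -> P C (vpoint u) x ->
    canonical_equiv [:: vpoint u; vpoint u; x; x].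
  case: (pointP x) => [w [? ? ?]|e t te gC]; first exact: canonical_equiv_double.
  move=> Px; apply: (pull _ _ (subdivision_refinement te)) => //.
  rewrite subdivision_mid refine_map_vpoint.
  by case: (good_subdivision te gC) => ? ? ?; exact: canonical_equiv_double.
case: (pointP p) => [u|e t te gC Px]; first exact: half.
apply: (pull _ _ (subdivision_refinement te)) => //; rewrite subdivision_mid => Pm.
by apply: half => //; exact: good_subdivision.
Qed.

(** * Ranks and gap sequences in genus three *)

Section Ranks.
Context {R : realType} {Gamma : tropical_curve R}.
Implicit Types (p q x z : Gamma) (s : seq Gamma) (D E : {freeg Gamma / int}).

Lemma rank_geP D k :
  rank_ge D k <-> forall ps, size ps = k -> exists s, principal (D - points ps - points s).
Proof.
split=> [rD ps psk|rD ps].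
  have [E /effectiveP[s ->] pE] := rD (Tuple (introT eqP psk)).
  by exists s.
have [s ps'] := rD ps (size_tuple ps).
by exists (points s); [exact: effective_points|exact: ps'].
Qed.

Lemma rank_ge_leq D k : rank_ge D k.+1 -> rank_ge D k.
Proof.
move=> /rank_geP rD; apply/rank_geP => ps psk.
have /card_gt0P[e _] := edge_inhabited Gamma; pose p : Gamma := vpoint (src e).
have [|s ps'] := rD (p :: ps); first by rewrite /= psk.
by exists (p :: s); apply: (principal_eq ps'); freeg_ring.
Qed.

Lemma rank_ge_subpoint D k : rank_ge D k.+1 <-> forall p, rank_ge (D - << p >>) k.
Proof.
split=> [/rank_geP rD q|rD].
  apply/rank_geP => ps psk; have [|s ps'] := rD (q :: ps); first by rewrite /= psk.
  by exists s; apply: (principal_eq ps'); freeg_ring.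
apply/rank_geP => -[//|q ps] [psk]; have /rank_geP/(_ ps psk)[s ps'] := rD q.
by exists s; apply: (principal_eq ps'); freeg_ring.
Qed.

Lemma rank_ge_addpoint D p k : rank_ge D k -> rank_ge (D + << p >>) k.
Proof.
move=> /rank_geP rD; apply/rank_geP => ps /rD[s ps'].
by exists (p :: s); apply: (principal_eq ps'); freeg_ring.
Qed.

Lemma rank_ge_mono D j k : (j <= k)%N -> rank_ge D k -> rank_ge D j.
Proof.
elim: k => [|k IH]; first by rewrite leqn0 => /eqP->.
by rewrite leq_eqVlt ltnS => /orP[/eqP->//|/IH H /rank_ge_leq].
Qed.

Lemma rank_eq D (k : nat) : rank_ge D k -> ~ rank_ge D k.+1 -> rank D = k%:Z.
Proof.
move=> rk nrk; rewrite /rank.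
have bd r : rank_set D r -> r <= k%:Z.
  case=> [->|[j -> rj]]; first by [].
  by rewrite lez_nat leqNgt; apply: contra_notN nrk => kj; exact: rank_ge_mono rj.
apply: xget_unique => [|r [rD ub]]; first by split; [right; exists k|exact: bd].
by apply/eqP; rewrite eq_le bd// ub//; right; exists k.
Qed.

Lemma rank_eqN1 D : ~ rank_ge D 0 -> rank D = -1.
Proof.
move=> nr0; rewrite /rank; apply: xget_unique => [|r [[//|[j _ rj]] _]].
  split; first by left.
  by move=> r [->//|[j _ rj]]; case: nr0; exact: rank_ge_mono rj.
by case: nr0; exact: rank_ge_mono rj.
Qed.

Lemma points_nseq m p : points (nseq m p) = << m%:Z *g p >>.
Proof.
elim: m => [|m IH]; first by rewrite points_nil; apply/esym/eqP; rewrite freegU_eq0.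
by rewrite /= points_cons IH freegUD.
Qed.

Lemma points_cat s1 s2 : points (s1 ++ s2) = points s1 + points s2.
Proof. exact: big_cat. Qed.

Lemma rank_ge_canonical m p k : rank_ge (canonical_divisor - << m%:Z *g p >>) k <->
  forall ps, size ps = k -> exists s, canonical_equiv (nseq m p ++ ps ++ s).
Proof.
rewrite -points_nseq; split=> [/rank_geP rD ps /rD[s ps']|rD].
  by exists s; apply: (principal_eq ps'); rewrite !points_cat; freeg_ring.
apply/rank_geP => ps /rD[s ps']; exists s; apply: (principal_eq ps').
by rewrite !points_cat; freeg_ring.
Qed.

Lemma exists_notin s : exists z, z \notin s.
Proof.
have /card_gt0P[e _] := edge_inhabited Gamma; have L0 := len_gt0 e.
pose f (n : nat) : Gamma := edge_path e (len e / n.+2%:R).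
have fI n : 0 < len e / n.+2%:R < len e.
  rewrite divr_gt0 ?ltr0n//= ltr_pdivrMr ?ltr0n// ltr_pMr//.
  by rewrite ltr1n.
have finj : injective f.
  move=> m n /(edge_path_inj (fI m) (fI n))[_ /(mulfI (lt0r_neq0 L0))/invr_inj/eqP].
  by rewrite eqr_nat; lia.
apply: contrapT => /forallNP all_in.
have : (size (map f (iota 0 (size s).+1)) <= size s)%N.
  apply: uniq_leq_size; first by rewrite map_inj_uniq ?iota_uniq.
  by move=> z _; have /negP := all_in z; rewrite negbK.
by rewrite size_map size_iota ltnn.
Qed.

Hypothesis Gamma_good : good_curve Gamma.

Lemma deg_canonical4 : deg (canonical_divisor (Gamma := Gamma)) = 4.
Proof.
by rewrite deg_canonical; case: Gamma_good => _ _ ->; rewrite addrAC subrr.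
Qed.

Lemma canonical_equiv_size s : canonical_equiv s -> size s = 4%N.
Proof. by move=> /principal_points_size; rewrite deg_canonical4 => -[]. Qed.

(** Through each [z] passes a pair equivalent to [D], and any such pair satisfies the assumption of
    [canonical_equiv_square]. *)
Lemma g12_square D : deg D = 2 -> rank_ge D 1 -> forall z, exists z',
  principal (D - points [:: z; z']) /\ canonical_equiv [:: z; z; z'; z'].
Proof.
move=> degD /rank_geP rD.
have pair z : exists z', principal (D - points [:: z; z']).
  have [s pD] := rD [:: z] erefl; have := deg_principal pD.
  rewrite !degB degD !deg_points /=; case: s pD => [|z' [|? ?]] pD /= ds;
    try by exfalso; move: ds; lia.
  by exists z'; apply: (principal_eq pD); freeg_ring.
move=> z; have [z' pz] := pair z; exists z'; split=> //.
apply: canonical_equiv_square => // x; have [x' px] := pair x; exists x'.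
by apply: (principal_eq (principalB px pz)); freeg_ring.
Qed.

(** The names follow plane quartics, where [K] is the class of a line section, and double covers of
    a line, whose branch points are doubled by the pencil of degree 2. *)
Definition flex p := exists q, canonical_equiv [:: p; p; p; q].
Definition hyperflex p := canonical_equiv [:: p; p; p; p].
Definition branch p := forall z, exists z', canonical_equiv [:: p; p; z; z'].

Lemma canonical_twice D : deg D = 2 -> rank_ge D 1 -> principal (D + D - canonical_divisor).
Proof.
move=> degD rD; have /card_gt0P[e _] := edge_inhabited Gamma.
have [w [pD KE]] := g12_square degD rD (vpoint (src e)).
by apply: (principal_eq (principalB (principalD pD pD) KE)); freeg_ring.
Qed.

Lemma hyperflex_flex p : hyperflex p -> flex p.
Proof. by exists p. Qed.

Lemma rank_ge_branch p : branch p -> rank_ge (canonical_divisor - points [:: p; p]) 1.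
Proof.
move=> Hp; apply/rank_geP => -[//|z [|//]] _; have [z' KE] := Hp z; exists [:: z'].
by apply: (principal_eq KE); freeg_ring.
Qed.

(** [K - 2p] has degree 2 and rank at least 1, so its double is equivalent to [K], which means
    [K ~ 4p]. *)
Lemma branch_hyperflex p : branch p -> hyperflex p.
Proof.
move=> /rank_ge_branch/canonical_twice; rewrite degB deg_canonical4 deg_points.
by move=> /(_ erefl) pD; apply: (principal_eq pD); freeg_ring.
Qed.

Section FinitelyManyHyperflexes.
Variable hs : seq Gamma.
Hypothesis hsP : forall p, hyperflex p -> p \in hs.

(** A curve has infinitely many points. The upper bounds on ranks below rest on this: a larger rank
    would make every point a hyperflex. *)
Lemma not_all_hyperflex : ~ forall p, hyperflex p.
Proof. by move=> all_h; have [z /negP] := exists_notin hs; case; exact/hsP. Qed.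

Let rank2_ge p : rank_ge (canonical_divisor - << 0%N%:Z *g p >>) 2.
Proof.
apply/rank_ge_canonical => -[|p1 [|p2 [|]]]// _.
by have [q1 [q2 KE]] := canonical_equiv2 p1 p2 Gamma_good; exists [:: q1; q2].
Qed.

Let rank1_ge p : rank_ge (canonical_divisor - << 1%N%:Z *g p >>) 1.
Proof.
apply/rank_ge_canonical => -[|p1 [|]]// _.
by have [q1 [q2 KE]] := canonical_equiv2 p p1 Gamma_good; exists [:: q1; q2].
Qed.

(** Otherwise [K - p - z] would have rank at least 1 for every [z], so [K ~ 2p + 2z], and [K ~ 4z]
    by doubling and subtracting the case [z = p]. *)
Let rank1_lt p : ~ rank_ge (canonical_divisor - << 1%N%:Z *g p >>) 2.
Proof.
move=> rp; apply: not_all_hyperflex.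
have pz z : canonical_equiv [:: p; p; z; z].
  move: rp => /rank_ge_subpoint/(_ z)/canonical_twice.
  rewrite !degB deg_canonical4 !degU => /(_ erefl) pD.
  by apply: (principal_eq pD); rewrite -(points1 p); freeg_ring.
move=> z; apply: (principal_eq (principalB (principalD (pz z) (pz z)) (pz p))).
by freeg_ring.
Qed.

Let rank2_lt p : ~ rank_ge (canonical_divisor - << 0%N%:Z *g p >>) 3.
Proof.
move=> /rank_ge_subpoint/(_ p) rp; apply: (@rank1_lt p); move: rp.
rewrite (_ : _ - _ - _ = canonical_divisor - << 1%N%:Z *g p >>)//.
by rewrite -addrA -opprD freegUD.
Qed.

Let rank_step m p k : ~ rank_ge (canonical_divisor - << m%:Z *g p >>) k ->
  ~ rank_ge (canonical_divisor - << m.+1%:Z *g p >>) k.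
Proof.
move=> nr rp; apply: nr; have := rank_ge_addpoint p rp.
by rewrite -!points_nseq /= (_ : _ + _ = canonical_divisor - points (nseq m p))//; freeg_ring.
Qed.

Let rank_flex p : rank_ge (canonical_divisor - << 3%N%:Z *g p >>) 0 <-> flex p.
Proof.
rewrite rank_ge_canonical; split=> [/(_ [::] erefl)[s KE]|[q KE] [|//] _]; last by exists [:: q].
have := canonical_equiv_size KE; case: s KE => [|q [|? ?]]// KE _.
by exists q.
Qed.

Let rank_hyperflex p : rank_ge (canonical_divisor - << 4%N%:Z *g p >>) 0 <-> hyperflex p.
Proof.
rewrite rank_ge_canonical; split=> [/(_ [::] erefl)[s KE]|KE [|//] _]; last by exists [::].
by have := canonical_equiv_size KE; case: s KE => [|? ?].
Qed.

Let rank_branch p : rank_ge (canonical_divisor - << 2%N%:Z *g p >>) 1 <-> branch p.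
Proof.
rewrite rank_ge_canonical; split=> [rp z|Hp [|z [|]]// _].
  have [s KE] := rp [:: z] erefl; have := canonical_equiv_size KE.
  by case: s KE => [|z' [|? ?]]// KE _; exists z'.
by have [z' KE] := Hp z; exists [:: z'].
Qed.

(** If [K ~ 3p + z] for every [z], then any two points are equivalent and [K ~ 4z]. *)
Let rank3_lt p : ~ rank_ge (canonical_divisor - << 3%N%:Z *g p >>) 1.
Proof.
rewrite rank_ge_canonical => rp; apply: not_all_hyperflex.
have pz z : canonical_equiv [:: p; p; p; z].
  by have [s KE] := rp [:: z] erefl; have := canonical_equiv_size KE; case: s KE.
move=> z; have pp := principalB (pz z) (pz p).
apply: (principal_eq (principalD (pz z) (principalD pp (principalD pp pp)))).
by freeg_ring.
Qed.

Let rank4_lt p : ~ rank_ge (canonical_divisor - << 4%N%:Z *g p >>) 1.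
Proof. exact/rank_step/rank3_lt. Qed.

Let rank5_lt m p : ~ rank_ge (canonical_divisor - << m.+1.+4%:Z *g p >>) 0.
Proof.
move=> /rank_ge_canonical/(_ [::] erefl)[s /canonical_equiv_size].
by rewrite size_cat size_nseq.
Qed.

Let crank (m : nat) p := rank (canonical_divisor - << m%:Z *g p >>).

Let crank0 p : crank 0 p = 2. Proof. exact: rank_eq. Qed.
Let crank1 p : crank 1 p = 1. Proof. exact: rank_eq. Qed.
Let crank5 m p : crank m.+1.+4 p = -1. Proof. exact: rank_eqN1. Qed.

Let crank2 p : crank 2 p = (`[< branch p >])%:Z.
Proof.
case: asboolP => [/rank_branch rp|/rank_branch nrp].
  by apply: rank_eq => //; exact: rank_step (@rank1_lt p).
apply: rank_eq => //; apply/rank_ge_canonical => -[|//] _.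
by have [q1 [q2 KE]] := canonical_equiv2 p p Gamma_good; exists [:: q1; q2].
Qed.

Let crank3 p : crank 3 p = if `[< flex p >] then 0 else -1.
Proof.
case: asboolP => [/rank_flex rp|/rank_flex nrp]; last exact: rank_eqN1.
exact: rank_eq.
Qed.

Let crank4 p : crank 4 p = if `[< hyperflex p >] then 0 else -1.
Proof.
case: asboolP => [/rank_hyperflex rp|/rank_hyperflex nrp]; last exact: rank_eqN1.
exact: rank_eq.
Qed.

Definition gaps p : seq nat :=
  if `[< branch p >] then [:: 1; 3; 5]%N else if `[< hyperflex p >] then [:: 1; 2; 5]%N
  else if `[< flex p >] then [:: 1; 2; 4]%N else [:: 1; 2; 3]%N.

(** The ranks of [K - mp] start with 2, 1 at [m = 0, 1]; at [m = 2] the rank is 1 or 0 by [branch],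
    at [m = 3] it is 0 or -1 by [flex], at [m = 4] by [hyperflex], and it is -1 from [m = 5] on.
    Gaps are the places where it drops. *)
Lemma is_gapE p m : is_gap p m <-> m \in gaps p.
Proof.
have bh : `[< branch p >] ==> `[< hyperflex p >].
  by apply/implyP => /asboolP/branch_hyperflex/asboolP.
have hf : `[< hyperflex p >] ==> `[< flex p >].
  by apply/implyP => /asboolP/hyperflex_flex/asboolP.
have gapE k : is_gap p k.+1 <-> crank k.+1 p < crank k p.
  by rewrite /is_gap intS addrAC subrr add0r; split=> [[]|].
case: m => [|m].
  rewrite /gaps; split=> [[]//|].
  by case: `[< branch p >] `[< hyperflex p >] `[< flex p >] => [] [] [].
rewrite gapE /gaps; move: bh hf.
case: m => [|[|[|[|[|m]]]]]; rewrite ?crank5 ?crank4 ?crank3 ?crank2 ?crank1 ?crank0;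
  by case: `[< branch p >]; case: `[< hyperflex p >]; case: `[< flex p >].
Qed.

Hypothesis genus3 : genus Gamma = 3%N.

Lemma gap_seqE p : gap_seq p = gaps p :> seq nat.
Proof.
have sz : size (gaps p) == genus Gamma by rewrite genus3 /gaps; do 3 case: ifP => _ //.
have so : sorted ltn (gaps p) by rewrite /gaps; do 3 case: ifP => _ //.
rewrite /gap_seq (@xget_unique _ _ _ (Tuple sz))//.
  by split=> // m; rewrite is_gapE.
move=> n [sn ng]; apply: val_inj => /=; apply: (irr_sorted_eq ltn_trans ltnn sn so) => m.
by apply/idP/idP => [/ng/is_gapE|/is_gapE/ng].
Qed.

Lemma weightE p : weight p = \sum_(0 <= i < 3) ((nth 0%N (gaps p) i)%:Z - i.+1%:Z).
Proof.
rewrite /weight -[in RHS]genus3 big_mkord; apply: eq_bigr => i _.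
by rewrite (tnth_nth 0%N) gap_seqE.
Qed.

Lemma tuple_leE (n n' : (genus Gamma).-tuple nat) :
  tuple_le n n' <-> forall i, (i < 3)%N -> (nth 0 n i <= nth 0 n' i)%N.
Proof.
rewrite -genus3; split=> [nn' i ig|nn' i].
  by have := nn' (Ordinal ig); rewrite !(tnth_nth 0%N).
by rewrite !(tnth_nth 0%N); exact: nn'.
Qed.

End FinitelyManyHyperflexes.
End Ranks.

(** * Maximal Weierstrass loci *)

(** The point is closed, and [U] makes it open in its component, which is connected. *)
Lemma connected_component_isolated (T : topologicalType) (A U : set T) (x : T) :
  closed [set x] -> open U -> U x -> A x -> (forall y, U y -> A y -> y = x) ->
  connected_component A x = [set x].
Proof.
move=> xC oU Ux Ax isol; have Bx := connected_component_refl Ax.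
apply/esym/(@component_connected _ A x).
- by exists x.
- exists U => //; apply/seteqP; split=> y /=; first by move=> ->.
  by move=> [/connected_component_sub Ay Uy]; exact: isol.
- exists [set x] => //; apply/seteqP; split=> y /=; first by move=> ->.
  by case.
Qed.

Section Loci.
Context {R : realType} {Gamma : tropical_curve R}.
Implicit Types (p q : Gamma).

Lemma edge_path_vpoint (e : edge Gamma) t v : edge_path e t = vpoint v <->
  (t <= 0 /\ src e = v) \/ (len e <= t /\ tgt e = v).
Proof.
split=> [|[[t0 <-]|[tL <-]]]; last by rewrite edge_path_ge.
  have [t0|t0] := leP t 0; first by rewrite edge_path_le0// => /vpoint_inj; left.
  have [tL|tL] := leP (len e) t; first by rewrite edge_path_ge// => /vpoint_inj; right.
  by move/(congr1 val); rewrite val_edge_path// t0.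
by rewrite edge_path_le0.
Qed.

Lemma closed_curve (A : set Gamma) :
  (forall e, closed (edge_path e @^-1` A)) -> closed A.
Proof.
move=> Ae; rewrite -[A]setCK; apply: open_closedC.
suff : point_open (~` A) by [].
by move=> e; rewrite preimage_setC; apply: closed_openC; exact: Ae.
Qed.

Lemma closed_point p : closed [set p].
Proof.
apply: closed_curve => e; case: (pointP p) => [v|e' t' te'].
  rewrite (_ : _ @^-1` _ = (if src e == v then [set t | t <= 0] else set0) `|`
      (if tgt e == v then [set t | len e <= t] else set0)).
    apply: closedU; case: ifP => _; try exact: closed0; [exact: closed_le|exact: closed_ge].
  apply/seteqP; split=> t /=.
    by move=> /edge_path_vpoint[[? ->]|[? ->]]; rewrite eqxx; [left|right].
  move=> tv; apply/edge_path_vpoint.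
  by case: tv; case: eqP => //; [left|right].
have [->|ee'] := eqVneq e e'; last first.
  rewrite (_ : _ @^-1` _ = set0); first exact: closed0.
  apply/seteqP; split=> t //=; rewrite -edge_path_clamp => /eqP.
  by rewrite edge_path_eq ?clampP// (negbTE ee').
rewrite (_ : _ @^-1` _ = [set t']); first exact: closed_eq.
apply/seteqP; split=> t /=; last by move=> ->.
rewrite -edge_path_clamp => /eqP; rewrite edge_path_eq ?clampP// eqxx /= => /eqP.
by rewrite /clamp; case/andP: te'; rewrite /Num.min /Num.max; do 2 case: ifP; lra.
Qed.

Lemma closed_seq (s : seq Gamma) : closed [set p | p \in s].
Proof.
elim: s => [|p s IH].
  by rewrite (_ : [set _ | _] = set0)//; [exact: closed0|apply/seteqP; split].
rewrite (_ : [set _ | _] = [set p] `|` [set q | q \in s]).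
  by apply: closedU => //; exact: closed_point.
apply/seteqP; split=> q /=; rewrite inE.
  by case/orP => [/eqP|]; [left|right].
by case=> [->|->]; rewrite ?eqxx ?orbT.
Qed.

Hypothesis Gamma_good : good_curve Gamma.
Hypothesis genus3 : genus Gamma = 3%N.
Hypothesis Gamma_connected : connected [set: Gamma].
(** [P2] lists the hyperflexes, with common gap sequence [g2], and [P1] the isolated flexes that are
    not hyperflexes. By [flex_P] any other flex is joined to a hyperflex through flexes. *)
Variables (P1 P2 : seq Gamma) (g2 : seq nat).
Hypothesis g2E : g2 = [:: 1; 2; 5]%N \/ g2 = [:: 1; 3; 5]%N.
Hypothesis P_nonempty : P1 ++ P2 != [::].
Hypothesis P2E : forall p, hyperflex p <-> p \in P2.
Hypothesis P2_gaps : forall p, p \in P2 -> gaps p = g2.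
Hypothesis P1_flex : forall p, p \in P1 -> [/\ flex p, ~ hyperflex p &
  exists U : set Gamma, [/\ open U, U p & forall x, U x -> flex x -> x = p]].
Hypothesis flex_P : forall p, flex p -> p \in P1 \/ exists2 q, q \in P2 &
  exists C : set Gamma, [/\ connected C, C p, C q & forall x, C x -> flex x].

Let hsP p : hyperflex p -> p \in P2. Proof. by move/P2E. Qed.

Let gap_seqE' p : gap_seq p = gaps p :> seq nat.
Proof. exact: gap_seqE hsP genus3 p. Qed.

Let gaps_hyperflex p : hyperflex p -> gaps p = g2.
Proof. by move/P2E/P2_gaps. Qed.

Let gaps_flex p : flex p -> ~ hyperflex p -> gaps p = [:: 1; 2; 4]%N.
Proof.
move=> fp hp; have bp : ~ branch p by move/(branch_hyperflex Gamma_good).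
by rewrite /gaps (asboolF bp) (asboolF hp) (asboolT fp).
Qed.

Let gaps_other p : ~ flex p -> gaps p = [:: 1; 2; 3]%N.
Proof.
move=> fp; have hp : ~ hyperflex p by move/hyperflex_flex.
have bp : ~ branch p by move/(branch_hyperflex Gamma_good).
by rewrite /gaps (asboolF bp) (asboolF hp) (asboolF fp).
Qed.

Let ge3 (a b : seq nat) := [&& nth 0 a 0 <= nth 0 b 0, nth 0 a 1 <= nth 0 b 1
  & nth 0 a 2 <= nth 0 b 2]%N.

Let weierstrass_geE (n : (genus Gamma).-tuple nat) p : weierstrass_ge n p <-> ge3 n (gaps p).
Proof.
rewrite /weierstrass_ge /= (tuple_leE genus3) gap_seqE'; split=> [H|/and3P[? ? ?]].
  by rewrite /ge3 !H.
by case=> [|[|[|]]].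
Qed.

(** So the loci that matter are the whole curve for 1,2,3, the set of flexes for 1,2,4 and the
    finite set of hyperflexes for [g2]. *)
Let ge124 p : ge3 [:: 1; 2; 4]%N (gaps p) <-> flex p.
Proof.
have [fp|fp] := pselect (flex p); last by rewrite gaps_other.
have [hp|hp] := pselect (hyperflex p); last by rewrite gaps_flex.
by rewrite gaps_hyperflex//; case: g2E => ->.
Qed.

Let geg2 p : ge3 g2 (gaps p) <-> hyperflex p.
Proof.
have [hp|hp] := pselect (hyperflex p).
  by rewrite gaps_hyperflex//; case: g2E => ->.
have [fp|fp] := pselect (flex p); first by rewrite gaps_flex//; case: g2E => ->.
by rewrite gaps_other//; case: g2E => ->.
Qed.

Let component_P1 (n : (genus Gamma).-tuple nat) x : n = [:: 1; 2; 4]%N :> seq nat ->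
  x \in P1 -> connected_component (weierstrass_ge n) x = [set x].
Proof.
move=> nE xP; have [fx hx [U [oU Ux isol]]] := P1_flex xP.
have flexE y : weierstrass_ge n y <-> flex y by rewrite weierstrass_geE nE ge124.
apply: (connected_component_isolated (U := U)) => //.
- exact: closed_point.
- exact/flexE.
- by move=> y Uy /flexE; exact: isol.
Qed.

Let component_P2 (n : (genus Gamma).-tuple nat) x : n = g2 :> seq nat ->
  x \in P2 -> connected_component (weierstrass_ge n) x = [set x].
Proof.
move=> nE xP.
have hE y : weierstrass_ge n y <-> y \in P2 by rewrite weierstrass_geE nE geg2 P2E.
apply: (@connected_component_isolated _ _ (~` [set p | p \in [seq q <- P2 | q != x]])).
- exact: closed_point.
- by apply: closed_openC; exact: closed_seq.
- by rewrite /= mem_filter eqxx.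
- exact/hE.
- move=> y /= /negP; rewrite mem_filter negb_and negbK => /orP[/eqP//|yP /hE].
  by rewrite (negbTE yP).
Qed.

Let tuple_of (a b c : nat) : {n : (genus Gamma).-tuple nat | n = [:: a; b; c] :> seq nat}.
Proof.
have sz : size [:: a; b; c] == genus Gamma by rewrite genus3.
by exists (Tuple sz).
Qed.

(** The gap sequence is constant on [B]. If a point of [B] is a flex joined to a hyperflex, its
    component contains that hyperflex, whose gaps differ. If it is no flex, the component is the
    whole connected curve, which contains points of [P1 ++ P2] with other gaps. *)
Lemma locus_is_point B : maximal_weierstrass_locus B ->
  exists2 p, p \in P1 ++ P2 & B = [set p].
Proof.
move=> [_ [n [_ [x nx ->] gapB]]].
have Bx : connected_component (weierstrass_ge n) x x by exact: connected_component_refl.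
have nE : n = gaps x :> seq nat by rewrite -gap_seqE' gapB.
have sub (C : set Gamma) y : connected C -> C x -> C y -> C `<=` weierstrass_ge n ->
    gaps y = n.
  move=> cC Cx Cy Cn; rewrite -gap_seqE' gapB//.
  exact: (connected_component_max Cx Cn cC).
have [hx|hx] := pselect (hyperflex x).
  exists x; first by rewrite mem_cat; apply/orP; right; exact/P2E.
  by apply: component_P2; [rewrite nE gaps_hyperflex|exact/P2E].
have [fx|fx] := pselect (flex x).
  have n124 : n = [:: 1; 2; 4]%N :> seq nat by rewrite nE gaps_flex.
  have [xP|[q qP [C [cC Cx Cq Cf]]]] := flex_P fx.
    by exists x; [rewrite mem_cat xP|exact: component_P1].
  have := sub C q cC Cx Cq; rewrite n124 P2_gaps// => H.
  have : g2 = [:: 1; 2; 4]%N by apply: H => y /Cf fy; apply/weierstrass_geE; rewrite n124 ge124.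
  by case: g2E => ->.
have n123 : n = [:: 1; 2; 3]%N :> seq nat by rewrite nE gaps_other.
have [y yP] : exists y, y \in P1 ++ P2.
  by case: (P1 ++ P2) P_nonempty => // y s _; exists y; rewrite mem_head.
have := sub setT y Gamma_connected I I; rewrite n123 => H.
have gy : gaps y = [:: 1; 2; 3]%N.
  apply: H => z _; apply/weierstrass_geE; rewrite n123.
  have [fz|fz] := pselect (flex z); last by rewrite gaps_other.
  have [hz|hz] := pselect (hyperflex z); last by rewrite gaps_flex.
  by rewrite gaps_hyperflex//; case: g2E => ->.
move: yP gy; rewrite mem_cat => /orP[/P1_flex[fy hy _]|/P2_gaps->].
  by rewrite gaps_flex.
by case: g2E => ->.
Qed.

Lemma point_is_locus p : p \in P1 ++ P2 -> maximal_weierstrass_locus [set p].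
Proof.
have [n nE] : {n : (genus Gamma).-tuple nat | n = gaps p :> seq nat}.
  by exists (gap_seq p); rewrite gap_seqE'.
move=> pP; split; first exact: closed_point.
exists n; split.
- split; first by rewrite nE /gaps; do 3 case: ifP => _ //.
  move=> k; have -> : (2 * genus Gamma).-1 = 5 by rewrite genus3.
  rewrite -[k \in n]/(k \in tval n) nE /gaps.
  by case: (asbool _); last case: (asbool _); last case: (asbool _); rewrite !inE => /or3P[] /eqP->.
- exists p; first by apply/weierstrass_geE; rewrite nE /ge3 !leqnn.
  move: pP; rewrite mem_cat => /orP[pP|pP].
    by apply/esym/component_P1 => //; have [? ? _] := P1_flex pP; rewrite nE gaps_flex.
  by apply/esym/component_P2 => //; rewrite nE P2_gaps.
- by move=> q ->; apply: val_inj; rewrite /= gap_seqE' nE.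
Qed.

End Loci.

(** * From lists of flexes to the theorem *)

Section Facts.
Context {R : realType}.
Implicit Type Gamma : tropical_curve R.

Definition isolated_flex Gamma (p : Gamma) := [/\ flex p, ~ hyperflex p &
  exists U : set Gamma, [/\ open U, U p & forall x, U x -> flex x -> x = p]].

Definition linked_flex Gamma (p q : Gamma) :=
  exists C : set Gamma, [/\ connected C, C p, C q & forall x, C x -> flex x].

(** The point [z] rules out divisors of degree 2 and rank at least 1, by [g12_square]. Points of
    [P1] have weight 1 and points of [P2] weight 2, so the equation on sizes gives the total weight
    and the bounds on the number of points. *)
Definition nonhyperelliptic_facts Gamma :=
  (exists z : Gamma, forall z', ~ canonical_equiv [:: z; z; z'; z']) /\
  exists P1 P2 : seq Gamma, [/\ uniq (P1 ++ P2), (size P1 + (size P2).*2 = 8)%N,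
    forall p, p \in P1 -> isolated_flex p,
    forall p, hyperflex p <-> p \in P2
  & forall p, flex p -> p \in P1 \/ exists2 q, q \in P2 & linked_flex p q].

Definition hyperelliptic_facts Gamma :=
  exists P : seq Gamma, [/\ uniq P, size P = 4%N,
    forall p, p \in P -> branch p,
    forall p, hyperflex p <-> p \in P
  & forall p, flex p -> exists2 q, q \in P & linked_flex p q].

Definition conclusion Gamma :=
  (forall B : set Gamma, maximal_weierstrass_locus B -> exists p, B = [set p]) /\
  exists ps : seq Gamma,
    [/\ uniq ps,
        forall p : Gamma, p \in ps <-> maximal_weierstrass_point p,
        hyperelliptic Gamma ->
          [/\ size ps = 4%N, \sum_(p <- ps) weight p = 12
            & 12 = (((genus Gamma)%:Z ^+ 3 - (genus Gamma)%:Z) %/ 2)%Z]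
      & ~ hyperelliptic Gamma ->
          [/\ (4 <= size ps <= 8)%N, \sum_(p <- ps) weight p = 8
            & 8 = (genus Gamma)%:Z ^+ 2 - 1]].

Section Conclusion.
Variable Gamma : tropical_curve R.
Hypothesis Gamma_good : good_curve Gamma.
Hypothesis genus3 : genus Gamma = 3%N.
Hypothesis Gamma_connected : connected [set: Gamma].

Lemma sum_const_seq (s : seq Gamma) (w : Gamma -> int) (k : int) :
  (forall p, p \in s -> w p = k) -> \sum_(p <- s) w p = k *+ size s.
Proof.
move=> wk; rewrite big_seq (eq_bigr (fun=> k)) => [|p /wk//].
by rewrite -big_seq big_const_seq count_predT iter_addr addr0.
Qed.

Lemma hyperelliptic_g12 : hyperelliptic Gamma ->
  exists2 D : {freeg Gamma / int}, deg D = 2 & rank_ge D 1.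
Proof.
move=> [_ [D [degD rD]]]; exists D => //; move: rD; rewrite /rank.
by case: xgetP => [r -> [[->//|[k -> rk]] _] [<-]|_].
Qed.

Lemma nonhyperelliptic_conclusion : nonhyperelliptic_facts Gamma -> conclusion Gamma.
Proof.
move=> [[z Nz] [P1 [P2 [uP sP P1P P2P flexP]]]].
have no_g12 (D : {freeg Gamma / int}) : deg D = 2 -> ~ rank_ge D 1.
  by move=> dD rD; have [z' [_ KE]] := g12_square Gamma_good dD rD z; exact: (Nz z').
have hsP p : hyperflex p -> p \in P2 by move/P2P.
have nb (p : Gamma) : ~ branch p.
  move=> /rank_ge_branch; apply: no_g12.
  by rewrite degB deg_canonical4// deg_points.
have g2 p : p \in P2 -> gaps p = [:: 1; 2; 5]%N.
  by move=> /P2P hp; rewrite /gaps (asboolF (nb p)) (asboolT hp).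
have nil : P1 ++ P2 != [::].
  by apply/eqP => /(congr1 size); rewrite size_cat /=; move: sP; lia.
have lP := locus_is_point Gamma_good genus3 Gamma_connected (or_introl erefl) nil P2P g2 P1P flexP.
have Pl := point_is_locus Gamma_good genus3 (or_introl erefl) P2P g2 P1P.
split; first by move=> B /lP[p _ ->]; exists p.
exists (P1 ++ P2); split=> //.
- move=> p; split=> [pP|[B /lP[q qP ->] ->//]].
  by exists [set p] => //; exact: Pl.
- by move=> /hyperelliptic_g12[D dD /no_g12].
move=> _; split; [|rewrite big_cat /=|by rewrite genus3].
  by rewrite size_cat; move: sP; lia.
rewrite (@sum_const_seq P1 _ 1) => [|p /P1P[fp hp _]]; last first.
  rewrite (weightE Gamma_good hsP genus3) /gaps (asboolF (nb p)) (asboolF hp) (asboolT fp).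
  by rewrite !big_nat_recl//= big_geq.
rewrite (@sum_const_seq P2 _ 2) => [|p pP]; last first.
  by rewrite (weightE Gamma_good hsP genus3) g2// !big_nat_recl//= big_geq.
by move: sP; lia.
Qed.

Lemma hyperelliptic_conclusion : hyperelliptic_facts Gamma -> conclusion Gamma.
Proof.
move=> [P [uP sP Pb P2P flexP]].
have hsP p : hyperflex p -> p \in P by move/P2P.
have g2 p : p \in P -> gaps p = [:: 1; 3; 5]%N.
  by move=> /Pb bp; rewrite /gaps (asboolT bp).
have nil : [::] ++ P != [::] by case: (P) sP.
have P1P (p : Gamma) : p \in [::] -> isolated_flex p by [].
have flexP' (p : Gamma) : flex p -> p \in [::] \/ exists2 q, q \in P & linked_flex p q.
  by move=> /flexP; right.
have lP := locus_is_point Gamma_good genus3 Gamma_connected (or_intror erefl) nil P2P g2 P1P flexP'.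
have Pl := point_is_locus Gamma_good genus3 (or_intror erefl) P2P g2 P1P.
have [p0 p0P] : exists p, p \in P.
  by case: (P) sP => // p s _; exists p; rewrite mem_head.
have hyp : hyperelliptic Gamma.
  split; first by rewrite genus3.
  exists (canonical_divisor - points [:: p0; p0]); split.
    by rewrite degB deg_canonical4// deg_points.
  apply: rank_eq; first exact/rank_ge_branch/Pb.
  (* Rank 2 would mean [K ~ 2 p0 + y + z] for all [y] and [z]; then [x ~ p0], so [K ~ 4x] for every
     [x]. *)
  move=> /rank_geP r2; apply: (not_all_hyperflex hsP) => x.
  have pp y z : canonical_equiv [:: p0; p0; y; z].
    have [s pD] := r2 [:: y; z] erefl.
    have KE : canonical_equiv ([:: p0; p0; y; z] ++ s).
      by apply: (principal_eq pD); rewrite points_cat; freeg_ring.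
    have := canonical_equiv_size Gamma_good KE.
    by case: s KE {pD} => //; rewrite cats0.
  have px := principalB (pp x x) (pp x p0).
  apply: (principal_eq (principalD (pp x x) (principalD px px))).
  by freeg_ring.
split; first by move=> B /lP[p _ ->]; exists p.
exists P; split=> //.
- move=> p; split=> [pP|[B /lP[q qP ->] ->//]].
  by exists [set p] => //; exact: Pl.
move=> _; split; [by []|rewrite (@sum_const_seq P _ 3) ?sP// => p pP|by rewrite genus3].
by rewrite (weightE Gamma_good hsP genus3) g2// !big_nat_recl//= big_geq.
Qed.
End Conclusion.

(** * Invariance of the facts under refinement *)

Section Transfer.
Variables (C F : tropical_curve R) (r : refinement C F).
Local Notation phi := (refine_map r).
Local Notation psi := (refine_inv r).

Lemma phi_inj : injective phi. Proof. exact: can_inj (refine_mapK r). Qed.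

Lemma flex_refine (p : C) : flex (phi p) <-> flex p.
Proof.
split=> [[q]|[q /(canonical_equiv_push r)]]; last by exists (phi q).
by rewrite -(refine_invK r q) => KE; exists (psi q); apply/(canonical_equiv_push r).
Qed.

Lemma hyperflex_refine (p : C) : hyperflex (phi p) <-> hyperflex p.
Proof. exact: iff_sym (canonical_equiv_push r [:: p; p; p; p]). Qed.

Lemma branch_refine (p : C) : branch p -> branch (phi p).
Proof.
move=> bp z; have [z' /(canonical_equiv_push r)/=] := bp (psi z).
by rewrite refine_invK; exists (phi z').
Qed.

Lemma isolated_refine (p : C) : isolated_flex p -> isolated_flex (phi p).
Proof.
move=> [fp hp [U [oU Up isol]]]; split; [exact/flex_refine|by move/hyperflex_refine|].
exists (psi @^-1` U); split.
- by have /continuousP := @refine_inv_continuous _ _ _ r; apply.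
- by rewrite /= refine_mapK.
- move=> x Ux fx; rewrite -(isol _ Ux) ?refine_invK//.
  by apply/flex_refine; rewrite refine_invK.
Qed.

Lemma linked_refine (p q : C) : linked_flex p q -> linked_flex (phi p) (phi q).
Proof.
move=> [A [cA Ap Aq fA]]; exists (phi @` A); split.
- apply: connected_continuous_connected => //.
  exact/continuous_subspaceT/refine_map_continuous.
- by exists p.
- by exists q.
- by move=> _ [x Ax <-]; apply/flex_refine/fA.
Qed.

Lemma mem_refine (p : F) (s : seq C) : (p \in map phi s) = (psi p \in s).
Proof.
by rewrite -{1}(refine_invK r p) mem_map//; exact: phi_inj.
Qed.

Lemma nonhyperelliptic_refine : nonhyperelliptic_facts C -> nonhyperelliptic_facts F.
Proof.
move=> [[z Nz] [P1 [P2 [uP sP P1P P2P flexP]]]]; split.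
  exists (phi z) => z' KE; apply: (Nz (psi z')); apply/(canonical_equiv_push r).
  by rewrite /= refine_invK.
exists (map phi P1), (map phi P2); split.
- by rewrite -map_cat map_inj_uniq//; exact: phi_inj.
- by rewrite !size_map.
- by move=> _ /mapP[p /P1P ? ->]; exact: isolated_refine.
- by move=> p; rewrite mem_refine -P2P -hyperflex_refine refine_invK.
- move=> p; rewrite -{1}(refine_invK r p) => /flex_refine/flexP[pP|[q qP pq]].
    by left; rewrite mem_refine.
  right; exists (phi q); first by rewrite map_f.
  by have := linked_refine pq; rewrite refine_invK.
Qed.

Lemma hyperelliptic_refine : hyperelliptic_facts C -> hyperelliptic_facts F.
Proof.
move=> [P [uP sP Pb P2P flexP]]; exists (map phi P); split.
- by rewrite map_inj_uniq//; exact: phi_inj.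
- by rewrite size_map.
- by move=> _ /mapP[p /Pb ? ->]; exact: branch_refine.
- by move=> p; rewrite mem_refine -P2P -hyperflex_refine refine_invK.
- move=> p; rewrite -{1}(refine_invK r p) => /flex_refine/flexP[q qP pq].
  exists (phi q); first by rewrite map_f.
  by have := linked_refine pq; rewrite refine_invK.
Qed.

Lemma no_cut_vertex_coarsen : (forall v : F, ~ cut_vertex v) -> forall v : C, ~ cut_vertex v.
Proof.
move=> Fcut v; apply; rewrite (_ : ~` [set v] = psi @` (~` [set phi v])).
  apply: connected_continuous_connected; first exact: contrapT (Fcut (phi v)).
  exact/continuous_subspaceT/refine_inv_continuous.
apply/seteqP; split=> [x xv|_ [y yv <-] /= yE]; last by apply: yv; rewrite -yE refine_invK.
by exists (phi x); rewrite ?refine_mapK//= => /phi_inj.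
Qed.

End Transfer.
End Facts.

(** * Euler's relation from the rank of the boundary map *)

Section Genus.
Context {R : realType} (Gamma : tropical_curve R).

(** A vector killed by the transposed boundary is a function on vertices with equal values at the
    ends of every edge; the graph being connected, it is constant. *)
Lemma rank_boundary_ker : \rank (kermx (boundary_mx Gamma)^T) = 1%N.
Proof.
have /card_gt0P[e0 _] := edge_inhabited Gamma.
set B := (boundary_mx Gamma)^T.
have BE (x : 'rV[R]_#|vertex Gamma|) e : (x *m B) 0 (enum_rank e) =
    x 0 (enum_rank (tgt e)) - x 0 (enum_rank (src e)).
  rewrite mxE; under eq_bigr do rewrite !mxE enum_rankK mulrBr.
  rewrite sumrB; congr (_ - _).
    rewrite (bigD1 (enum_rank (tgt e)))//= enum_rankK eqxx mulr1 big1 ?addr0// => j jt.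
    by rewrite -(inj_eq enum_rank_inj) enum_valK eq_sym (negbTE jt) mulr0.
  rewrite (bigD1 (enum_rank (src e)))//= enum_rankK eqxx mulr1 big1 ?addr0// => j jt.
  by rewrite -(inj_eq enum_rank_inj) enum_valK eq_sym (negbTE jt) mulr0.
apply/eqP; rewrite -(@eqmx_rank _ _ _ _ (const_mx 1 : 'rV_#|vertex Gamma|)).
  rewrite rank_rV (_ : _ != 0)//; apply/eqP => /matrixP/(_ 0 (enum_rank (src e0))).
  by rewrite !mxE => /eqP; rewrite oner_eq0.
apply/andP; split.
  apply/sub_kermxP/matrixP => i j; rewrite (ord1 i) -(enum_valK j) BE !mxE.
  by rewrite subrr.
apply/row_subP => i; set x := row i _.
have x0 : x *m B = 0 by apply/sub_kermxP; exact: row_sub.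
have xc u v : x 0 (enum_rank u) = x 0 (enum_rank v).
  have := graph_connected u v; rewrite -/(adjacent _ _) => /connectP[p].
  elim: p u => [|w p IH] u /=; first by move=> _ ->.
  move=> /andP[/adjacentP[e uw] wp vE]; rewrite -(IH w wp vE).
  have := BE x e; rewrite x0 mxE => /esym/eqP; rewrite subr_eq0 => /eqP H.
  by case: uw => -[<- <-].
rewrite (_ : x = x 0 (enum_rank (src e0)) *: const_mx 1); first exact: scalemx_sub.
apply/matrixP => a j; rewrite (ord1 a) !mxE mulr1 -[j]enum_valK.
by have := xc (enum_val j) (src e0); rewrite !mxE.
Qed.

(** The rank of the boundary is the number of edges minus 3 and also the number of vertices minus
    1. *)
Lemma euler_genus3 : genus Gamma = 3%N -> #|edge Gamma|%:Z = #|vertex Gamma|%:Z + 2.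
Proof.
rewrite /genus mxrank_ker -mxrank_tr => g.
have := mxrank_ker (boundary_mx Gamma)^T; rewrite rank_boundary_ker.
have := rank_leq_row (boundary_mx Gamma)^T; have := rank_leq_col (boundary_mx Gamma)^T.
move: g; set k := \rank _; move: k => k.
by move: #|edge Gamma| #|vertex Gamma| => a b; lia.
Qed.

End Genus.

(** * Consequences of the absence of cut vertices *)

Section NoCutVertex.
Context {R : realType} (Gamma : tropical_curve R).
Hypothesis no_cut : forall v : Gamma, ~ cut_vertex v.

(** [U] is both open and closed in the complement of [p], contains [x] and misses [y]. *)
Lemma cut_by (U : set Gamma) (p x y : Gamma) : open U -> closed (U `|` [set p]) ->
  ~ U p -> U x -> ~ U y -> y <> p -> cut_vertex p.
Proof.
move=> oU cU Up Ux Uy yp /(_ U) H; apply: Uy; rewrite H//.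
- by exists x.
- exists U => //; apply/seteqP; split=> z /=; last by case.
  by move=> Uz; split=> // zp; rewrite zp in Uz.
- exists (U `|` [set p]) => //; apply/seteqP; split=> z /=.
    by move=> Uz; split; [move=> zp; rewrite zp in Uz|left].
  by case=> zp [].
Qed.

(** The curve is the union of the complements of two points, which are connected and share a third
    point. *)
Lemma no_cut_connected : connected [set: Gamma].
Proof.
have [x _] := @exists_notin R Gamma [::].
have [y /negP xy] := exists_notin [:: x]; have [z /negP zxy] := exists_notin [:: x; y].
rewrite (_ : [set: Gamma] = ~` [set x] `|` ~` [set y]).
  apply: connectedU; [|exact: contrapT (@no_cut x)|exact: contrapT (@no_cut y)].
  by exists z; split=> /= zE; apply: zxy; rewrite !inE zE eqxx ?orbT.
apply/esym/seteqP; split=> // w _; have [wx|] := pselect (w = x); last by left.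
by right=> /= wy; apply: xy; rewrite inE -wx -wy.
Qed.

Definition arc (e : edge Gamma) (I : set R) : set Gamma := edge_path e @` I.

Lemma open_arc e (a b : R) : 0 <= a -> b <= len e -> open (arc e [set t | a < t < b]).
Proof.
move=> a0 bL; suff : point_open (arc e [set t | a < t < b]) by [].
move=> e'; have [->|ee'] := eqVneq e' e; last first.
  rewrite (_ : _ @^-1` _ = set0); first exact: open0.
  apply/seteqP; split=> t //= [t' /= tab] /esym; rewrite -edge_path_clamp => /eqP.
  by rewrite edge_path_eq ?clampP ?(negbTE ee')//; lra.
rewrite (_ : _ @^-1` _ = [set t | a < t] `&` [set t | t < b]).
  by apply: openI; [exact: open_gt|exact: open_lt].
apply/seteqP; split=> t /=; last by case=> at_ tb; exists t => //=; rewrite at_.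
move=> [t' /= tab] /esym; rewrite -edge_path_clamp => /eqP.
rewrite edge_path_eq ?clampP//; last lra.
rewrite eqxx /= => /eqP; rewrite /clamp => tE; move: tE tab.
by rewrite /Num.min /Num.max; do 2 case: ifP; lra.
Qed.

Hypothesis euler : #|edge Gamma|%:Z = #|vertex Gamma|%:Z + 2.

Lemma mid_itv (e : edge Gamma) : 0 < len e / 2 < len e.
Proof. by have := len_gt0 e; lra. Qed.

(** The vertex of a loop separates the interior of the loop from the middle of another edge, which
    exists because there are at least three edges. *)
Lemma no_cut_loopless : loopless (Gamma := Gamma).
Proof.
move=> e; apply/negP => /eqP st; have L0 := len_gt0 e.
have [e' ee'] : exists e', e' != e.
  apply: contrapT => /forallNP all_e; have : (#|edge Gamma| <= 1)%N.
    by apply/card_le1_eqP => x y _ _; have /negP/negPn/eqP-> := all_e x;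
      have /negP/negPn/eqP-> := all_e y.
  by move: euler; have : (0 < #|vertex Gamma|)%N by [apply/card_gt0P; exists (src e)]; lia.
apply: (@no_cut (vpoint (src e))).
have interior t f : 0 < t < len f -> arc e [set t | 0 < t < len e] (edge_path f t) -> f = e.
  by move=> tf [t' /= t'e] /edge_path_inj[].
apply: (@cut_by (arc e [set t | 0 < t < len e]) _ (edge_path e (len e / 2))
  (edge_path e' (len e' / 2))).
- exact: open_arc.
- apply: closed_curve => f; have [->|fe] := eqVneq f e.
    rewrite (_ : _ @^-1` _ = setT); first exact: closedT.
    apply/seteqP; split=> t //= _; have [te|te] := boolP (0 < t < len e).
      by left; exists t.
    right; apply/edge_path_vpoint; rewrite -st.
    by move: te; rewrite negb_and -!leNgt => /orP[]; [left|right].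
  rewrite (_ : _ @^-1` _ = edge_path f @^-1` [set vpoint (src e)]).
    have /continuousP := @edge_path_continuous _ _ f.
    move=> /(_ (~` [set vpoint (src e)])) H; rewrite -[X in closed X]setCK.
    by apply: open_closedC; apply: H; exact/closed_openC/closed_point.
  apply/seteqP; split=> t /=; last by right.
  case=> // -[t' /= t'e] /esym; rewrite -edge_path_clamp => /eqP.
  by rewrite edge_path_eq ?clampP// (negbTE fe).
- move=> [t /= te] /(congr1 val); rewrite val_edge_path//.
- by exists (len e / 2) => //=; exact: mid_itv.
- by move=> /(interior _ _ (mid_itv e'))/eqP; rewrite (negbTE ee').
- by move/(congr1 val); rewrite val_edge_path ?mid_itv.
Qed.

(** If only one dart leaves [v], the midpoint of its edge separates [v] from the other end. *)
Lemma no_cut_leafless : leafless (Gamma := Gamma).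
Proof.
move=> v; rewrite ltnNge; apply/negP => val1.
have [nu nuv] : exists nu, endpoint nu = v.
  have /card_gt0P[e0 _] := edge_inhabited Gamma.
  have := graph_connected v (src e0); rewrite -/(adjacent _ _) => /connectP[[|w p]] /=.
    by move=> _ e0v; exists (e0, false).
  move=> /andP[/adjacentP[e [[se te]|[se te]]] _ _]; first by exists (e, false).
  by exists (e, true).
have uniq_nu mu : endpoint mu = v -> mu = nu.
  move=> muv; have /card_le1_eqP := val1; apply; by rewrite mem_tangent ?muv ?nuv.
have lp := no_cut_loopless.
case: nu nuv uniq_nu => e b eb uniq_nu; have L0 := len_gt0 e.
have other_edge f t : f != e -> edge_path f t <> vpoint v.
  by move=> /eqP fe /edge_path_vpoint[[_ sf]|[_ tf]]; apply: fe;
    [have := uniq_nu (f, false) sf|have := uniq_nu (f, true) tf] => -[].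
have ov : endpoint (e, ~~ b) != v.
  have := lp e; move: eb; rewrite /endpoint; case: b {uniq_nu} => /= <-//.
  by rewrite eq_sym.
(* The parameters on the side of [v], with the midpoint included when [c] holds. The half line is
   unbounded because [edge_path] stays at [v] beyond the end. *)
pose A (c : bool) := if b then [set t : R | if c then len e / 2 <= t else len e / 2 < t]
   else [set t : R | if c then t <= len e / 2 else t < len e / 2].
have A_end t c : (t <= 0 \/ len e <= t) -> A c t <-> edge_path e t = vpoint v.
  move=> te; rewrite edge_path_vpoint /A.
  move: eb ov; rewrite /endpoint; case: b {uniq_nu A} => /= -> /eqP ne.
    by case: c => /=; split=> [At|[[_ /ne]//|[tL _]]]; [right; split=> //; case: te => // ?|
      |right; split=> //; case: te => // ?|]; lra.
  by case: c => /=; split=> [At|[[tL _]|[_ /ne]//]]; [left; split=> //; case: te => // ?|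
    |left; split=> //; case: te => // ?|]; lra.
have preA c f : edge_path f @^-1` (arc e (A c)) = if f == e then A c else set0.
  case: eqP => [->|/eqP fe]; apply/seteqP; split=> t //=.
  - move=> [t' At'] tE; have [te|te] := boolP (0 < t < len e).
      have [t'e|t'e] := boolP (0 < t' < len e).
        by have [_ <-] := edge_path_inj t'e te tE.
      move: t'e; rewrite negb_and -!leNgt => /orP/(A_end _ c)/proj1/(_ At').
      by rewrite tE => /(congr1 val); rewrite val_edge_path.
    move: (te); rewrite negb_and -!leNgt => /orP/(A_end _ c) H; apply/H.
    have [t'e|t'e] := boolP (0 < t' < len e).
      move: te; rewrite negb_and -!leNgt -tE => /orP[?|?].
        by move: tE => /esym/(congr1 val); rewrite edge_path_le0// (val_edge_path t'e).
      by move: tE => /esym/(congr1 val); rewrite edge_path_ge// (val_edge_path t'e).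
    by move: t'e; rewrite negb_and -!leNgt -tE => /orP/(A_end _ c)/proj1/(_ At').
  - by exists t.
  - move=> [t' At']; have [t'e|t'e] := boolP (0 < t' < len e).
      move=> /esym; rewrite -edge_path_clamp => /eqP.
      by rewrite edge_path_eq ?clampP// (negbTE fe).
    move: t'e; rewrite negb_and -!leNgt => /orP/(A_end _ c)/proj1/(_ At') ->.
    by move=> /esym; exact: other_edge.
have halfL : (b = false /\ A false = [set t | t < len e / 2] /\ A true = [set t | t <= len e / 2])
  \/ (b = true /\ A false = [set t | len e / 2 < t] /\ A true = [set t | len e / 2 <= t]).
  by rewrite /A; case: (b); [right|left].
apply: (@no_cut (edge_path e (len e / 2))).
have mem t c : arc e (A c) (edge_path e t) <-> A c t.
  by have := preA c e; rewrite eqxx => /seteqP[H1 H2]; split=> [/H1|/H2].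
apply: (@cut_by (arc e (A false)) _ (vpoint v) (vpoint (endpoint (e, ~~ b)))).
- suff : point_open (arc e (A false)) by [].
  move=> f; rewrite preA; case: ifP => _; last exact: open0.
  by case: halfL => -[_ [-> _]]; [exact: open_lt|exact: open_gt].
- rewrite (_ : _ `|` _ = arc e (A true)).
    apply: closed_curve => f; rewrite preA; case: ifP => _; last exact: closed0.
    by case: halfL => -[_ [_ ->]]; [exact: closed_le|exact: closed_ge].
  apply/seteqP; split=> [_ [[t At <-]|->]|_ [t At <-]].
  - by exists t => //; move: At; case: halfL => -[_ [-> ->]] /=; exact: ltW.
  - by apply/mem; case: halfL => -[_ [_ ->]] /=.
  - move: At; case: halfL => -[_ [-> ->]] /=; rewrite le_eqVlt => /orP[/eqP tE|tl].
    + by right; rewrite tE.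
    + by left; exists t.
    + by right; rewrite tE.
    + by left; exists t.
- by move/mem; case: halfL => -[_ [-> _]] /=; rewrite ltxx.
- have -> : vpoint v = edge_path e (if b then len e else 0) by rewrite edge_path_end eb.
  by apply/mem; case: halfL => -[-> [-> _]] /=; lra.
- have -> : vpoint (endpoint (e, ~~ b)) = edge_path e (if b then 0 else len e).
    by rewrite edge_path_end'.
  by move/mem; case: halfL => -[-> [-> _]] /=; lra.
- by move/(congr1 val); rewrite val_edge_path ?mid_itv.
Qed.

Lemma no_cut_good : good_curve Gamma.
Proof. by split; [exact: no_cut_loopless|exact: no_cut_leafless|]. Qed.

End NoCutVertex.

(** * Erasing a vertex of valence two *)

Section Smoothing.
Context {R : realType} (F : tropical_curve R).
Hypothesis F_loopless : loopless (Gamma := F).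
Variables (m : vertex F) (nu1 nu2 : edge F * bool).
Hypothesis tangent_m : tangent (vpoint m) = [set nu1; nu2]%SET.
Hypothesis nu12 : nu1 != nu2.

Let end1 : endpoint nu1 = m.
Proof. by apply/eqP; rewrite -mem_tangent tangent_m !inE eqxx. Qed.

Let end2 : endpoint nu2 = m.
Proof. by apply/eqP; rewrite -mem_tangent tangent_m !inE eqxx orbT. Qed.

Let at_m nu : endpoint nu = m -> nu = nu1 \/ nu = nu2.
Proof. by move/eqP; rewrite -mem_tangent tangent_m !inE => /orP[]/eqP; [left|right]. Qed.

Let endpoint_other (nu : edge F * bool) : endpoint nu != other nu.
Proof. by case: nu => e []; rewrite /other /endpoint //= eq_sym. Qed.

Let e12 : nu1.1 != nu2.1.
Proof.
apply/eqP => ee; have := endpoint_other nu1; rewrite /other.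
have -> : (nu1.1, ~~ nu1.2) = nu2; last by rewrite end1 end2 eqxx.
move: nu12; case: (nu1) (nu2) ee => [e b] [e' b'] /= ->.
by rewrite xpair_eqE eqxx /=; case: b; case: b'.
Qed.

Let V : finType := {w : vertex F | w != m}.
Let E : finType := {e : edge F | e != nu2.1}.

(** The edge of [nu1] is reused for the merged edge, running from the far end of [nu1] to the far
    end of [nu2]; the edge of [nu2] disappears. *)
Let s_raw (e : edge F) : vertex F := if e == nu1.1 then other nu1 else src e.
Let g_raw (e : edge F) : vertex F := if e == nu1.1 then other nu2 else tgt e.

Let s_raw_m (e : E) : s_raw (val e) != m.
Proof.
rewrite /s_raw; case: (val e =P nu1.1) => [_|/eqP en1]; first by rewrite -end1 eq_sym endpoint_other.
apply/eqP => se; case: (at_m (nu := (val e, false)) se) => eE.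
  by move: en1; rewrite -(congr1 fst eE) eqxx.
by have /eqP := valP e; case; exact: (congr1 fst eE).
Qed.

Let g_raw_m (e : E) : g_raw (val e) != m.
Proof.
rewrite /g_raw; case: (val e =P nu1.1) => [_|/eqP en1]; first by rewrite -end2 eq_sym endpoint_other.
apply/eqP => te; case: (at_m (nu := (val e, true)) te) => eE.
  by move: en1; rewrite -(congr1 fst eE) eqxx.
by have /eqP := valP e; case; exact: (congr1 fst eE).
Qed.

Let s (e : E) : V := Sub (s_raw (val e)) (s_raw_m e).
Let g (e : E) : V := Sub (g_raw (val e)) (g_raw_m e).
Let l (e : E) : R := if val e == nu1.1 then len nu1.1 + len nu2.1 else len (val e).

Let l_gt0 e : 0 < l e.
Proof. by rewrite /l; case: ifP => _; rewrite ?addr_gt0 ?len_gt0. Qed.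

Let E1 : E := Sub nu1.1 e12.

Let E_inhabited : (0 < #|{: E}|)%N.
Proof. by apply/card_gt0P; exists E1. Qed.

Let other2_m : other nu2 != m. Proof. by rewrite -end2 eq_sym endpoint_other. Qed.

(** Collapses [m] onto the far end of [nu2], which maps paths in [F] to paths in the smoothing. *)
Let rho (w : vertex F) : V := insubd (Sub (other nu2) other2_m : V) w.

Let rho_m : rho m = Sub (other nu2) other2_m.
Proof. by apply: val_inj; rewrite val_insubd eqxx. Qed.

Let val_rho w : w != m -> val (rho w) = w.
Proof. by move=> wm; rewrite val_insubd wm. Qed.

Let connected_all u v : connect (adjacent s g) u v.
Proof.
suff conn x y : connect (adjacent (@src R F) (@tgt R F)) x y ->
    connect (adjacent s g) (rho x) (rho y).
  have rhoV (w : V) : rho (val w) = w by apply: val_inj; rewrite val_rho// (valP w).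
  by rewrite -(rhoV u) -(rhoV v); exact/conn/graph_connected.
have sym := sym_connect_sym (adjacent_sym s g).
have conn_e e : connect (adjacent s g) (rho (src e)) (rho (tgt e)).
  have ends b : connect (adjacent s g) (rho (endpoint (e, b))) (rho (endpoint (e, ~~ b))) ->
      connect (adjacent s g) (rho (src e)) (rho (tgt e)).
    by case: b; rewrite /endpoint //= sym.
  have [ee|e2] := eqVneq e nu2.1.
    apply: (ends nu2.2); rewrite ee -surjective_pairing end2 rho_m.
    rewrite (_ : Sub _ _ = rho (other nu2)); first exact: connect0.
    by apply: val_inj; rewrite val_rho.
  have [ee|e1] := eqVneq e nu1.1.
    apply: (ends nu1.2); rewrite ee -surjective_pairing end1 rho_m.
    rewrite (_ : Sub _ _ = g E1).
      rewrite (_ : rho _ = s E1); first exact: connect_endsV.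
      apply: val_inj; rewrite /= /s_raw eqxx val_rho//.
      by rewrite -end1 eq_sym endpoint_other.
    by apply: val_inj; rewrite /= /g_raw eqxx.
  pose e' : E := Sub e e2.
  rewrite (_ : rho (src e) = s e'); first rewrite (_ : rho (tgt e) = g e').
  - exact: connect_ends.
  - have := g_raw_m e'; rewrite /g_raw /= (negbTE e1) => tm.
    by apply: val_inj; rewrite val_rho//= /g_raw (negbTE e1).
  - have := s_raw_m e'; rewrite /s_raw /= (negbTE e1) => tm.
    by apply: val_inj; rewrite val_rho//= /s_raw (negbTE e1).
move=> /connectP[p]; elim: p x => [|w p IH] x /=; first by move=> _ ->; exact: connect0.
move=> /andP[/adjacentP[e xw] wp yE]; apply: connect_trans (IH w wp yE).
by case: xw => -[<- <-] //; rewrite sym.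
Qed.

Definition smoothing : tropical_curve R :=
  @TropicalCurve R V E s g l l_gt0 E_inhabited connected_all.

Definition smoothing_refinement : refinement smoothing F.
Proof.
apply: (@Refinement R smoothing F (val : V -> vertex F) rho m (val : E -> edge F)
  (insubd E1) E1 nu2.1 (~~ nu1.2) nu2.2).
- by move=> u; apply: val_inj; rewrite val_rho// (valP u).
- by move=> u; exact: (valP u).
- exact: val_rho.
- by move=> e; apply: val_inj; rewrite val_insubd (valP e).
- by move=> e; exact: (valP e).
- by move=> e e2; rewrite val_insubd e2.
- by move=> e; rewrite -(inj_eq val_inj) /= /s_raw => /negbTE->.
- by move=> e; rewrite -(inj_eq val_inj) /= /g_raw => /negbTE->.
- by move=> e; rewrite -(inj_eq val_inj) /= /l => /negbTE->.
- by rewrite /= /s_raw eqxx.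
- by rewrite /= negbK -surjective_pairing.
- by rewrite -surjective_pairing.
- by rewrite /= /g_raw eqxx.
- by rewrite /= /l eqxx.
Defined.

End Smoothing.

Section Cards.
Context {R : realType} {C F : tropical_curve R} (r : refinement C F).

Lemma card_vertex_refine : #|vertex F| = #|vertex C|.+1.
Proof.
rewrite -cardsT (_ : [set: vertex F]%SET = mid r |: [set vmap r u | u in [set: vertex C]])%SET.
  rewrite cardsU1 card_imset ?cardsT; last exact: vmap_inj.
  by case: imsetP => // -[u _ mu]; have := vmap_mid r u; rewrite mu eqxx.
apply/esym/setP => w; rewrite !inE; apply/orP.
by elim/(vertexF_cases (r := r)): w => [|u]; [left|right; apply/imset_f; rewrite inE].
Qed.

Lemma card_edge_refine : #|edge F| = #|edge C|.+1.
Proof.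
rewrite -cardsT (_ : [set: edge F]%SET = new_edge r |: [set emap r u | u in [set: edge C]])%SET.
  rewrite cardsU1 card_imset ?cardsT; last exact: emap_inj.
  by case: imsetP => // -[u _ mu]; have := emap_new r u; rewrite mu eqxx.
apply/esym/setP => w; rewrite !inE; apply/orP.
elim/(edgeF_cases (r := r)): w => [||e _]; first by left.
  by right; apply/imset_f; rewrite inE.
by right; apply/imset_f; rewrite inE.
Qed.

End Cards.

Definition classified (R : realType) (Gamma : tropical_curve R) :=
  nonhyperelliptic_facts Gamma \/ hyperelliptic_facts Gamma.

(** Induction on the number of vertices. Without cut vertices all valences are at least 2, so a
    vertex violating the bound has valence 2; erasing it gives a homeomorphic curve, from which the
    facts transfer back. *)
Lemma smoothing_induction (R : realType) :
  (forall Gamma : tropical_curve R, good_curve Gamma ->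
     (forall v : vertex Gamma, 3 <= valence (vpoint v))%N -> classified Gamma) ->
  forall Gamma : tropical_curve R, (forall v : Gamma, ~ cut_vertex v) ->
    #|edge Gamma|%:Z = #|vertex Gamma|%:Z + 2 -> classified Gamma.
Proof.
move=> base Gamma; have [n] := ubnP #|vertex Gamma|.
elim: n Gamma => // n IH Gamma; rewrite ltnS => Gn no_cut euler.
have good := no_cut_good no_cut euler; have [lp lf _] := good.
have [all3|] := boolP [forall v : vertex Gamma, 3 <= valence (vpoint v)]%N.
  by apply: base => // v; exact: (forallP all3).
rewrite negb_forall => /existsP[m]; rewrite -leqNgt leq_eqVlt ltnNge lf orbF.
move=> /cards2P[nu1 [nu2 [nu12 tm]]].
have r := smoothing_refinement lp tm nu12.
have [|||H|H] := IH (smoothing lp tm nu12).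
- by have := card_vertex_refine r; lia.
- exact: no_cut_vertex_coarsen r no_cut.
- by have := card_vertex_refine r; have := card_edge_refine r; lia.
- by left; exact: (nonhyperelliptic_refine r H).
- by right; exact: (hyperelliptic_refine r H).
Qed.

(** * Flexes on a tripod *)

Section Star.
Context {R : realType}.
Implicit Types (l : 'I_3 -> R) (j : 'I_3) (x y h : R).

(* Four chips on a tripod with legs l come from the three ends of the legs    *)
(* moving inwards at unit speed iff the legs, shortened by the distances of   *)
(* their chips to the center, all have the same length h.                     *)
Definition star_flex l j x := exists j' y h, [/\ 0 <= y, 0 < h &
  forall i, l i = h + 3 * x * (i == j)%:R + y * (i == j')%:R].

Definition star_hyperflex l j x := exists2 h, 0 < h &
  forall i, l i = h + 4 * x * (i == j)%:R.

(** [Q1] holds the isolated flexes and [Q2] the hyperflexes, of total weight 2. A point is a leg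
    with a distance to the center, so the center has three names; the clauses with distance 0 deal
    with that. *)
Record star_points l (Q1 Q2 : seq ('I_3 * R)) : Prop := StarPoints {
  star_uniq : uniq (Q1 ++ Q2);
  star_size : (size Q1 + (size Q2).*2 = 2)%N;
  star_itv : forall q, q \in Q1 ++ Q2 -> 0 <= q.2 /\ 3 * q.2 < l q.1;
  star_center : forall q q', q \in Q1 ++ Q2 -> q' \in Q1 ++ Q2 -> q.2 = 0 -> q'.2 = 0 -> q = q';
  star_isolated : forall q, q \in Q1 -> [/\ 0 < q.2, star_flex l q.1 q.2 &
    forall x, 0 <= x -> star_flex l q.1 x -> x = q.2];
  star_not_hyperflex : forall q, q \in Q1 -> forall j x, 0 <= x -> ~ star_hyperflex l j x;
  star_hyperflexE : forall q, q \in Q2 -> star_hyperflex l q.1 q.2;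
  star_hyperflex_mem : forall j x, 0 <= x -> star_hyperflex l j x ->
    exists2 q, q \in Q2 & (q = (j, x)) \/ (q.2 = 0 /\ x = 0);
  star_linked : forall j x, 0 <= x -> star_flex l j x -> (j, x) \in Q1 \/
    exists2 q, q \in Q2 & (j = q.1 \/ x = 0) /\
      forall t, Num.min x q.2 <= t <= Num.max x q.2 -> star_flex l q.1 t
}.

Lemma star_flex_itv l j x : 0 <= x -> star_flex l j x -> 3 * x < l j.
Proof.
move=> x0 [j' [y [h [y0 h0 /(_ j)]]]]; rewrite eqxx mulr1 => ->.
by case: (j == j'); rewrite ?mulr1 ?mulr0; lra.
Qed.

Lemma star_hyperflex_itv l j x : 0 <= x -> star_hyperflex l j x -> 3 * x < l j.
Proof. by move=> x0 [h h0 /(_ j)]; rewrite eqxx mulr1 => ->; lra. Qed.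

(** The common length [h] is attained on a leg without chips at positive distance, so it is the
    least leg length, and the chips must absorb the excess of the other legs over it. The three
    cases are the number of legs with positive excess. *)
Lemma star_pointsP l : (forall j, 0 < l j) -> exists Q1 Q2, star_points l Q1 Q2.
Proof.
move=> l0; have [j0 _ jmin] := @arg_minP _ _ _ (ord0 : 'I_3) xpredT l isT.
have {}jmin j : l j0 <= l j by exact: jmin.
have [a [b [a0 b0 ab jab]]] : exists a b, [/\ a != j0, b != j0, a != b &
    forall j, [\/ j = j0, j = a | j = b]].
  pose i1 : 'I_3 := inord 1; pose i2 : 'I_3 := inord 2.
  have all3 (i : 'I_3) : [\/ i = ord0, i = i1 | i = i2].
    case: i => -[|[|[|//]]] i3; [constructor 1|constructor 2|constructor 3];
      by apply: val_inj; rewrite /= ?inordK.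
  have n1 : i1 != ord0 by rewrite -val_eqE /= inordK.
  have n2 : i2 != ord0 by rewrite -val_eqE /= inordK.
  have n12 : i1 != i2 by rewrite -val_eqE /= !inordK.
  have [n1' n2' n12'] : [/\ ord0 != i1, ord0 != i2 & i2 != i1] by split; rewrite eq_sym.
  case: (all3 j0) => ->.
  - by exists i1, i2.
  - exists ord0, i2; split=> //.
    by move=> j; case: (all3 j); [constructor 2|constructor 1|constructor 3].
  - exists ord0, i1; split=> //.
    by move=> j; case: (all3 j); [constructor 2|constructor 3|constructor 1].
have m0 := l0 j0; have ma := jmin a; have mb := jmin b.
wlog lba : a b a0 b0 ab jab ma mb / l b <= l a.
  move=> W; have [|/ltW lab] := leP (l b) (l a); first exact: (W a b).
  apply: (W b a) => //; first by rewrite eq_sym.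
  by move=> j; case: (jab j); [constructor 1|constructor 3|constructor 2].
have [a0' b0' ba] : [/\ j0 != a, j0 != b & b != a] by split; rewrite eq_sym.
have eqs := (eqxx j0, eqxx a, eqxx b, negbTE a0, negbTE b0, negbTE ab,
  negbTE a0', negbTE b0', negbTE ba, mulr1n, mulr0n, mulr1, mulr0, addr0).
have flexE j x : star_flex l j x -> exists j' y h, [/\ 0 <= y, 0 < h,
    l j0 = h + 3 * x * (j0 == j)%:R + y * (j0 == j')%:R,
    l a = h + 3 * x * (a == j)%:R + y * (a == j')%:R
  & l b = h + 3 * x * (b == j)%:R + y * (b == j')%:R].
  by move=> [j' [y [h [y_0 h0 H]]]]; exists j', y, h; split.
have hflexE j x : star_hyperflex l j x -> exists h, [/\ 0 < h,
    l j0 = h + 4 * x * (j0 == j)%:R, l a = h + 4 * x * (a == j)%:R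
  & l b = h + 4 * x * (b == j)%:R].
  by move=> [h h0 H]; exists h; split.
have mkflex j j' x y h : 0 <= y -> 0 < h ->
    l j0 = h + 3 * x * (j0 == j)%:R + y * (j0 == j')%:R ->
    l a = h + 3 * x * (a == j)%:R + y * (a == j')%:R ->
    l b = h + 3 * x * (b == j)%:R + y * (b == j')%:R -> star_flex l j x.
  by move=> y_0 h0 H1 H2 H3; exists j', y, h; split=> // i; case: (jab i) => ->.
have mkhflex j x h : 0 < h -> l j0 = h + 4 * x * (j0 == j)%:R ->
    l a = h + 4 * x * (a == j)%:R -> l b = h + 4 * x * (b == j)%:R -> star_hyperflex l j x.
  by move=> h0 H1 H2 H3; exists h => // i; case: (jab i) => ->.
(* Two longer legs: the triple chip absorbs the excess of one and the fourth chip that of the other,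
   giving two isolated flexes at a third of the excess. *)
have [lbm|lbm] := eqVneq (l b) (l j0); last first.
  have lb : l j0 < l b by rewrite lt_neqAle eq_sym lbm.
  pose xa := (l a - l j0) / 3; pose xb := (l b - l j0) / 3.
  have fP j x : 0 <= x -> star_flex l j x -> (j, x) = (a, xa) \/ (j, x) = (b, xb).
    move=> x0 /flexE[j' [y [h [y_0 h0]]]].
    case: (jab j) => ->; case: (jab j') => ->; rewrite !eqs /= ?eqs => *;
      try (by exfalso; lra); [left|right]; congr pair; rewrite /xa /xb; lra.
  have nh j x : 0 <= x -> ~ star_hyperflex l j x.
    by move=> x0 /hflexE[h [h0]]; case: (jab j) => ->; rewrite !eqs /= ?eqs => *; lra.
  exists [:: (a, xa); (b, xb)], [::]; split=> //.
  - by rewrite /= inE xpair_eqE (negbTE ab).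
  - by move=> q; rewrite !inE => /orP[]/eqP-> /=; rewrite /xa /xb; split; lra.
  - by move=> q q'; rewrite !inE => /orP[]/eqP-> _ /= + _; rewrite /xa /xb => ?; exfalso; lra.
  - move=> q; rewrite !inE => /orP[]/eqP-> /=; split.
    + by rewrite /xa; lra.
    + by apply: (@mkflex a b xa (l b - l j0) (l j0)); rewrite ?eqs /= ?eqs /xa //; lra.
    + move=> x x0 /(fP _ _ x0)[E|E]; first exact: (congr1 snd E).
      by have /eqP := congr1 fst E; rewrite /= (negbTE ab).
    + by rewrite /xb; lra.
    + by apply: (@mkflex b a xb (l a - l j0) (l j0)); rewrite ?eqs /= ?eqs /xb //; lra.
    + move=> x x0 /(fP _ _ x0)[E|E]; last exact: (congr1 snd E).
      by have /eqP := congr1 fst E; rewrite /= (negbTE ba).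
  - by move=> j x x0 /(nh _ _ x0).
  - by move=> j x x0 /(fP _ _ x0) jx; left; rewrite !inE; case: jx => ->; rewrite eqxx ?orbT.
(* One longer leg: all chips share its excess, so the flexes form the segment from the center to a
   third of the excess, with the hyperflex at a quarter. *)
have [lam|lam] := eqVneq (l a) (l j0); last first.
  have la : l j0 < l a by rewrite lt_neqAle eq_sym lam.
  pose x4 := (l a - l j0) / 4.
  have seg t : 0 <= t -> 3 * t <= l a - l j0 -> star_flex l a t.
    by move=> t0 tl; apply: (@mkflex a a t (l a - l j0 - 3 * t) (l j0)); rewrite ?eqs /= ?eqs //; lra.
  have hf : star_hyperflex l a x4 by apply: (@mkhflex a x4 (l j0)); rewrite ?eqs /= ?eqs /x4 //; lra.
  exists [::], [:: (a, x4)]; split=> //.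
  - by move=> q; rewrite !inE => /eqP-> /=; rewrite /x4; split; lra.
  - by move=> q q'; rewrite !inE => /eqP-> /eqP->.
  - by move=> q; rewrite !inE => /eqP->.
  - move=> j x x0 /hflexE[h [h0 H1 H2 H3]]; exists (a, x4); rewrite ?mem_head//.
    move: H1 H2 H3; case: (jab j) => ->; rewrite !eqs /= ?eqs => H1 H2 H3; try (by exfalso; lra).
    by left; congr pair; rewrite /x4; lra.
  - move=> j x x0 /flexE[j' [y [h [y_0 h0 H1 H2 H3]]]]; right; exists (a, x4); rewrite ?mem_head//=.
    have [jx xl] : (j = a \/ x = 0) /\ 3 * x <= l a - l j0.
      move: H1 H2 H3; case: (jab j) => ->; case: (jab j') => ->; rewrite !eqs /= ?eqs => *;
        (split; [by [left]|lra]) || (split; [right; lra|lra]) || (by exfalso; lra).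
    split=> // t; rewrite ge_min le_max => /andP[/orP t1 /orP t2].
    by apply: seg; case: t1; case: t2; rewrite /x4; lra.
(* Equal legs: all chips are at the center. *)
have c0 : star_hyperflex l j0 0.
  by apply: (@mkhflex j0 0 (l j0)); rewrite ?eqs /= ?eqs //; lra.
exists [::], [:: (j0, 0)]; split=> //.
- by move=> q; rewrite !inE => /eqP-> /=; rewrite mulr0.
- by move=> q q'; rewrite !inE => /eqP-> /eqP->.
- by move=> q; rewrite !inE => /eqP->.
- move=> j x x0 /hflexE[h [h0 H1 H2 H3]]; exists (j0, 0); rewrite ?mem_head//.
  by move: H1 H2 H3; case: (jab j) => ->; rewrite !eqs /= ?eqs => H1 H2 H3; right; split=> //; lra.
- move=> j x x0 /flexE[j' [y [h [y_0 h0 H1 H2 H3]]]]; right; exists (j0, 0); rewrite ?mem_head//=.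
  have x00 : x = 0.
    by move: H1 H2 H3; case: (jab j) => ->; case: (jab j') => ->; rewrite !eqs /= ?eqs => *; lra.
  split; first by right.
  rewrite x00 minxx maxxx => t /le_anti <-.
  by apply: (@mkflex j0 j0 0 0 (l j0)); rewrite ?eqs /= ?eqs //; lra.
Qed.

End Star.

(** * Assembling the tripods of a curve *)

Section Assemble.
Context {R : realType} (Gamma : tropical_curve R) (I : finType).
(** [gam i j] runs along leg [j] of tripod [i] from its center, and [Q] lists isolated flexes
    outside the tripods. Injectivity is asked only within a third of each leg, where the flexes lie,
    because different tripods may share an edge. *)
Variables (l : I -> 'I_3 -> R) (gam : I -> 'I_3 -> R -> Gamma) (Q : seq Gamma).
Hypothesis l_gt0 : forall i j, 0 < l i j.
Hypothesis flexE : forall p, flex p <-> p \in Q \/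
  exists i j x, [/\ 0 <= x, p = gam i j x & star_flex (l i) j x].
Hypothesis hyperflexE : forall p, hyperflex p <->
  exists i j x, [/\ 0 <= x, p = gam i j x & star_hyperflex (l i) j x].
Hypothesis gam_center : forall i j j', gam i j 0 = gam i j' 0.
Hypothesis gam_continuous : forall i j, continuous (gam i j).
Hypothesis gam_inj : forall i j x i' j' x', 0 <= x -> 3 * x < l i j ->
  0 <= x' -> 3 * x' < l i' j' -> gam i j x = gam i' j' x' ->
  i = i' /\ ((j = j' /\ x = x') \/ (x = 0 /\ x' = 0)).
Hypothesis gam_open : forall i j, open (gam i j @` [set x | 0 < x < l i j / 3]).
Hypothesis Q_uniq : uniq Q.
Hypothesis Q_gam : forall i j x, 0 <= x -> 3 * x < l i j -> gam i j x \notin Q.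
Hypothesis Q_isolated : forall q, q \in Q ->
  exists U : set Gamma, [/\ open U, U q & forall x, U x -> flex x -> x = q].
Hypothesis Q_size : (size Q + #|I|.*2 = 8)%N.

(** Each tripod contributes weight 2 and each point of [Q] weight 1. A flex isolated on its leg is
    isolated in the curve, since the open third of that leg meets neither [Q] nor the flexes of
    other tripods or legs. *)
Lemma assemble_stars : exists P1 P2 : seq Gamma,
  [/\ uniq (P1 ++ P2), (size P1 + (size P2).*2 = 8)%N,
    forall p, p \in P1 -> isolated_flex p,
    forall p, hyperflex p <-> p \in P2
  & forall p, flex p -> p \in P1 \/ exists2 q, q \in P2 & linked_flex p q].
Proof.
have /choice[Q12 sP] : forall i, exists Q12 : seq ('I_3 * R) * seq ('I_3 * R),
    star_points (l i) Q12.1 Q12.2.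
  by move=> i; have [Q1 [Q2 ?]] := star_pointsP (l_gt0 i); exists (Q1, Q2).
pose Q1 i := (Q12 i).1; pose Q2 i := (Q12 i).2.
pose G (u : I * ('I_3 * R)) := gam u.1 u.2.1 u.2.2.
pose S (T : I -> seq ('I_3 * R)) := [seq (i, q) | i <- enum I, q <- T i].
have memS T i q : ((i, q) \in S T) = (q \in T i).
  apply/allpairsPdep/idP => [[i' [q' [_ qT [-> ->]]]] //|qT].
  by exists i, q; rewrite mem_enum.
have uniqS T : (forall i, uniq (T i)) -> uniq (S T).
  move=> uT; apply: allpairs_uniq_dep => [|i _|[i q] [i' q'] _ _ [-> ->]] //=.
  exact: enum_uniq.
have itv i q : q \in Q1 i ++ Q2 i -> 0 <= q.2 /\ 3 * q.2 < l i q.1.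
  by move=> qi; exact: (star_itv (sP i) qi).
have itv1 i q : q \in Q1 i -> 0 <= q.2 /\ 3 * q.2 < l i q.1.
  by move=> qi; apply: itv; rewrite mem_cat qi.
have itv2 i q : q \in Q2 i -> 0 <= q.2 /\ 3 * q.2 < l i q.1.
  by move=> qi; apply: itv; rewrite mem_cat qi orbT.
have G_inj : {in S Q1 ++ S Q2 &, injective G}.
  move=> [i q] [i' q']; rewrite !mem_cat !memS -!mem_cat => qi q'i' Gq.
  have [q0 ql] := itv _ _ qi; have [q'0 q'l] := itv _ _ q'i'.
  have [ii' qq'] := gam_inj q0 ql q'0 q'l Gq; subst i'; congr pair.
  case: qq' => [[j1 x1]|[x0 x'0]]; first by apply/eqP/andP; split; apply/eqP.
  exact: (star_center (sP i) qi q'i' x0 x'0).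
have uniq12 i : uniq (Q1 i ++ Q2 i) by exact: (star_uniq (sP i)).
have uniqSS : uniq (S Q1 ++ S Q2).
  rewrite cat_uniq !uniqS; first last.
  - by move=> i; have := uniq12 i; rewrite cat_uniq => /and3P[].
  - by move=> i; have := uniq12 i; rewrite cat_uniq => /and3P[].
  rewrite andbT /=; apply/hasPn => -[i q]; rewrite !memS => q2.
  have := uniq12 i; rewrite cat_uniq => /and3P[_ /hasPn/(_ q q2) + _].
  exact.
have sizeS T : size (S T) = \sum_i size (T i).
  by rewrite size_allpairs_dep sumnE big_map big_enum.
have center i q x : q.2 = 0 -> x = 0 -> forall j, gam i j x = G (i, q).
  by move=> q0 -> j; rewrite /G /= q0 (gam_center i j q.1).
exists (Q ++ map G (S Q1)), (map G (S Q2)); split.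
- rewrite -catA cat_uniq Q_uniq -map_cat map_inj_in_uniq// uniqSS andbT /=.
  apply/hasPn => _ /mapP[[i q] + ->]; rewrite mem_cat !memS -mem_cat => /itv[q0 ql].
  exact: Q_gam.
- rewrite size_cat !size_map !sizeS -Q_size -addnA; congr (_ + _)%N.
  rewrite -muln2 big_distrl -big_split /= -mul2n mulnC -sum_nat_const.
  by apply: eq_bigr => i _; rewrite -[RHS](star_size (sP i)) muln2.
- move=> p; rewrite mem_cat => /orP[pQ|/mapP[[i q]]].
    split; [by apply/flexE; left| |exact: Q_isolated].
    move=> /hyperflexE[i [j [x [x0 pE /(star_hyperflex_itv x0) xl]]]].
    by have /negP := Q_gam x0 xl; rewrite -pE.
  rewrite memS => qi ->; have [q0 ql] := itv1 _ _ qi.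
  have [q_gt0 fq isol] := star_isolated (sP i) qi.
  split.
  + by apply/flexE; right; exists i, q.1, q.2.
  + move=> /hyperflexE[i' [j [x [x0 pE hx]]]].
    have [ii' _] := gam_inj q0 ql x0 (star_hyperflex_itv x0 hx) pE; subst i'.
    exact: (star_not_hyperflex (sP i) qi x0 hx).
  + exists (gam i q.1 @` [set x | 0 < x < l i q.1 / 3]); split=> //.
      by exists q.2 => //=; lra.
    move=> _ [x /= xl <-] /flexE[xQ|[i' [j [x' [x'0 xE fx']]]]].
      have := @Q_gam i q.1 x; rewrite xQ => H; exfalso.
      by have : ~~ true by apply: H; lra.
    have [x_0 x_l] : 0 <= x /\ 3 * x < l i q.1 by split; lra.
    have [ii' H] := gam_inj x_0 x_l x'0 (star_flex_itv x'0 fx') xE.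
    subst i'; case: H => [[jE xx']|[x00 _]]; last by exfalso; lra.
    by rewrite /G /= (isol x)// xx' jE.
- move=> p; split=> [/hyperflexE[i [j [x [x0 pE hx]]]]|/mapP[[i q]]].
    have [q qi [qE|[q0 x00]]] := star_hyperflex_mem (sP i) x0 hx.
      by apply/mapP; exists (i, q); rewrite ?memS// pE qE.
    by apply/mapP; exists (i, q); rewrite ?memS// pE; exact: center.
  rewrite memS => qi ->; apply/hyperflexE; exists i, q.1, q.2; split=> //.
    by have [] := itv2 _ _ qi.
  exact: (star_hyperflexE (sP i) qi).
- move=> p /flexE[pQ|[i [j [x [x0 pE fx]]]]]; first by left; rewrite mem_cat pQ.
  have [xQ|[q qi [jx seg]]] := star_linked (sP i) x0 fx.
    left; rewrite mem_cat; apply/orP; right; apply/mapP.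
    by exists (i, (j, x)); rewrite ?memS.
  right; exists (G (i, q)); first by apply/map_f; rewrite memS.
  have [q0 _] := itv2 _ _ qi.
  have pE' : p = gam i q.1 x.
    by rewrite pE; case: jx => [->//|->]; exact: gam_center.
  exists (gam i q.1 @` `[Num.min x q.2, Num.max x q.2]); split.
  + apply: connected_continuous_connected; first exact/connected_intervalP/interval_is_interval.
    exact/continuous_subspaceT/gam_continuous.
  + by exists x; rewrite //= in_itv /= ge_min lexx le_max lexx.
  + by exists q.2; rewrite //= in_itv /= ge_min le_max lexx !orbT.
  + move=> _ [t /= tI <-]; apply/flexE; right; exists i, q.1, t; split=> //.
      by move: tI; rewrite in_itv /= => /andP[+ _]; apply: le_trans; rewrite le_min x0.
    by apply: seg; move: tI; rewrite in_itv.
Qed.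

End Assemble.

(** * Chips in dart coordinates *)

Section DartCoordinates.
Context {R : realType} {Gamma : tropical_curve R}.
Implicit Types (nu mu : edge Gamma * bool) (x : R) (l : seq (edge Gamma * bool * R)).

Definition dart_coord nu x : R := if nu.2 then len nu.1 - x else x.

Definition dart_path nu x : Gamma := edge_path nu.1 (dart_coord nu x).

Definition in_range (c : edge Gamma * bool * R) := 0 <= c.2 <= len c.1.1.

Definition place (c : edge Gamma * bool * R) : Gamma := dart_path c.1 c.2.

(* The distance from the chip c, on the edge of nu, to the end of nu. *)
Definition far nu (c : edge Gamma * bool * R) : R :=
  if nu.2 == c.1.2 then len nu.1 - c.2 else c.2.

(** The balance conditions for [K] minus the chips of [l]: chips enter with multiplicity -1, and the
    coefficient of [K] at [v] is its valence minus 2. *)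
Definition slopes l (G : vertex Gamma -> R) (out : edge Gamma * bool -> int) : Prop :=
  [/\ forall nu, out nu + out (reverse nu) = \sum_(c <- l | c.1.1 == nu.1) 1,
      forall nu, G (other nu) = G (endpoint nu) + (out nu)%:~R * len nu.1
        - \sum_(c <- l | c.1.1 == nu.1) far nu c
    & forall v, \sum_(nu in tangent (vpoint v)) out nu = (valence (vpoint v))%:Z - 2].

Lemma canonical_slopes l : all in_range l ->
  canonical_equiv (map place l) <-> exists G out, slopes l G out.
Proof.
move=> l_in; pose cs := [seq (c.1.1, dart_coord c.1 c.2, - 1 : int) | c <- l].
have cs_on : on_curve cs.
  rewrite /on_curve all_map; apply: sub_all l_in => -[[e b] x] /andP[/= x0 xL] /=.
  by rewrite /dart_coord /=; case: b; rewrite ?x0 ?xL// subr_ge0 xL gerBl x0.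
have -> : canonical_equiv (map place l) = principal (vertex_div
    (fun v : vertex Gamma => (valence (vpoint v))%:Z - 2) + chip_div cs).
  congr principal; rewrite /chip_div /points !big_map; congr (_ + _).
  by rewrite -sumrN; apply: eq_bigr => c _; rewrite freegUN.
rewrite (principal_balanced _ cs_on) dart_balancedP.
have e1 nu : - \sum_(c <- cs | c.1.1 == nu.1) c.2 = \sum_(c <- l | c.1.1 == nu.1) 1.
  by rewrite big_map -sumrN.
have e2 nu : \sum_(c <- cs | c.1.1 == nu.1) c.2%:~R * dist_to_end nu c.1.2 =
    - \sum_(c <- l | c.1.1 == nu.1) far nu c.
  rewrite big_map -sumrN; apply: eq_bigr => -[[e b] x] /= /eqP ->.
  rewrite mulrN1z mulN1r /far /dist_to_end /dart_coord /=; congr (- _).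
  by case: nu.2; case: b => //=; rewrite opprB addrC subrK.
by split=> -[G [out [oN oG oz]]]; exists G, out; split=> // nu;
  have := oN nu; have := oG nu; rewrite ?e1 ?e2.
Qed.

Lemma slopes_grad l G out nu : all in_range l -> slopes l G out ->
  G (other nu) - G (endpoint nu) <= (out nu)%:~R * len nu.1.
Proof.
move=> /allP l_in [_ /(_ nu) -> _].
suff : 0 <= \sum_(c <- l | c.1.1 == nu.1) far nu c by lra.
rewrite big_seq_cond; apply: sumr_ge0 => -[[e b] x] /= /andP[/l_in/andP[/= x0 xL] /eqP eE].
by rewrite /far /=; case: ifP => _ //; rewrite subr_ge0 -eE.
Qed.

Lemma reverseK : involutive (@reverse R Gamma).
Proof. by case=> e b; rewrite /reverse /= negbK. Qed.

Lemma endpoint_reverse nu : endpoint (reverse nu) = other nu.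
Proof. by []. Qed.

Lemma other_reverse nu : other (reverse nu) = endpoint nu.
Proof. by case: nu => e b; rewrite /other /reverse /= negbK. Qed.

Lemma same_edge nu mu : nu.1 = mu.1 -> nu = mu \/ nu = reverse mu.
Proof.
case: nu mu => e b [e' b'] /= ->; have [->|/bool_neq->] := eqVneq b b'; [by left|by right].
Qed.

Lemma dart_path_reverse nu x : dart_path (reverse nu) x = dart_path nu (len nu.1 - x).
Proof.
rewrite /dart_path /dart_coord /reverse; case: nu => e [] //=.
by rewrite opprB addrC subrK.
Qed.

Lemma dart_path_far nu mu x : nu.1 = mu.1 ->
  dart_path nu x = dart_path (reverse mu) (far mu (nu, x)).
Proof.
move=> /same_edge[->|->]; rewrite /far /=.
  by rewrite eqxx dart_path_reverse opprB addrC subrK.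
by case: mu => e [].
Qed.

Lemma far_itv nu mu x : nu.1 = mu.1 -> 0 <= x <= len nu.1 -> 0 <= far mu (nu, x) <= len mu.1.
Proof.
move=> e /andP[x0 xL]; rewrite /far /= -e; case: ifP => _; last by rewrite x0.
by rewrite subr_ge0 xL gerBl x0.
Qed.

Lemma far_reverse mu x : far mu (reverse mu, x) = x.
Proof. by case: mu => e []. Qed.

Lemma dart_pathP p : exists nu x, 0 <= x <= len nu.1 /\ p = dart_path nu x.
Proof.
case: (pointP p) => [v|e t te].
  have [e [b vE]] : exists e b, v = endpoint (e, b).
    have /card_gt0P[e0 _] := edge_inhabited Gamma.
    have := graph_connected v (src e0); rewrite -/(adjacent _ _) => /connectP[[|w q]] /=.
      by move=> _ <-; exists e0, false.
    by move=> /andP[/adjacentP[e [[<- _]|[_ <-]]] _ _]; exists e; [exists false|exists true].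
  exists (e, b), 0; rewrite lexx (ltW (len_gt0 _)); split=> //.
  by rewrite /dart_path /dart_coord /= subr0 edge_path_end vE.
by exists (e, false), t; rewrite !ltW; case/andP: te.
Qed.

Lemma dart_path0 nu : dart_path nu 0 = vpoint (endpoint nu).
Proof. by case: nu => e b; rewrite /dart_path /dart_coord subr0 edge_path_end. Qed.

Lemma dart_path_continuous nu : continuous (dart_path nu).
Proof.
move=> t; apply: (@continuous_comp _ _ _ (fun t => if nu.2 then len nu.1 - t else t)
  (edge_path nu.1)); last exact: edge_path_continuous.
by case: nu.2; [apply: cvgB; [exact: cvg_cst|exact: cvg_id]|exact: cvg_id].
Qed.

Lemma dart_path_val nu x : 0 < x < len nu.1 -> val (dart_path nu x) = inr (nu.1, dart_coord nu x).
Proof.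
move=> xl; rewrite val_edge_path// /dart_coord; case: nu.2; lra.
Qed.

Lemma dart_path_inj nu x mu y : 0 < x < len nu.1 -> 0 < y < len mu.1 ->
  dart_path nu x = dart_path mu y -> nu.1 = mu.1 /\ dart_coord nu x = dart_coord mu y.
Proof. by move=> xl yl /(congr1 val); rewrite !dart_path_val// => -[]. Qed.

Lemma dart_path_vpoint nu x v : 0 < x < len nu.1 -> dart_path nu x <> vpoint v.
Proof. by move=> xl /(congr1 val); rewrite dart_path_val. Qed.

Lemma open_dart_arc nu a b : 0 <= a -> b <= len nu.1 ->
  open (dart_path nu @` [set x | a < x < b]).
Proof.
move=> a0 bL; rewrite (_ : _ @` _ = arc nu.1
    [set t | (if nu.2 then len nu.1 - b else a) < t < (if nu.2 then len nu.1 - a else b)]).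
  by apply: open_arc; case: nu.2; lra.
rewrite /dart_path /dart_coord; apply/seteqP; split=> _ [x /= xab <-].
  by exists (if nu.2 then len nu.1 - x else x) => //=; case: nu.2 => /=; lra.
exists (if nu.2 then len nu.1 - x else x); first by move: xab => /=; case: nu.2; lra.
by case: nu.2; rewrite ?opprB ?(addrC _ (_ - _)) ?subrK // addrC subrK.
Qed.

End DartCoordinates.

Lemma count_sum (T : Type) (P : pred T) (s : seq T) :
  \sum_(c <- s | P c) (1 : int) = (count P s)%:Z.
Proof.
elim: s => [|c s IH]; rewrite ?big_nil// big_cons /= IH.
by case: (P c); rewrite /= ?add0n // -PoszD.
Qed.

(** * The complete graph on four vertices *)

Section Complete.
Context {R : realType} {Gamma : tropical_curve R}.
Local Notation V := (vertex Gamma).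
Implicit Types (u v w o : V) (x y h : R) (l : seq (edge Gamma * bool * R)).
Hypothesis Gamma_loopless : loopless (Gamma := Gamma).
Hypothesis card4 : #|V| = 4%N.
Hypothesis cubic : forall v, valence (vpoint v) = 3%N.
Variable d : V -> V -> edge Gamma * bool.
Hypothesis dE : forall u w, u != w -> endpoint (d u w) = u /\ other (d u w) = w.

Lemma endpoint_other (nu : edge Gamma * bool) : endpoint nu != other nu.
Proof. by case: nu => e []; rewrite /other /endpoint //= eq_sym. Qed.

Lemma d_inj v : {in [set~ v]%SET &, injective (d v)}.
Proof.
move=> w w'; rewrite !inE ![_ == v]eq_sym => /dE[_ dw] /dE[_ dw'] e.
by rewrite -dw e dw'.
Qed.

(** The darts to the three other vertices are distinct, and the valence is 3. *)
Lemma tangentK4 v : tangent (vpoint v) = [set d v w | w in [set~ v]]%SET.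
Proof.
have imE : #|[set d v w | w in [set~ v]]%SET| = 3%N.
  by rewrite (card_in_imset (@d_inj v)) cardsC1 card4.
apply/esym/eqP; rewrite eqEcard imE -[X in _ && (X <= _)%N]/(valence _) cubic andbT.
apply/fintype.subsetP => _ /imsetP[w + ->]; rewrite mem_tangent in_setC1 eq_sym => /dE[-> _].
exact: eqxx.
Qed.

Lemma dK nu : d (endpoint nu) (other nu) = nu.
Proof.
have : nu \in tangent (vpoint (endpoint nu)) by rewrite mem_tangent.
rewrite tangentK4 => /imsetP[w]; rewrite !inE eq_sym => /dE[_ ow] nuE.
by rewrite {2}nuE ow.
Qed.

Lemma reverse_d u w : u != w -> reverse (d u w) = d w u.
Proof.
by move=> /dE[du dw]; rewrite -(dK (reverse _)) endpoint_reverse other_reverse du dw.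
Qed.

Lemma sum_tangentK4 v (f : edge Gamma * bool -> int) :
  \sum_(nu in tangent (vpoint v)) f nu = \sum_(w | w != v) f (d v w).
Proof.
rewrite tangentK4 big_imset /=; last exact: d_inj.
by apply: eq_bigl => w; rewrite !inE.
Qed.

(** At a vertex of least potential the three outgoing slopes are nonnegative with sum 1. If some [o]
    is higher, each lowest vertex spends its unit of slope toward [o] and has slope 0 elsewhere; so
    all vertices but [o] are lowest, and edges away from [o] carry no chip. *)
Lemma slopesK4 l G out : all in_range l -> slopes l G out ->
  ((forall u w, G u = G w) /\ forall nu, 0 <= out nu <= 1) \/
  exists o h, [/\ 0 < h,
    forall v, v != o -> len (d v o).1 = h + \sum_(c <- l | c.1.1 == (d v o).1) far (d v o) c
  & forall nu, endpoint nu != o -> other nu != o -> \sum_(c <- l | c.1.1 == nu.1) (1 : int) = 0].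
Proof.
move=> l_in sl; have [oN oG oz] := sl.
have [e0 _] : exists e : edge Gamma, true by have /card_gt0P[e _] := edge_inhabited Gamma; exists e.
have [v0 _ Gmin] := @arg_minP _ _ _ (src e0) xpredT G isT.
have {}Gmin v : G v0 <= G v by exact: Gmin.
have sum1 v : \sum_(w | w != v) out (d v w) = 1 by rewrite -sum_tangentK4 oz cubic.
have out_ge0 v w : G v = G v0 -> w != v -> 0 <= out (d v w).
  rewrite eq_sym => vm /dE[de dw]; have := slopes_grad (d v w) l_in sl.
  rewrite de dw vm => H; rewrite -(ler_int R) -(ler_pM2r (len_gt0 (d v w).1)) mul0r.
  by apply: le_trans H; rewrite subr_ge0.
have out_le1 v w : G v = G v0 -> w != v -> out (d v w) <= 1.
  move=> vm wv; rewrite -(sum1 v) (bigD1 w)//= lerDl.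
  by apply: sumr_ge0 => w' /andP[w'v _]; exact: out_ge0.
have [all_min|] := pselect (forall v, G v = G v0).
  left; split=> [u w|nu]; first by rewrite !all_min.
  by rewrite -(dK nu) out_ge0 ?out_le1// eq_sym endpoint_other.
move=> /existsNP[ o om]; right.
have oG0 : G v0 < G o by rewrite lt_neqAle Gmin andbT; apply/eqP => E; apply: om.
have toward_o v : v != o -> G v = G v0 -> out (d v o) = 1 /\
    forall w, w != v -> w != o -> out (d v w) = 0.
  move=> vo vm; have ov : o != v by rewrite eq_sym.
  have out1 : out (d v o) = 1.
    apply/eqP; rewrite eq_le out_le1//= -gtz0_ge1 -(ltr_int R).
    rewrite -(ltr_pM2r (len_gt0 (d v o).1)) mul0r; have [de dw] := dE vo.
    by apply: lt_le_trans (slopes_grad (d v o) l_in sl); rewrite de dw vm subr_gt0.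
  split=> // w wv wo; have := sum1 v; rewrite (bigD1 o)//= out1 => /eqP.
  rewrite -subr_eq0 addrAC subrr add0r psumr_eq0 => [|w' /andP[w'v _]]; last exact: out_ge0.
  by move=> /allP/(_ w (mem_index_enum _)); rewrite wv wo => /eqP.
have v0o : v0 != o by apply/eqP => E; rewrite E ltxx in oG0.
have min_all v : v != o -> G v = G v0.
  move=> vo; have [->//|vv0] := eqVneq v v0.
  have [_ /(_ v vv0 vo) out0] := toward_o v0 v0o erefl.
  have [de dw] : endpoint (d v0 v) = v0 /\ other (d v0 v) = v by apply: dE; rewrite eq_sym.
  have := slopes_grad (d v0 v) l_in sl; rewrite de dw out0 mul0r subr_le0 => H.
  by apply/eqP; rewrite eq_le H Gmin.
exists o, (G o - G v0); split; first by rewrite subr_gt0.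
  move=> v vo; have [out1 _] := toward_o v vo (min_all v vo); have [de dw] := dE vo.
  by have := oG (d v o); rewrite de dw out1 mul1r (min_all v vo) => ->; ring.
move=> nu no wo; rewrite -oN -[nu]dK reverse_d ?endpoint_other//.
have [_ ->] := toward_o _ no (min_all _ no); rewrite ?add0r//; last by rewrite eq_sym endpoint_other.
by have [_ ->] := toward_o _ wo (min_all _ wo); rewrite ?endpoint_other.
Qed.

(** Converse of the tripod case: the potential is [h] at [o] and 0 elsewhere, with slope 1 toward
    [o], and at [o] the number of chips on the edge minus 1. *)
Lemma starK4 o h l : size l = 4%N ->
  (forall c, c \in l -> exists2 v, v != o & c.1 = d o v) -> all in_range l ->
  (forall v, v != o -> len (d o v).1 = h + \sum_(c <- l | c.1 == d o v) c.2) ->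
  canonical_equiv (map place l).
Proof.
move=> l4 l_o l_in lenE; apply/canonical_slopes => //.
pose k (nu : edge Gamma * bool) : int := \sum_(c <- l | c.1.1 == nu.1) 1.
pose G w : R := if w == o then h else 0.
pose out (nu : edge Gamma * bool) : int := if endpoint nu == o then k nu - 1 else if other nu == o then 1 else 0.
have c_o nu c : c \in l -> c.1.1 = nu.1 -> endpoint nu = o \/ other nu = o.
  move=> /l_o[v vo ->]; have [de _] : endpoint (d o v) = o /\ other (d o v) = v.
    by apply: dE; rewrite eq_sym.
  case/same_edge=> E; [left|right]; first by rewrite -E.
  by rewrite -endpoint_reverse -E.
have k0 nu : endpoint nu != o -> other nu != o -> k nu = 0.
  move=> no wo; rewrite /k big_seq_cond big1// => c /andP[cl /eqP ce].
  by case: (c_o nu c cl ce) => E; [move: no|move: wo]; rewrite E eqxx.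
have from_o nu c : endpoint nu = o -> c \in l -> (c.1.1 == nu.1) = (c.1 == nu).
  move=> no cl; apply/eqP/eqP => [/same_edge[//|E]|->//].
  have [v vo cE] := l_o c cl; have [de _] : endpoint (d o v) = o /\ other (d o v) = v.
    by apply: dE; rewrite eq_sym.
  by have := endpoint_other nu; rewrite no -endpoint_reverse -E cE de eqxx.
have sumE nu (T : nmodType) (f : edge Gamma * bool * R -> T) : endpoint nu = o ->
    \sum_(c <- l | c.1.1 == nu.1) f c = \sum_(c <- l | c.1 == nu) f c.
  move=> no; rewrite big_seq_cond [RHS]big_seq_cond; apply: eq_bigl => c.
  by case cl: (c \in l) => //=; exact: from_o.
have dartE nu : endpoint nu = o -> nu = d o (other nu) by move=> no; rewrite -{1}(dK nu) no.
have other_o nu : endpoint nu = o -> other nu != o.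
  by move=> no; rewrite -no eq_sym endpoint_other.
exists G, out; split=> [nu|nu|v].
- rewrite -/(k nu) /out endpoint_reverse other_reverse.
  have kr : k (reverse nu) = k nu by [].
  have [no|no] := eqVneq (endpoint nu) o.
    by rewrite -no eq_sym (negbTE (endpoint_other nu)) subrK.
  case: eqP => [_|/eqP wo]; first by rewrite kr addrC subrK.
  by rewrite k0 ?addr0.
- have [no|no] := eqVneq (endpoint nu) o.
    have wo := other_o nu no; have nuE := dartE nu no.
    have lenE' : len nu.1 = h + \sum_(c <- l | c.1 == nu) c.2 by rewrite nuE lenE.
    rewrite /G /out no eqxx (negbTE wo) [X in _ - X](sumE _ _ _ no).
    have -> : \sum_(c <- l | c.1 == nu) far nu c =
        (k nu)%:~R * len nu.1 - \sum_(c <- l | c.1 == nu) c.2.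
      rewrite /k sumE// raddf_sum mulr_suml -sumrB.
      by apply: eq_bigr => c /eqP ce; rewrite /far ce eqxx mul1r.
    by rewrite intrB mulrBl mul1r; set kL := _ * len _; lra.
  rewrite /G /out (negbTE no); case: eqP => [wo|/eqP wo].
    have ro : endpoint (reverse nu) = o by [].
    rewrite (sumE (reverse nu))// mul1r add0r.
    have -> : \sum_(c <- l | c.1 == reverse nu) far nu c =
        \sum_(c <- l | c.1 == reverse nu) c.2.
      by apply: eq_bigr => c /eqP ce; rewrite /far ce /=; case: (nu.2).
    have -> : len nu.1 = h + \sum_(c <- l | c.1 == reverse nu) c.2.
      by rewrite -[nu.1]/(reverse nu).1 (dartE _ ro) lenE ?other_o.
    lra.
  rewrite mul0r !add0r big_seq_cond big1 ?oppr0// => c /andP[cl /eqP ce].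
  by case: (c_o nu c cl ce) => E; [move: no|move: wo]; rewrite E eqxx.
- rewrite cubic sum_tangentK4; have [->|vo] := eqVneq v o.
    have outE w : w != o -> out (d o w) = \sum_(c <- l | c.1 == d o w) 1 - 1.
      by rewrite eq_sym => /dE[de _]; rewrite /out de eqxx /k sumE.
    rewrite (eq_bigr _ outE) sumrB sumr_const cardC1 card4.
    rewrite (exchange_big_dep xpredT)//= big_seq (eq_bigr (fun=> 1)).
      by rewrite -big_seq big_const_seq count_predT l4.
    move=> c /l_o[v' v'o ->]; rewrite (bigD1 v') ?v'o ?eqxx//= big1 ?addr0// => w.
    move=> /andP[/andP[wo /eqP/(@d_inj o) e] /negP[]]; apply/eqP; symmetry.
    by apply: e; rewrite !inE.
  have outE w : w != v -> out (d v w) = if w == o then 1 else 0.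
    by rewrite eq_sym => /dE[de dw]; rewrite /out de (negbTE vo) dw.
  rewrite (eq_bigr _ outE) -big_mkcondr (big_pred1 o) // => w /=.
  by have [->|] := eqVneq w o; rewrite ?andbF ?andbT // eq_sym.
Qed.

Definition leg o (j : 'I_3) : V := nth o (enum [set~ o]%SET) j.

Lemma size_legs o : size (enum [set~ o]%SET) = 3%N.
Proof. by rewrite -cardE cardsC1 card4. Qed.

Lemma leg_neq o j : leg o j != o.
Proof.
have : leg o j \in enum [set~ o]%SET by rewrite mem_nth ?size_legs.
by rewrite mem_enum !inE.
Qed.

Lemma leg_inj o : injective (leg o).
Proof.
move=> j j' /eqP; rewrite nth_uniq ?size_legs ?enum_uniq// => /eqP; exact: val_inj.
Qed.

Lemma legP o v : v != o -> exists j, v = leg o j.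
Proof.
move=> vo; have ve : v \in enum [set~ o]%SET by rewrite mem_enum !inE.
have vi : (index v (enum [set~ o]%SET) < 3)%N by rewrite -(size_legs o) index_mem.
by exists (Ordinal vi); rewrite /leg nth_index.
Qed.

Lemma legE o j : endpoint (d o (leg o j)) = o /\ other (d o (leg o j)) = leg o j.
Proof. by apply: dE; rewrite eq_sym leg_neq. Qed.

Definition leg_len o j := len (d o (leg o j)).1.

Definition ray o j x := dart_path (d o (leg o j)) x.

Lemma eq_leg o i j : (d o (leg o j) == d o (leg o i)) = (i == j).
Proof.
apply/eqP/eqP => [E|->//]; have [_ e1] := legE o i; have [_ e2] := legE o j.
by apply: (@leg_inj o); rewrite -e1 -e2 E.
Qed.

(** A constant potential has slopes at most 1, so it allows at most two chips on an edge, and three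
    chips force a tripod. The map [f] rewrites each chip in the coordinate measured from its center
    [o]. *)
Lemma triple_chips_star l (nu : edge Gamma * bool) : all in_range l ->
  (3 <= count (fun c => c.1.1 == nu.1) l)%N -> canonical_equiv (map place l) ->
  exists o h (f : edge Gamma * bool * R -> edge Gamma * bool * R), [/\ 0 < h,
    forall c, c \in l -> [/\ place (f c) = place c, in_range (f c)
      & exists j, (f c).1 = d o (leg o j)]
  & forall i, leg_len o i = h + \sum_(c <- l | (f c).1 == d o (leg o i)) (f c).2].
Proof.
move=> l_in c3 /(canonical_slopes l_in)[G [out sl]].
have [oN _ _] := sl; case: (slopesK4 l_in sl) => [[_ out01]|[ o [h [h0 lenE away]]]].
  have := oN nu; have := out01 nu; have := out01 (reverse nu).
  by rewrite count_sum => /andP[_ o1] /andP[_ o2] o12; exfalso; move: c3 o12; case: (count _ _) => [|[|[|n]]] //; lia.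
exists o, h, (fun c => if endpoint c.1 == o then c else (reverse c.1, len c.1.1 - c.2)).
have touch c : c \in l -> endpoint c.1 == o \/ other c.1 == o.
  move=> cl; case: eqP => [|/eqP no]; first by left.
  case: eqP => [|/eqP wo]; first by right.
  exfalso; have := away _ no wo; rewrite count_sum => /eqP.
  rewrite eqz_nat -leqn0 leqNgt -has_count => /negP[]; apply/hasP.
  by exists c.
have dleg mu : endpoint mu = o -> exists j, mu = d o (leg o j).
  move=> mo; have [|j jE] := @legP o (other mu).
    by rewrite -mo eq_sym endpoint_other.
  by exists j; rewrite -jE -mo dK.
split=> // [c cl|i].
  have := allP l_in _ cl; rewrite /in_range => /andP[c0 cL].
  case: ifP => [/eqP co|no]; first by rewrite c0 cL; split=> //; exact: dleg.
  case: (touch _ cl); rewrite ?no// => /eqP wo; split.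
  - by rewrite /place /= dart_path_reverse opprB addrC subrK.
  - by rewrite /= subr_ge0 cL gerBl c0.
  - exact: dleg.
have [_ lo] := legE o i; rewrite /leg_len.
have -> : (d o (leg o i)).1 = (d (leg o i) o).1 by rewrite -reverse_d // leg_neq.
rewrite lenE ?leg_neq//; congr (_ + _).
have de : endpoint (d (leg o i) o) = leg o i by case: (dE (leg_neq o i)).
rewrite big_seq_cond [RHS]big_seq_cond; apply: eq_big => c; case cl: (c \in l) => //=.
  rewrite -[d o (leg o i)](reverse_d (leg_neq o i)).
  have [_ dw] := dE (leg_neq o i); apply/eqP/eqP => [/same_edge[e|e]|].
  - by rewrite e de (negbTE (leg_neq _ _)).
  - by rewrite e endpoint_reverse dw eqxx.
  - by case: ifP => _ /= => [->|/(congr1 fst)].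
move=> /eqP/same_edge[e|e].
  by rewrite e de (negbTE (leg_neq _ _)) /far e eqxx.
rewrite e endpoint_reverse; have [_ ->] := dE (leg_neq o i); rewrite eqxx.
by rewrite /far e /=; case: (_.2).
Qed.

Lemma flexK4 p : flex p <->
  exists o j x, [/\ 0 <= x, p = ray o j x & star_flex (leg_len o) j x].
Proof.
split=> [[q pq]|[ o [j [x [x0 -> [j' [y [h [y0 h0 lE]]]]]]]]].
  have [nu [x [xl pE]]] := dart_pathP p; have [mu [y [yl qE]]] := dart_pathP q.
  pose c := (nu, x); pose e := (mu, y).
  have [|||o [h [f [h0 fl lE]]]] := @triple_chips_star [:: c; c; c; e] nu.
  - by rewrite /= /in_range xl yl.
  - by rewrite /= !eqxx.
  - by rewrite /= {1 2 3}/place -pE {1}/place -qE.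
  have [|fc fc_in [j jE]] := fl c; first by rewrite mem_head.
  have [|_ fe_in [j' j'E]] := fl e; first by rewrite !inE eqxx !orbT.
  exists o, j, (f c).2; split; first by case/andP: fc_in.
    by rewrite pE -[LHS]fc /place jE.
  exists j', (f e).2, h; split=> //; first by case/andP: fe_in.
  move=> i; rewrite lE !big_cons big_nil jE j'E !eq_leg.
  by case: (i == j); case: (i == j'); rewrite /= ?mulr1 ?mulr0; lra.
exists (ray o j' y).
pose c := (d o (leg o j), x); pose e := (d o (leg o j'), y).
apply: (@starK4 o h [:: c; c; c; e]) => //.
- by move=> ?; rewrite !inE => /orP[|/orP[|/orP[]]] /eqP->; [exists (leg o j)..|exists (leg o j')];
    rewrite ?leg_neq.
- have := lE j; have := lE j'; rewrite /in_range /leg_len /= x0 y0 eqxx.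
  case: (j' == j); case: (j == j'); rewrite ?eqxx /= ?mulr1 ?mulr0 => H1 H2;
    by rewrite !andbT; apply/and4P; split; lra.
- move=> v /legP[i ->]; rewrite -/(leg_len o i) lE !big_cons big_nil !eq_leg.
  by case: (i == j); case: (i == j'); rewrite /= ?mulr1 ?mulr0; lra.
Qed.

Lemma hyperflexK4 p : hyperflex p <->
  exists o j x, [/\ 0 <= x, p = ray o j x & star_hyperflex (leg_len o) j x].
Proof.
split=> [pp|[ o [j [x [x0 -> [h h0 lE]]]]]].
  have [nu [x [xl pE]]] := dart_pathP p; pose c := (nu, x).
  have [|||o [h [f [h0 fl lE]]]] := @triple_chips_star [:: c; c; c; c] nu.
  - by rewrite /= /in_range xl.
  - by rewrite /= !eqxx.
  - by rewrite /= /place -pE.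
  have [|fc fc_in [j jE]] := fl c; first by rewrite mem_head.
  exists o, j, (f c).2; split; first by case/andP: fc_in.
    by rewrite pE -[LHS]fc /place jE.
  exists h => // i; rewrite lE !big_cons big_nil jE !eq_leg.
  by case: (i == j); rewrite /= ?mulr1 ?mulr0; lra.
pose c := (d o (leg o j), x).
apply: (@starK4 o h [:: c; c; c; c]) => //.
- by move=> ?; rewrite !inE !orbb => /eqP->; exists (leg o j); rewrite ?leg_neq.
- have := lE j; rewrite /in_range /leg_len /= x0 eqxx /= mulr1 => H.
  by rewrite !andbT; apply/and4P; split; lra.
- move=> v /legP[i ->]; rewrite -/(leg_len o i) lE !big_cons big_nil !eq_leg.
  by case: (i == j); rewrite /= ?mulr1 ?mulr0; lra.
Qed.

Lemma not_branchK4 : exists z : Gamma, forall z' : Gamma, ~ canonical_equiv [:: z; z; z'; z'].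
Proof.
have [eps eps0 len_eps] := finite_lower_bound (@len_gt0 R Gamma).
have [u [w uw]] : exists u w : V, u != w.
  have /card_gt0P[u _] : (0 < #|V|)%N by rewrite card4.
  by exists u, (leg u ord0); rewrite eq_sym leg_neq.
(* Slightly before the middle of the edge: [2t < L] excludes a constant potential and a tripod at
   [w], while [2t + eps > L] excludes a tripod at [u], where [h] is at least [eps]. *)
pose L := len (d u w).1; pose t := L / 2 - eps / 4.
have tL : 0 < t < L by have := len_eps (d u w).1; rewrite /t -/L; lra.
exists (dart_path (d u w) t) => z'.
have [mu [y [yl ->]]] := dart_pathP z'; pose c := (d u w, t); pose e := (mu, y).
have l_in : all in_range [:: c; c; e; e].
  by rewrite /= /in_range /= yl !ltW //; case/andP: tL.
move=> /(@canonical_slopes _ _ [:: c; c; e; e] l_in)[G [out sl]].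
have [oN oG _] := sl.
have [de dw] := dE uw.
case: (slopesK4 l_in sl) => [[Gc out01]|[ o [h [h0 lenE away]]]].
  have := oN (d u w); have := oG (d u w); have := out01 (d u w); have := out01 (reverse (d u w)).
  rewrite !big_cons !big_nil /= eqxx (Gc (other _) (endpoint (d u w))) /far /= eqxx.
  case: (mu.1 == _) => /=; first by move=> ? ? _ ?; lia.
  move=> o1 o2 + oo; have -> : out (d u w) = 1 by lia.
  by rewrite -/L mul1r /t; lra.
have [ou|no] := eqVneq u o; last first.
  have [wo|wo] := eqVneq w o; last first.
    have := away (d u w); rewrite de dw => /(_ no wo).
    by rewrite !big_cons !big_nil /= eqxx; case: (mu.1 == _); lia.
  have := lenE u no; rewrite -wo !big_cons !big_nil /= eqxx -/L.
  have -> : far (d u w) c = L - t by rewrite /far eqxx.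
  case: eqP => [muE|_]; last by have := len_eps (d u w).1; rewrite /t -/L; lra.
  have := far_itv muE yl => /andP[fy _].
  by have := len_eps (d u w).1; rewrite /t -/L; lra.
have wo : w != o by rewrite -ou eq_sym.
(* The edge from this [v] to [u] carries no chip, so its length equals [h]. *)
have [v vN] : exists v, v \notin [:: u; w; if endpoint mu == u then other mu else endpoint mu].
  apply: contrapT => /forallNP all_in.
  have : (#|V| <= 3)%N; last by rewrite card4.
  rewrite cardE; apply: (@uniq_leq_size _ _ [:: u; w; _] (enum_uniq _)) => x _.
  by apply: contrapT => /negP; exact: all_in.
move: vN; rewrite !inE !negb_or => /and3P[vu vw vmu].
have [dv dvu] := dE vu.
have dwE : (d w o).1 = (d u w).1 by rewrite -ou -(reverse_d uw).
have far_w : far (d w o) c = t.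
  by rewrite -ou -(reverse_d uw) /far /c /=; case: (d u w).2.
have := lenE v; rewrite -ou => /(_ vu); rewrite !big_cons !big_nil /=.
have -> : ((d u w).1 == (d v u).1) = false.
  apply/eqP => /same_edge[E|E]; first by move: vu; rewrite -dv -E de eqxx.
  by move: vw; rewrite -dv -other_reverse -E dw eqxx.
have -> : (mu.1 == (d v u).1) = false.
  apply/eqP => /same_edge[E|E]; move: vmu; rewrite E.
    by rewrite dv (negbTE vu) eqxx.
  by rewrite endpoint_reverse dvu eqxx other_reverse dv eqxx.
rewrite addr0 => hv; have := lenE w wo; have := len_eps (d v u).1.
rewrite !big_cons !big_nil /= dwE eqxx far_w -/L hv.
case: eqP => [muE|_]; last by rewrite /t; lra.
have /(@far_itv _ _ mu (d w o) y) : mu.1 = (d w o).1 by rewrite dwE.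
by move=> /(_ yl)/andP[+ _]; rewrite -/e /t; lra.
Qed.

(** An edge belongs to the tripods at both its ends, but each uses less than a third of it. *)
Lemma ray_inj o j x o' j' x' : 0 <= x -> 3 * x < leg_len o j ->
  0 <= x' -> 3 * x' < leg_len o' j' -> ray o j x = ray o' j' x' ->
  o = o' /\ ((j = j' /\ x = x') \/ (x = 0 /\ x' = 0)).
Proof.
have [ep ot] := legE o j; have [ep' ot'] := legE o' j'.
move=> x0 xl x'0 x'l; rewrite /ray.
have [->|xN] := eqVneq x 0.
  rewrite dart_path0 ep; have [->|x'N] := eqVneq x' 0.
    by rewrite dart_path0 ep' => /vpoint_inj; split=> //; right.
  move=> /esym/dart_path_vpoint[]; rewrite -/(leg_len o' j').
  by rewrite lt0r x'N x'0; lra.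
have [->|x'N] := eqVneq x' 0.
  rewrite dart_path0 => /dart_path_vpoint[]; rewrite -/(leg_len o j).
  by rewrite lt0r xN x0; lra.
have xp : 0 < x by rewrite lt0r xN.
have x'p : 0 < x' by rewrite lt0r x'N.
move=> /dart_path_inj; rewrite -!/(leg_len _ _) => -[||/same_edge[E|E]]; try lra.
  have oE : o = o' by rewrite -ep -ep' E.
  move: E; rewrite -oE => E; have jj : j = j' by apply/eqP; rewrite -(eq_leg o) -E.
  rewrite -jj /dart_coord => xx; split=> //; left; split=> //.
  by move: xx; case: (_.2) => //; lra.
rewrite E /dart_coord /=; move: x'l xl; rewrite /leg_len E /=.
by case: (_.2) => /=; lra.
Qed.

Lemma nonhyperellipticK4 : nonhyperelliptic_facts Gamma.
Proof.
split; first exact: not_branchK4.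
apply: (@assemble_stars R Gamma V leg_len ray [::]) => //.
- by move=> o j; exact: len_gt0.
- by move=> p; rewrite flexK4; split=> [|[//|]]; first by right.
- exact: hyperflexK4.
- by move=> o j j'; rewrite /ray !dart_path0; have [-> _] := legE o j; have [-> _] := legE o j'.
- by move=> o j; exact: dart_path_continuous.
- exact: ray_inj.
- move=> o j; apply: open_dart_arc; rewrite ?lexx// ler_pdivrMr// ler_peMr ?ler1n//.
  exact/ltW/len_gt0.
- by rewrite card4.
Qed.

End Complete.

(** * Two pairs of parallel edges: the possible potentials *)

Section RawSlopes.
Context {R : realType}.

(* Two pairs of parallel edges, numbered by their side s, are joined at both  *)
(* ends t by connectors: inl (s, i) runs from (s, false) to (s, true), and     *)
(* inr t from (false, t) to (true, t). Connectors may have length 0.           *)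
Definition label : Type := ((bool * bool) + bool)%type.
HB.instance Definition _ := Finite.on label.

Definition end_of (lab : label) (e : bool) : bool * bool :=
  match lab with inl (s, _) => (s, e) | inr t => (e, t) end.

Variable llen : label -> R.
Hypothesis leg_gt0 : forall si, 0 < llen (inl si).
Hypothesis connector_ge0 : forall t, 0 <= llen (inr t).
Implicit Types (l : seq (label * R)) (F : bool * bool -> R) (o : label -> bool -> int).

Definition label_chips l lab : int := \sum_(c <- l | c.1 == lab) 1.

Definition dist_end lab (e : bool) u : R := if e then llen lab - u else u.

Definition total_dist l lab e : R := \sum_(c <- l | c.1 == lab) dist_end lab e c.2.

(** The system of [slopes] written for four trivalent vertices, where [K] has coefficient 1. A
    connector of length 0 keeps its slopes, so degenerate graphs obey the same equations. *)
Definition raw_slopes l F o : Prop :=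
  [/\ forall lab e, o lab e + o lab (~~ e) = label_chips l lab,
      forall lab e, F (end_of lab e) = F (end_of lab (~~ e))
        + (o lab (~~ e))%:~R * llen lab - total_dist l lab e
    & forall s t, o (inl (s, false)) t + o (inl (s, true)) t + o (inr t) s = 1].

Definition on_labels l := forall c, c \in l -> 0 <= c.2 <= llen c.1.

Lemma label_chips_ge0 l lab : 0 <= label_chips l lab.
Proof. by apply: sumr_ge0 => c _. Qed.

Lemma total_dist_ge0 l lab e : on_labels l -> 0 <= total_dist l lab e.
Proof.
move=> l_on; rewrite /total_dist big_seq_cond; apply: sumr_ge0 => c /andP[/l_on/andP[c0 cL] /eqP cl].
by rewrite /dist_end -cl; case: e; rewrite ?subr_ge0.
Qed.

Lemma total_dist0 l lab e : label_chips l lab = 0 -> total_dist l lab e = 0.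
Proof.
rewrite /label_chips count_sum => /eqP; rewrite eqz_nat -leqn0 leqNgt -has_count => /hasPn nl.
by rewrite /total_dist big_seq_cond big1// => c /andP[/nl/negP].
Qed.

Lemma ler_intM (m n : int) (x : R) : 0 <= x -> m <= n -> m%:~R * x <= n%:~R * x.
Proof. by move=> x0 mn; apply: ler_wpM2r; rewrite ?ler_int. Qed.

Lemma intM_gt0 (m : int) (x : R) : 0 <= x -> 0 < m%:~R * x -> 1 <= m.
Proof.
move=> x0 mx; rewrite -gtz0_ge1 ltNge; apply/negP => /(ler_intM x0).
by rewrite mul0r leNgt mx.
Qed.

(** Two legs climbing from [(s, ~~ t)] push the slope of the connector there to at most -1, so the
    other side lies lower; it is level, and everything else follows. The chips lie on the tripod at
    [(s, t)] formed by two legs and the connector [t], the latter shortened by the other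
    connector. *)
Lemma raw_tripod l F o s t : on_labels l -> raw_slopes l F o -> F (s, ~~ t) < F (s, t) ->
  exists2 h, 0 < h & [/\ forall i, llen (inl (s, i)) = h + total_dist l (inl (s, i)) t,
    llen (inr t) = llen (inr (~~ t)) + h + total_dist l (inr t) s,
    forall i, label_chips l (inl (~~ s, i)) = 0 & label_chips l (inr (~~ t)) = 0].
Proof.
move=> l_on [oN oF oz] h0.
have tot0 lab e : 0 <= total_dist l lab e by exact: total_dist_ge0.
have grad lab e : F (end_of lab e) - F (end_of lab (~~ e)) <= (o lab (~~ e))%:~R * llen lab.
  by have := oF lab e; have := tot0 lab e; lra.
have up s' e i : F (s', ~~ e) < F (s', e) -> 1 <= o (inl (s', i)) (~~ e).
  move=> lt; apply: (@intM_gt0 _ (llen (inl (s', i)))); first exact: ltW.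
  by apply: lt_le_trans (grad (inl (s', i)) e); rewrite /= subr_gt0.
have Xt0 := connector_ge0 t; have Xt'0 := connector_ge0 (~~ t).
have u0 := up s t false h0; have u1 := up s t true h0.
have x1 : o (inr (~~ t)) s <= - 1 by have := oz s (~~ t); lia.
have k0 := label_chips_ge0 l (inr (~~ t)).
have ko := oN (inr (~~ t)) s.
have lower : F (~~ s, ~~ t) <= F (s, ~~ t) - llen (inr (~~ t)).
  have := grad (inr (~~ t)) (~~ s); rewrite /= negbK.
  by have := ler_intM Xt'0 x1; lra.
(* Otherwise the slopes at both ends of [inr (~~ t)] would be at most -1, although their sum is a
   number of chips. *)
have upper : F (~~ s, t) <= F (~~ s, ~~ t).
  rewrite leNgt; apply/negP => lt.
  have := up _ _ false lt; have := up _ _ true lt; have := oz (~~ s) (~~ t).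
  by lia.
have flat : F (~~ s, t) = F (~~ s, ~~ t).
  apply/eqP; rewrite eq_le upper leNgt; apply/negP => lt.
  have lt' : F (~~ s, ~~ ~~ t) < F (~~ s, ~~ t) by rewrite negbK.
  have := up _ _ false lt'; have := up _ _ true lt'; have := oz (~~ s) t.
  rewrite negbK => oz' ? ?; have /(ler_intM Xt0) : o (inr t) (~~ s) <= - 1 by lia.
  by have := grad (inr t) s; rewrite /=; lra.
have flat_ge0 i e : 0 <= o (inl (~~ s, i)) e.
  rewrite -(negbK e) -(ler_int R) -(ler_pM2r (leg_gt0 (~~ s, i))) mul0r.
  by apply: le_trans (grad (inl (~~ s, i)) (~~ e)); rewrite /= negbK; case: (t) flat; case: (e); lra.
have fl := (flat_ge0 false (~~ t), flat_ge0 true (~~ t), flat_ge0 false t, flat_ge0 true t).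
have [[[fl1 fl2] fl3] fl4] := fl.
have z1 := oz (~~ s) (~~ t); have z2 := oz (~~ s) t; have z3 := oz s (~~ t).
have o1 : o (inr (~~ t)) (~~ s) = 1 by lia.
have k_ct : label_chips l (inr (~~ t)) = 0 by lia.
have x_1 : o (inr (~~ t)) s = - 1 by lia.
have lowerE : F (~~ s, ~~ t) = F (s, ~~ t) - llen (inr (~~ t)).
  by have := oF (inr (~~ t)) (~~ s); rewrite /= negbK x_1 total_dist0//; lra.
have o2 : o (inr t) (~~ s) = 1.
  apply/eqP; rewrite eq_le; apply/andP; split; first by lia.
  by apply: (@intM_gt0 _ (llen (inr t))) => //; have := grad (inr t) s; rewrite /=; lra.
exists (F (s, t) - F (s, ~~ t)); first by rewrite subr_gt0.
split=> [i||i|//].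
- have := oF (inl (s, i)) t; have -> : o (inl (s, i)) (~~ t) = 1 by case: i; lia.
  by rewrite /=; lra.
- by have := oF (inr t) s; rewrite /= o2; lra.
- by rewrite -(oN _ t); case: i; lia.
Qed.

Section Flat.
Variables (l : seq (label * R)) (F : bool * bool -> R) (o : label -> bool -> int).
Hypothesis l_on : on_labels l.
Hypothesis raw : raw_slopes l F o.
Hypothesis flat : forall s t, F (s, ~~ t) = F (s, t).

Lemma flat_leg s i t : (o (inl (s, i)) (~~ t))%:~R * llen (inl (s, i)) = total_dist l (inl (s, i)) t.
Proof. by have [_ /(_ (inl (s, i)) t) + _] := raw; rewrite /= flat; lra. Qed.

Lemma flat_leg_ge0 si e : 0 <= o (inl si) e.
Proof.
case: si => s i; rewrite -(negbK e) -(ler_int R) -(ler_pM2r (leg_gt0 (s, i))) mul0r.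
by rewrite flat_leg total_dist_ge0.
Qed.

(** On level sides the legs have nonnegative slopes, which bounds the slopes at both ends of a
    connector by 1; their sum is nonnegative. *)
Lemma flat_connector t s : -1 <= o (inr t) s <= 1.
Proof.
have le1 s' : o (inr t) s' <= 1.
  have [_ _ /(_ s' t)] := raw; have := flat_leg_ge0 (s', false) t.
  by have := flat_leg_ge0 (s', true) t; lia.
have [/(_ (inr t) s) + _ _] := raw; have := le1 (~~ s); have := le1 s.
by have := label_chips_ge0 l (inr t); lia.
Qed.

Lemma flat_connector_chips t : label_chips l (inr t) <= 2.
Proof.
have [/(_ (inr t) false) + _ _] := raw; have := flat_connector t false.
by have := flat_connector t true; rewrite /=; lia.
Qed.

Lemma flat_sum s t : o (inr t) s + o (inr (~~ t)) s =
  2 - label_chips l (inl (s, false)) - label_chips l (inl (s, true)).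
Proof.
have [oN _ oz] := raw; have := oz s t; have := oz s (~~ t).
by have := oN (inl (s, false)) t; have := oN (inl (s, true)) t; lia.
Qed.

Lemma flat_drop t s : o (inr t) s = - 1 -> label_chips l (inr t) = 0 /\
  F (s, t) = F (~~ s, t) + llen (inr t).
Proof.
move=> oE; have [oN oF _] := raw; have := oN (inr t) s; have := oF (inr t) s.
have := flat_connector t (~~ s); have := label_chips_ge0 l (inr t).
rewrite oE /= => k0 o1 + k; have o1' : o (inr t) (~~ s) = 1 by lia.
have k0' : label_chips l (inr t) = 0 by lia.
by rewrite o1' total_dist0//; split=> //; lra.
Qed.

(** Both connectors then fall at unit slope, without chips, between the same two levels. *)
Lemma flat_middle s : o (inr false) s = - 1 -> o (inr true) s = - 1 ->
  llen (inr false) = llen (inr true).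
Proof.
move=> /flat_drop[_ e1] /flat_drop[_ e2].
by have := flat s false; have := flat (~~ s) false; rewrite /=; lra.
Qed.

(* A leg that carries three of the four chips.                                 *)
Lemma flat_triple s i : 3 <= label_chips l (inl (s, i)) ->
  (exists t, [/\ label_chips l (inl (s, i)) = 3,
     total_dist l (inl (s, i)) t = llen (inl (s, i)) & llen (inr t) <= llen (inr (~~ t))]) \/
  llen (inr false) = llen (inr true) /\
  ((label_chips l (inl (s, i)) = 4 /\ total_dist l (inl (s, i)) false = 2 * llen (inl (s, i))) \/
   label_chips l (inl (s, i)) = 3 /\ exists e, total_dist l (inl (s, i)) e = llen (inl (s, i))).
Proof.
move=> k3; have kd := label_chips_ge0 l (inl (s, ~~ i)).
have sumk t : o (inr t) s + o (inr (~~ t)) s =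
    2 - label_chips l (inl (s, i)) - label_chips l (inl (s, ~~ i)).
  by rewrite flat_sum; case: (i); rewrite /=; lia.
have [oN oF oz] := raw.
have ozi t : o (inl (s, i)) t + o (inl (s, ~~ i)) t + o (inr t) s = 1.
  by rewrite -(oz s t); case: (i); rewrite /= // [X in X + _]addrC.
have oi t := flat_leg_ge0 (s, i) t; have od t := flat_leg_ge0 (s, ~~ i) t.
have c t := flat_connector t s.
(* The two connector slopes at side [s] add up to at most -1 by [sumk], and each is at least -1. *)
have [[e0 e1]|[t [e0 e1]]] : (o (inr false) s = - 1 /\ o (inr true) s = - 1) \/
    exists t, o (inr t) s = - 1 /\ o (inr (~~ t)) s = 0.
  have := sumk false; rewrite /=; have := c false; have := c true => ? ? ?.
  have [|] := eqVneq (o (inr false) s) (- 1); have [|] := eqVneq (o (inr true) s) (- 1).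
  - by left.
  - by right; exists false; split=> //=; lia.
  - by right; exists true; split=> //=; lia.
  - by lia.
- right; split; first exact: (flat_middle e0 e1).
  have := ozi true; have := ozi false; rewrite e0 e1.
  have := oi true; have := oi false; have := od true; have := od false.
  have := oN (inl (s, i)) false; rewrite /= => kE d0 d1 i0 i1 z0 z1.
  have f0 := flat_leg s i false; have f1 := flat_leg s i true.
  have [[i0' i1']|[[i0' i1']|[i0' i1']]] :
      (o (inl (s, i)) false = 2 /\ o (inl (s, i)) true = 2) \/
      (o (inl (s, i)) false = 2 /\ o (inl (s, i)) true = 1) \/
      (o (inl (s, i)) false = 1 /\ o (inl (s, i)) true = 2) by lia.
  + by left; split; [lia|rewrite -f0 /= i1'].
  + by right; split; [lia|exists false; rewrite -f0 /= i1' mul1r].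
  + by right; split; [lia|exists true; rewrite -f1 /= i0' mul1r].
- left; exists t; have := ozi t; have := ozi (~~ t); rewrite e0 e1.
  have := oi t; have := oi (~~ t); have := od t; have := od (~~ t).
  have := oN (inl (s, i)) t => kE d0 d1 i0 i1 z0 z1.
  have o1 : o (inl (s, i)) (~~ t) = 1 by lia.
  split; [by lia|by rewrite -flat_leg o1 mul1r|].
  have [_ dropE] := flat_drop e0; have := oF (inr (~~ t)) s; rewrite /=.
  have := flat s t; have := flat (~~ s) t; have := flat_connector (~~ t) (~~ s).
  have tot0 := total_dist_ge0 (inr (~~ t)) s l_on => /andP[_ o_le1].
  by have := ler_intM (connector_ge0 (~~ t)) o_le1; rewrite mul1r; lra.
Qed.

End Flat.
End RawSlopes.

Lemma sum_pair_bool (I : finType) (g : I * bool -> int) :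
  \sum_p g p = \sum_i (g (i, false) + g (i, true)).
Proof.
rewrite (eq_bigr (fun p => g (p.1, p.2))) => [|[]//].
rewrite -(pair_bigA _ (fun i b => g (i, b))); apply: eq_bigr => i _.
by rewrite big_bool /= addrC.
Qed.

Lemma dart_path_len (R : realType) (Gamma : tropical_curve R) (nu : edge Gamma * bool) :
  dart_path nu (len nu.1) = vpoint (other nu).
Proof. by rewrite -endpoint_reverse -dart_path0 dart_path_reverse subr0. Qed.

(** * Curves modelled on two pairs of parallel edges *)

Section Model.
Context {R : realType} {Gamma : tropical_curve R}.
Local Notation V := (vertex Gamma).
Variables (D : label -> edge Gamma * bool) (ok : pred label) (v : bool * bool -> V).

(* A connector t with ~~ ok (inr t) has length 0, and its ends are the same vertex. *)
Record model : Prop := Model {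
  ok_leg : forall si, ok (inl si);
  endpoint_D : forall lab, ok lab -> endpoint (D lab) = v (end_of lab false);
  other_D : forall lab, ok lab -> other (D lab) = v (end_of lab true);
  D_inj : forall lab lab', ok lab -> ok lab' -> (D lab).1 = (D lab').1 -> lab = lab';
  D_onto : forall e, exists2 lab, ok lab & (D lab).1 = e;
  v_eqP : forall st st', v st = v st' -> st = st' \/ (st.2 = st'.2 /\ ~~ ok (inr st.2));
  v_glue : forall s t, ~~ ok (inr t) -> v (s, t) = v (~~ s, t)
}.

Hypothesis M : model.

Definition label_len lab : R := if ok lab then len (D lab).1 else 0.

Lemma leg_len_gt0 si : 0 < label_len (inl si).
Proof. by rewrite /label_len (ok_leg M) len_gt0. Qed.

Lemma connector_len_ge0 t : 0 <= label_len (inr t).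
Proof. by rewrite /label_len; case: ifP => // _; exact/ltW/len_gt0. Qed.

Definition dart_at lab (e : bool) := if e then reverse (D lab) else D lab.

Lemma endpoint_at lab e : ok lab -> endpoint (dart_at lab e) = v (end_of lab e).
Proof.
by case: e => o; rewrite /dart_at ?endpoint_reverse ?(endpoint_D M) ?(other_D M).
Qed.

Lemma reverse_at lab e : reverse (dart_at lab e) = dart_at lab (~~ e).
Proof. by case: e; rewrite /dart_at /= ?reverseK. Qed.

Lemma edge_at lab e : (dart_at lab e).1 = (D lab).1.
Proof. by case: e. Qed.

Lemma dart_at_inj lab e lab' e' : ok lab -> ok lab' ->
  dart_at lab e = dart_at lab' e' -> (lab, e) = (lab', e').
Proof.
move=> o o' E; have ll : lab = lab'.
  by apply: (D_inj M) => //; rewrite -(edge_at lab e) E edge_at.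
congr pair => //; move: E; rewrite -ll /dart_at /reverse; case: (D lab) => d b.
by case: e; case: e' => //= -[]; case: b.
Qed.

Lemma dart_at_onto nu : exists le : label * bool, ok le.1 /\ dart_at le.1 le.2 = nu.
Proof.
have [lab o E] := D_onto M nu.1.
by case: (same_edge E) => DE; [exists (lab, false)|exists (lab, true)]; split=> //;
  rewrite /dart_at /= DE ?reverseK.
Qed.

Lemma v_onto w : exists st, v st = w.
Proof.
have [nu [x [x01 pE]]] := dart_pathP (vpoint w).
have [nu' nu'E] : exists nu', endpoint nu' = w.
  have [x0|xN0] := eqVneq x 0.
    by exists nu; move: pE; rewrite x0 dart_path0 => /vpoint_inj.
  have [xL|xNL] := eqVneq x (len nu.1).
    by exists (reverse nu); move: pE; rewrite xL dart_path_len => /vpoint_inj.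
  move: pE => /esym/dart_path_vpoint[]; lra.
have [[lab e] [ o E]] := dart_at_onto nu'.
by exists (end_of lab e); rewrite -endpoint_at // E.
Qed.

Lemma eq_v st st' : (v st == v st') = (st == st') || (st.2 == st'.2) && ~~ ok (inr st.2).
Proof.
apply/eqP/orP => [/(v_eqP M)[->|[-> ->]]|[/eqP->//|]]; rewrite ?eqxx; [by left|by right|].
case: st st' => s t [s' t'] /= /andP[/eqP<- o].
by have [->//|/bool_neq->] := eqVneq s s'; rewrite -(v_glue M).
Qed.

Lemma sum_label (f : label -> int) : \sum_lab f lab =
  f (inl (false, false)) + f (inl (false, true)) + f (inl (true, false)) + f (inl (true, true))
  + f (inr false) + f (inr true).
Proof.
rewrite big_sumType /= sum_pair_bool !big_bool /=; ring.
Qed.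

(** Where the connector is missing, the legs of both sides start at the same vertex. *)
Lemma tangent_sum s t (f : edge Gamma * bool -> int) :
  \sum_(nu in tangent (vpoint (v (s, t)))) f nu =
  f (dart_at (inl (s, false)) t) + f (dart_at (inl (s, true)) t) +
  if ok (inr t) then f (dart_at (inr t) s)
  else f (dart_at (inl (~~ s, false)) t) + f (dart_at (inl (~~ s, true)) t).
Proof.
have -> : tangent (vpoint (v (s, t))) = [set dart_at le.1 le.2 | le in
    [set le : label * bool | ok le.1 && (v (end_of le.1 le.2) == v (s, t))]]%SET.
  apply/setP => nu; rewrite mem_tangent; apply/eqP/imsetP => [nuE|[le + ->]].
    have [le [ o leE]] := dart_at_onto nu; exists le => //.
    by rewrite !inE o -nuE -leE endpoint_at ?eqxx.
  by rewrite !inE => /andP[ o /eqP <-]; rewrite endpoint_at.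
rewrite big_imset /=; last first.
  by move=> [lab1 e1] [lab2 e2]; rewrite !inE => /andP[k1 _] /andP[k2 _]; exact: dart_at_inj.
rewrite big_mkcond sum_pair_bool.
under eq_bigr => lab _ do rewrite !inE /= !eq_v.
rewrite sum_label /= !(ok_leg M) /=.
by case: s; case: t; rewrite /dart_at /=; case: (ok (inr false)); case: (ok (inr true)) => /=; ring.
Qed.

Lemma valenceE s t : (valence (vpoint (v (s, t))))%:Z = if ok (inr t) then 3 else 4.
Proof.
have -> : (valence (vpoint (v (s, t))))%:Z = \sum_(nu in tangent (vpoint (v (s, t)))) (1 : int).
  by rewrite sumr_const /valence natz.
by rewrite tangent_sum; case: ifP.
Qed.

Definition label_place (c : label * R) : Gamma := dart_path (D c.1) c.2.

Definition label_chip (c : label * R) := (D c.1, c.2).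

Definition valid (c : label * R) := ok c.1 && (0 <= c.2 <= label_len c.1).

Lemma chips_at l lab e : all valid l -> ok lab ->
  \sum_(c <- map label_chip l | c.1.1 == (dart_at lab e).1) (1 : int) = label_chips l lab.
Proof.
move=> /allP l_ok o; rewrite big_map /= edge_at /label_chips big_seq_cond [RHS]big_seq_cond.
apply: eq_bigl => c; case cl: (c \in l) => //=; have /andP[oc _] := l_ok _ cl.
by apply/eqP/eqP => [/(D_inj M)|->//]; apply.
Qed.

Lemma far_at l lab e : all valid l -> ok lab ->
  \sum_(c <- map label_chip l | c.1.1 == (dart_at lab e).1) far (dart_at lab e) c =
  total_dist label_len l lab (~~ e).
Proof.
move=> /allP l_ok o; rewrite big_map /= edge_at /total_dist big_seq_cond [RHS]big_seq_cond.
apply: eq_big => c; case cl: (c \in l) => //=; have /andP[oc _] := l_ok _ cl.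
  by apply/eqP/eqP => [/(D_inj M)|->//]; apply.
move=> /eqP E; have ce := D_inj M oc o E; rewrite /far /= /dist_end /label_len ce o edge_at.
by case: e; rewrite /= ?eqxx //; case: (_.2).
Qed.

(** A missing connector receives the slopes that the vertex equations force; they cancel because the
    merged vertex has coefficient 2 in [K]. *)
Lemma raw_of_slopes l G out : all valid l -> slopes (map label_chip l) G out ->
  raw_slopes label_len l (fun st => G (v st)) (fun lab e => if ok lab then out (dart_at lab e)
    else if lab is inr t then
      1 - out (dart_at (inl (e, false)) t) - out (dart_at (inl (e, true)) t) else 0).
Proof.
move=> l_ok [oN oG oz]; split=> [lab e|lab e|s t].
- case: ifP => [ol|no]; first by have := oN (dart_at lab e); rewrite chips_at// reverse_at.
  have -> : label_chips l lab = 0.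
    rewrite /label_chips big_seq_cond big1// => c /andP[/(allP l_ok)/andP[oc _] /eqP ce].
    by rewrite -ce oc in no.
  case: lab no => [si|t] no; first by rewrite (ok_leg M) in no.
  by have := oz (v (e, t)); rewrite tangent_sum valenceE no; lia.
- case: ifP => [ol|no].
    have := oG (dart_at lab (~~ e)); rewrite far_at// -endpoint_reverse reverse_at.
    by rewrite !endpoint_at// negbK edge_at {2}/label_len ol.
  have -> : total_dist label_len l lab e = 0.
    rewrite /total_dist big_seq_cond big1// => c /andP[/(allP l_ok)/andP[oc _] /eqP ce].
    by rewrite -ce oc in no.
  rewrite /label_len no mulr0 subr0 addr0.
  case: lab no => [si|t] no; first by rewrite (ok_leg M) in no.
  by rewrite /= -(v_glue M) ?no.
- rewrite !(ok_leg M); case: ifP => o; last by lia.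
  by have := oz (v (s, t)); rewrite tangent_sum valenceE o; lia.
Qed.

(** The ends of a missing connector have equal potential, and its slopes cancel in the sum of their
    two vertex equations. [key] and [kv] choose labels for darts and vertices. *)
Lemma slopes_of_raw l F o : all valid l -> raw_slopes label_len l F o ->
  exists G out, slopes (map label_chip l) G out.
Proof.
move=> l_ok [oN oF oz].
have /choice[key keyP] := dart_at_onto.
have key_at lab e : ok lab -> key (dart_at lab e) = (lab, e).
  move=> ol; have [ok1 E] := keyP (dart_at lab e).
  by rewrite [LHS]surjective_pairing; exact: dart_at_inj.
have /choice[kv kvP] := v_onto.
have no_chips t : ~~ ok (inr t) -> label_chips l (inr t) = 0.
  move=> no; rewrite /label_chips big_seq_cond big1// => c /andP[/(allP l_ok)/andP[oc _] /eqP ce].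
  by rewrite ce (negbTE no) in oc.
have F_glue s t : ~~ ok (inr t) -> F (s, t) = F (~~ s, t).
  move=> no; have := oF (inr t) s; rewrite total_dist0 ?no_chips// /label_len (negbTE no).
  by rewrite mulr0 subr0 addr0.
have F_v st0 : F (kv (v st0)) = F st0.
  case: (v_eqP M (kvP (v st0))) => [->//|[]].
  move: (kv _) => st1; case: st1 st0 => [s t] [s' t'] /= -> no.
  by have [->//|/bool_neq->] := eqVneq s s'; rewrite (F_glue s').
exists (fun w => F (kv w)), (fun nu => o (key nu).1 (key nu).2).
split=> [nu|nu|w].
- have [[lab e] [/= ol <-]] := dart_at_onto nu.
  by rewrite chips_at// reverse_at !key_at// oN.
- have [[lab e] [/= ol <-]] := dart_at_onto nu.
  rewrite far_at// -endpoint_reverse reverse_at !endpoint_at// !F_v key_at// edge_at.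
  by have := oF lab (~~ e); rewrite negbK [label_len lab]/label_len ol.
- have [[s t] <-] := v_onto w; rewrite tangent_sum valenceE.
  have z1 := oz s t; have z2 := oz (~~ s) t; have z3 := oN (inr t) s.
  case: (boolP (ok (inr t))) => [oc|no]; rewrite !key_at ?(ok_leg M)//=.
  by rewrite no_chips// in z3; lia.
Qed.

Lemma label_equiv l : all valid l ->
  canonical_equiv (map label_place l) <-> exists F o, raw_slopes label_len l F o.
Proof.
move=> l_ok; have -> : map label_place l = map place (map label_chip l) by rewrite -map_comp.
rewrite canonical_slopes; first split=> [[G [out sl]]|[F [ o rs]]].
- by eexists; eexists; exact: (raw_of_slopes l_ok sl).
- exact: (slopes_of_raw l_ok rs).
apply/allP => _ /mapP[c /(allP l_ok)/andP[oc c_in] ->].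
by move: c_in; rewrite /in_range /label_len oc.
Qed.

Lemma label_placeP p : exists c, valid c /\ label_place c = p.
Proof.
have [nu [x [xl ->]]] := dart_pathP p; have [[lab e] [ol E]] := dart_at_onto nu.
exists (lab, if e then len nu.1 - x else x); move: xl; rewrite /valid /label_len /label_place -E edge_at /= in ol *.
rewrite ol /dart_at => xl; case: (e) => /=; last by rewrite xl.
by rewrite dart_path_reverse; split=> //; lra.
Qed.

Lemma label_place_inj lab x lab' y : ok lab -> 0 < x < label_len lab -> valid (lab', y) ->
  label_place (lab, x) = label_place (lab', y) -> lab = lab' /\ x = y.
Proof.
rewrite /valid /label_len /label_place /= => ol; rewrite ol => xl /andP[ol']; rewrite ol' => yl.
have [->|y0] := eqVneq y 0; first by rewrite dart_path0 => /dart_path_vpoint[].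
have [->|yL] := eqVneq y (len (D lab').1).
  by rewrite dart_path_len => /dart_path_vpoint[].
have yl' : 0 < y < len (D lab').1 by rewrite !lt_neqAle yL eq_sym y0.
move=> E; have [eE xE] := dart_path_inj xl yl' E.
have ll := D_inj M ol ol' eE; split=> //.
by move: xE; rewrite /dart_coord ll; case: (_.2) => //; lra.
Qed.

End Model.

(** * Explicit potentials *)

Section RawSolutions.
Context {R : realType}.
Variable llen : label -> R.
Implicit Types (l : seq (label * R)).

Lemma total_dist_flip l lab e :
  total_dist llen l lab (~~ e) = (label_chips l lab)%:~R * llen lab - total_dist llen l lab e.
Proof.
rewrite /total_dist /label_chips raddf_sum mulr_suml -sumrB; apply: eq_bigr => c _.
by rewrite mul1r /dist_end; case: e; rewrite /= ?opprB ?(addrC _ (_ - _)) ?subrK.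
Qed.

(** Converse of [raw_tripod]: the potential is 0 on the other side, the length of the connector
    [~~ t] at [(s, ~~ t)], and [h] more at [(s, t)]. *)
Lemma raw_star l s t h : size l = 4%N ->
  (forall c, c \in l -> c.1 \in [:: inl (s, false); inl (s, true); inr t]) ->
  (forall i, llen (inl (s, i)) = h + total_dist llen l (inl (s, i)) t) ->
  llen (inr t) = llen (inr (~~ t)) + h + total_dist llen l (inr t) s ->
  exists F o, raw_slopes llen l F o.
Proof.
move=> l4 l_s lenE XE.
have chips0 lab : lab \notin [:: inl (s, false); inl (s, true); inr t] -> label_chips l lab = 0.
  move=> labN; rewrite /label_chips big_seq_cond big1// => c /andP[/l_s + /eqP ce].
  by rewrite ce (negbTE labN).
have chips4 : label_chips l (inl (s, false)) + label_chips l (inl (s, true)) + label_chips l (inr t) = 4.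
  have -> : 4 = (size l)%:Z by rewrite l4.
  rewrite /label_chips; elim: l l_s {l4 lenE XE chips0} => [|c l IH] l_s; rewrite ?big_nil// !big_cons.
  rewrite /= -addn1 PoszD -IH => [|c' cl]; last by apply: l_s; rewrite inE cl orbT.
  have := l_s c (mem_head _ _); rewrite !inE => /orP[/eqP->|/orP[/eqP->|/eqP->]];
    by case: (s); case: (t); rewrite !eqE /=; lia.
pose F (st : bool * bool) : R := if st.1 == s then
  (if st.2 == t then llen (inr (~~ t)) + h else llen (inr (~~ t))) else 0.
pose o (lab : label) (e : bool) : int := match lab with
  | inl si => if si.1 == s then (if e == t then label_chips l lab - 1 else 1) else 0
  | inr t' => if e == s then (if t' == t then label_chips l lab - 1 else - 1) else 1 end.
have chipsF i : label_chips l (inl (~~ s, i)) = 0 by apply: chips0; case: (s); case: i.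
have chipsX : label_chips l (inr (~~ t)) = 0 by apply: chips0; case: (t).
have := lenE false; have := lenE true; have := total_dist_flip l (inl (s, false)) t.
have := total_dist_flip l (inl (s, true)) t; have := total_dist_flip l (inr t) s.
have := total_dist0 llen (~~ s) (chipsX).
have := total_dist0 llen s chipsX.
have := total_dist0 llen false (chipsF false); have := total_dist0 llen false (chipsF true).
have := total_dist0 llen true (chipsF false); have := total_dist0 llen true (chipsF true).
move=> f1 f2 f3 f4 f5 f6 f7 f8 f9 e1 e2.
move: chips4 (chipsF false) (chipsF true) chipsX => c4 cf ct cX.
exists F, o; split=> [lab e|lab e|s' t'].
- rewrite /o; move: cf ct cX {f1 f2 f3 f4 f5 f6 f7 f8 f9 e1 e2 chipsF c4 chips0 l_s lenE XE F o}.
  case: s; case: t; case: lab => [[[] []]|[]]; case: e => /=; lia.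
- rewrite /o /F; move: cf ct cX XE f1 f2 f3 f4 f5 f6 f7 f8 f9 e1 e2 {chipsF c4 chips0 l_s lenE F o}.
  case: s; case: t; case: lab => [[[] []]|[]]; case: e => /= *;
    rewrite ?intrB ?mulrBl ?mul0r ?mul1r ?mulrN1z ?mulN1r; lra.
- rewrite /o; move: c4 cf ct cX {f1 f2 f3 f4 f5 f6 f7 f8 f9 e1 e2 chipsF chips0 l_s lenE XE F o}.
  by case: s; case: t; case: s'; case: t' => /=; lia.
Qed.

(* The pairs of chips are exchanged by the involution of a curve whose two     *)
(* connectors have the same length.                                            *)
Lemma raw_pairs l (n : bool * bool -> int) (k : int) (N : bool -> R) :
  llen (inr false) = llen (inr true) ->
  (forall si, label_chips l (inl si) = n si + n si) ->
  (forall si e, total_dist llen l (inl si) e = (n si)%:~R * llen (inl si)) ->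
  (forall t, label_chips l (inr t) = k) ->
  (forall t s, total_dist llen l (inr t) s = N s) ->
  n (false, false) + n (false, true) + n (true, false) + n (true, true) + k = 2 ->
  exists F o, raw_slopes llen l F o.
Proof.
move=> XE chipsL distL chipsX distX sum2.
pose a s : int := 1 - n (s, false) - n (s, true).
have aE : a false + a true = k by rewrite /a; lia.
have NE : N true = k%:~R * llen (inr true) - N false.
  by have := total_dist_flip l (inr true) false; rewrite !distX chipsX.
exists (fun st => if st.1 then (a false)%:~R * llen (inr true) - N true else 0).
exists (fun lab e => match lab with inl si => n si | inr t => a e end).
split=> [[si|t] e|[[s i]|t] e|s t].
- by rewrite chipsL.
- by rewrite chipsX -aE; case: e; rewrite // addrC.
- by rewrite distL /=; lra.
- have XtE : llen (inr t) = llen (inr true) by case: (t).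
  rewrite distX XtE /=; case: e => /=; first by rewrite add0r.
  by move: NE; rewrite -aE intrD mulrDl; lra.
- by rewrite /a; lia.
Qed.

(** Both sides are level, with side [s] higher by the length of the shorter connector. The longer
    connector stays level up to the fourth chip, at a distance from side [s] equal to the difference
    of lengths, and falls at unit slope after it. *)
Lemma raw_third s i u : llen (inr false) < llen (inr true) -> 3 * u = llen (inl (s, i)) ->
  let c := (inl (s, i) : label, u) in
  exists F o, raw_slopes llen [:: c; c; c;
    (inr true, dist_end llen (inr true) s (llen (inr true) - llen (inr false)))] F o.
Proof.
move=> Xlt uE /=.
exists (fun st => if st.1 == s then llen (inr false) else 0).
exists (fun lab e => match lab with
  | inl si => if si == (s, i) then (if e then 1 else 2) else 0
  | inr t => if e == s then (if t then 0 else - 1) else 1 end).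
split=> [lab e|lab e|s' t].
- by rewrite /label_chips !big_cons !big_nil; case: s {uE}; case: i; case: lab => [[[] []]|[]]; case: e.
- rewrite /total_dist !big_cons !big_nil /dist_end; move: uE.
  by case: s; case: i; case: lab => [[[] []]|[]]; case: e => /=; lra.
- by case: s {uE}; case: i; case: s'; case: t.
Qed.

End RawSolutions.

(** * Unequal connectors: the equations of the flexes *)

Section Unbalanced.
Context {R : realType} {Gamma : tropical_curve R}.
Local Notation V := (vertex Gamma).
Variables (D : label -> edge Gamma * bool) (ok : pred label) (v : bool * bool -> V).
Hypothesis M : model D ok v.
Local Notation llen := (label_len D ok).
Local Notation place := (label_place D).
Local Notation valid := (valid D ok).
Implicit Types (p q : Gamma) (s i t : bool) (j : 'I_3) (w x : R).

Lemma dist_endK lab e x : dist_end llen lab e (dist_end llen lab e x) = x.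
Proof. by rewrite /dist_end; case: e; rewrite // opprB addrC subrK. Qed.

Lemma valid_dist_end lab e x : valid (lab, dist_end llen lab e x) = valid (lab, x).
Proof.
rewrite /valid /dist_end /=; case: e => //; congr (_ && _).
by apply/andP/andP => -[]; split; lra.
Qed.

Lemma place_dist_end lab e w : ok lab ->
  place (lab, dist_end llen lab e w) = dart_path (dart_at D lab e) w.
Proof.
by move=> ol; rewrite /place /dist_end /label_len ol; case: e => //=; rewrite dart_path_reverse.
Qed.

Lemma raw_canonical l : all valid l -> canonical_equiv (map place l) ->
  exists F o, on_labels llen l /\ raw_slopes llen l F o.
Proof.
move=> l_ok /(label_equiv M l_ok)[F [ o rs]]; exists F, o; split=> // c.
by move=> /(allP l_ok)/andP[].
Qed.

Lemma tripod_or_flat (F : bool * bool -> R) :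
  (exists s t, F (s, ~~ t) < F (s, t)) \/ forall s t, F (s, ~~ t) = F (s, t).
Proof.
have [E|N] := pselect (exists s t, F (s, ~~ t) < F (s, t)); [by left|right=> s t].
apply/eqP; rewrite eq_le !leNgt; apply/andP; split; apply/negP => lt; apply: N.
  by exists s, (~~ t); rewrite negbK.
by exists s, t.
Qed.

Hypothesis unbalanced : llen (inr false) < llen (inr true).

Lemma ok_true : ok (inr true).
Proof.
move: unbalanced; rewrite {2}/label_len; case: ifP => // _ /lt_le_trans/(_ (lexx _)).
by rewrite ltNge (connector_len_ge0 D ok).
Qed.

(** The tripod of side [s] is centered at the end [(s, true)] of the longer connector; its third leg
    is that connector, reached here as the default of [nth]. *)
Definition star_label s j : label := nth (inr true : label)
  [:: inl (s, false); inl (s, true)] j.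

Definition star_end s j : bool := if star_label s j is inl _ then true else s.

(** The connector counts only for its excess over the shorter one, as in [raw_tripod]. *)
Definition star_len s j := llen (star_label s j) -
  (if star_label s j is inl _ then 0 else llen (inr false)).

Definition star_ray s j w : Gamma :=
  place (star_label s j, dist_end llen (star_label s j) (star_end s j) w).

Lemma star_ok s j : ok (star_label s j).
Proof.
by rewrite /star_label; case: j => -[|[|[|]]] //= _; rewrite ?(ok_leg M) ?ok_true.
Qed.

Lemma star_labelP s lab : lab \in [:: inl (s, false); inl (s, true); inr true] ->
  exists j, lab = star_label s j.
Proof.
rewrite !inE => /orP[/eqP->|/orP[/eqP->|/eqP->]].
- by exists ord0.
- by exists (inord 1); rewrite /star_label inordK.
- by exists (inord 2); rewrite /star_label inordK.
Qed.

Lemma star_label_mem s j : star_label s j \in [:: inl (s, false); inl (s, true); inr true].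
Proof. by rewrite /star_label; case: j => -[|[|[|]]] //= _; rewrite !inE !eqxx ?orbT. Qed.

Lemma star_label_inj s : injective (star_label s).
Proof.
move=> [[|[|[|a]]] la] [[|[|[|b]]] lb] // E; apply: val_inj => //=; move: E;
  by rewrite /star_label /=.
Qed.

Lemma star_label_side s j s' j' : star_label s j = star_label s' j' ->
  s = s' \/ star_label s j = inr true.
Proof.
by rewrite /star_label; case: j => -[|[|[|]]] //= _; case: j' => -[|[|[|]]] //= _;
  move=> E; try (by right); by case: E => ->; left.
Qed.

Lemma star_len_le s j : star_len s j <= llen (star_label s j).
Proof.
rewrite /star_len; case: (star_label s j) => [?|?]; first by rewrite subr0.
by rewrite gerBl connector_len_ge0.
Qed.

Lemma star_len_gt0 s j : 0 < star_len s j.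
Proof.
have := star_label_mem s j; rewrite !inE /star_len => /orP[/eqP->|/orP[/eqP->|/eqP->]];
  by rewrite ?subr0 ?subr_gt0 ?(leg_len_gt0 M).
Qed.

Definition thirds : seq Gamma :=
  [seq place (inl si, llen (inl si) / 3) | si <- enum ((bool * bool)%type : finType)].

(** A tripod at an end of the shorter connector is impossible, since [raw_tripod] makes the
    connector at the center the longer one. *)
Lemma unbalanced_cases l : all valid l -> canonical_equiv (map place l) ->
  (exists s h, [/\ 0 < h, forall c', 0 < label_chips l c' ->
      c' \in [:: inl (s, false); inl (s, true); inr true] &
     forall j, star_len s j = h + total_dist llen l (star_label s j) (star_end s j)]) \/
  exists F o, [/\ on_labels llen l, raw_slopes llen l F o & forall s t, F (s, ~~ t) = F (s, t)].
Proof.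
move=> l_ok /(raw_canonical l_ok)[F [ o [l_on rs]]].
case: (tripod_or_flat F) => [[s [t lt]]|flat]; [left|right; by exists F, o].
have [h h0 [lenE XE legs0 conn0]] := raw_tripod (leg_len_gt0 M) (connector_len_ge0 D ok) l_on rs lt.
have tt : t = true.
  have := total_dist_ge0 (inr t) s l_on; case: t {lt} XE lenE conn0 => // XE _ _.
  by move: unbalanced XE => /=; lra.
rewrite {}tt /= in lt XE lenE conn0.
exists s, h; split=> // [[[s' i]|t']|j].
- have [->|/bool_neq->] := eqVneq s' s; last by rewrite legs0.
  by rewrite !inE; case: i; rewrite eqxx ?orbT.
- by case: t'; rewrite ?conn0 // !inE eqxx !orbT.
- have := star_label_mem s j; rewrite !inE /star_len /star_end.
  by move=> /orP[/eqP->|/orP[/eqP->|/eqP->]]; rewrite ?subr0 ?lenE// XE; ring.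
Qed.

Lemma chips_cons (c : label * R) l lab : label_chips (c :: l) lab = (c.1 == lab)%:Z + label_chips l lab.
Proof. by rewrite /label_chips big_cons; case: (_ == lab); rewrite ?add0r. Qed.

Lemma total_dist_cons (c : label * R) l lab e : total_dist llen (c :: l) lab e =
  dist_end llen lab e c.2 *+ (c.1 == lab) + total_dist llen l lab e.
Proof. by rewrite /total_dist big_cons; case: ifP => _; rewrite ?mulr1n // mulr0n add0r. Qed.

Lemma chips_nil lab : label_chips ([::] : seq (label * R)) lab = 0.
Proof. by rewrite /label_chips big_nil. Qed.

Lemma total_dist_nil lab e : total_dist llen [::] lab e = 0.
Proof. by rewrite /total_dist big_nil. Qed.

Definition chipsE := (chips_cons, chips_nil).
Definition total_distE := (total_dist_cons, total_dist_nil).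

(** Unequal lengths leave one case of [flat_triple], in which the distances to the end at the
    shorter connector add up to the leg. Three equal chips are then at one third of it. *)
Lemma flat_triple_third (l : seq (label * R)) (F : bool * bool -> R) o lab : on_labels llen l -> raw_slopes llen l F o ->
  (forall s t, F (s, ~~ t) = F (s, t)) -> 3 <= label_chips l lab ->
  [/\ label_chips l lab = 3, total_dist llen l lab false = llen lab & exists si, lab = inl si].
Proof.
move=> l_on rs flat; case: lab => [[s i]|t] k3; last first.
  by have := flat_connector_chips (leg_len_gt0 M) l_on rs flat t; lia.
have := flat_triple (leg_len_gt0 M) (connector_len_ge0 D ok) l_on rs flat k3.
move=> [[[] [k3' tE XX]]|[XX _]]; try (by move: unbalanced XX => /=; lra).
by split=> //; exists (s, i).
Qed.

Lemma star_rayE s j lab w : star_label s j = lab ->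
  star_ray s j (dist_end llen lab (star_end s j) w) = place (lab, w).
Proof. by move=> E; rewrite /star_ray E dist_endK. Qed.

Lemma dist_end_ge0 lab e w : valid (lab, w) -> 0 <= dist_end llen lab e w.
Proof. by move=> /andP[_ /andP[]] /=; rewrite /dist_end; case: e; lra. Qed.

Lemma valid_star s j w : 0 <= w -> w <= star_len s j ->
  valid (star_label s j, dist_end llen (star_label s j) (star_end s j) w).
Proof.
move=> w0 wl; rewrite valid_dist_end /valid star_ok w0 /=.
exact: le_trans wl (star_len_le s j).
Qed.

Lemma star_equiv l s h : all valid l -> size l = 4%N ->
  (forall c, c \in l -> c.1 \in [:: inl (s, false); inl (s, true); inr true]) ->
  (forall j, star_len s j = h + total_dist llen l (star_label s j) (star_end s j)) ->
  canonical_equiv (map place l).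
Proof.
move=> l_ok l4 l_s lenE; apply/(label_equiv M l_ok); apply: (@raw_star _ _ l s true h) => //.
  move=> i; have := lenE (if i then inord 1 else ord0).
  by rewrite /star_len /star_end /star_label; case: i; rewrite ?inordK //= subr0.
by have := lenE (inord 2); rewrite /star_len /star_end /star_label inordK //=; lra.
Qed.

(** The tripod solutions are the flexes of the two stars, and the level solutions are the thirds,
    realized by [raw_third]. *)
Lemma flex_unbalanced p : flex p <-> p \in thirds \/
  exists s j w, [/\ 0 <= w, p = star_ray s j w & star_flex (star_len s) j w].
Proof.
split=> [[q]|[/mapP[[s i] _ ->]|[s [j [w [w0 -> [j' [y [h [y0 h0 lenE]]]]]]]]]].
- have [c [c_ok <-]] := label_placeP M p; have [c' [c'_ok <-]] := label_placeP M q.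
  have l_ok : all valid [:: c; c; c; c'] by rewrite /= c_ok c'_ok.
  move=> /(@unbalanced_cases [:: c; c; c; c'] l_ok)[[s [h [h0 l_s lenE]]]|[F [ o [l_on rs flat]]]].
    right; have [j jE] : exists j, c.1 = star_label s j.
      by apply/star_labelP/l_s; rewrite !chipsE eqxx /=; case: (_ == _).
    have [j' j'E] : exists j, c'.1 = star_label s j.
      by apply/star_labelP/l_s; rewrite !chipsE eqxx /=; case: (_ == _).
    exists s, j, (dist_end llen c.1 (star_end s j) c.2); split.
    + by apply: dist_end_ge0; rewrite -surjective_pairing.
    + by rewrite star_rayE -?surjective_pairing.
    exists j', (dist_end llen c'.1 (star_end s j') c'.2), h; split=> //.
      by apply: dist_end_ge0; rewrite -surjective_pairing.
    move=> i; rewrite lenE !total_distE jE j'E !(inj_eq (@star_label_inj s)).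
    rewrite ![_ == i]eq_sym; case: eqP => [<-|_]; case: eqP => [<-|_];
      by rewrite ?mulr1n ?mulr0n ?mulr1 ?mulr0; lra.
  left; have [|] := flat_triple_third (lab := c.1) l_on rs flat.
    by rewrite !chipsE eqxx.
  rewrite !chipsE !total_distE eqxx; case: eqP => //= _ _ dE [si siE].
  apply/mapP; exists si; first by rewrite mem_enum.
  rewrite [c]surjective_pairing siE; congr (place (_, _)).
  by move: dE; rewrite /dist_end siE !mulr1n mulr0n; lra.
- have L0 := leg_len_gt0 M (s, i); have Lt := connector_len_ge0 D ok false.
  set c := (inl (s, i) : label, llen (inl (s, i)) / 3).
  have [|F [ o rs]] := @raw_third _ llen s i (llen (inl (s, i)) / 3) unbalanced; first by lra.
  pose c' := (inr true : label, dist_end llen (inr true) s (llen (inr true) - llen (inr false))).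
  exists (place c'); apply/(@label_equiv _ _ _ _ _ M [:: c; c; c; c']); last by exists F, o.
  have c_ok : valid c by rewrite /valid /= (ok_leg M); apply/andP; split; lra.
  rewrite /= c_ok /= andbT /c' valid_dist_end /valid ok_true /=; move: unbalanced; lra.
- pose c := (star_label s j, dist_end llen (star_label s j) (star_end s j) w).
  pose c' := (star_label s j', dist_end llen (star_label s j') (star_end s j') y).
  have c_ok : valid c.
    apply: valid_star => //; rewrite (lenE j) eqxx mulr1.
    by case: (_ == _); rewrite ?mulr1 ?mulr0; lra.
  have c'_ok : valid c'.
    apply: valid_star => //; rewrite (lenE j') eqxx mulr1.
    by case: (_ == _); rewrite ?mulr1 ?mulr0; lra.
  exists (star_ray s j' y); apply: (@star_equiv [:: c; c; c; c'] s h) => //.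
  + by rewrite /= c_ok c'_ok.
  + by move=> a; rewrite !in_cons in_nil orbF => /or4P[] /eqP->; exact: star_label_mem.
  + move=> i; rewrite lenE !total_distE /c /c' /= !(inj_eq (@star_label_inj s)).
    rewrite ![_ == i]eq_sym; case: eqP => [<-|_]; case: eqP => [<-|_];
      by rewrite ?dist_endK ?mulr1n ?mulr0n ?mulr1 ?mulr0; lra.
Qed.

(** A level potential allows exactly three chips on a leg, never four, so hyperflexes come from the
    stars alone. *)
Lemma hyperflex_unbalanced p : hyperflex p <->
  exists s j w, [/\ 0 <= w, p = star_ray s j w & star_hyperflex (star_len s) j w].
Proof.
split=> [|[s [j [w [w0 -> [h h0 lenE]]]]]].
- have [c [c_ok <-]] := label_placeP M p.
  have l_ok : all valid [:: c; c; c; c] by rewrite /= c_ok.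
  move=> /(@unbalanced_cases [:: c; c; c; c] l_ok)[[s [h [h0 l_s lenE]]]|[F [ o [l_on rs flat]]]].
    have [j jE] : exists j, c.1 = star_label s j.
      by apply/star_labelP/l_s; rewrite !chipsE eqxx.
    exists s, j, (dist_end llen c.1 (star_end s j) c.2); split.
    + by apply: dist_end_ge0; rewrite -surjective_pairing.
    + by rewrite star_rayE -?surjective_pairing.
    exists h => // i; rewrite lenE !total_distE jE !(inj_eq (@star_label_inj s)).
    by rewrite ![_ == i]eq_sym; case: eqP => [<-|_]; rewrite ?mulr1n ?mulr0n ?mulr1 ?mulr0; lra.
  by have [|] := flat_triple_third (lab := c.1) l_on rs flat; rewrite !chipsE eqxx.
- pose c := (star_label s j, dist_end llen (star_label s j) (star_end s j) w).
  have c_ok : valid c.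
    by apply: valid_star => //; rewrite (lenE j) eqxx mulr1; lra.
  apply: (@star_equiv [:: c; c; c; c] s h) => //.
  + by rewrite /= c_ok.
  + by move=> a; rewrite !in_cons in_nil orbF !orbb => /eqP->; exact: star_label_mem.
  + move=> i; rewrite lenE !total_distE /c /= !(inj_eq (@star_label_inj s)).
    by rewrite ![_ == i]eq_sym; case: eqP => [<-|_]; rewrite ?dist_endK ?mulr1n ?mulr0n ?mulr1 ?mulr0; lra.
Qed.

End Unbalanced.

(** * Unequal connectors: counting the flexes *)

Section UnbalancedFacts.
Context {R : realType} {Gamma : tropical_curve R}.
Local Notation V := (vertex Gamma).
Variables (D : label -> edge Gamma * bool) (ok : pred label) (v : bool * bool -> V).
Hypothesis M : model D ok v.
Local Notation llen := (label_len D ok).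
Local Notation place := (label_place D).
Local Notation valid := (valid D ok).
Local Notation star_len := (star_len D ok).
Local Notation star_ray := (star_ray D ok).
Local Notation thirds := (thirds D ok).
Implicit Types (p q : Gamma) (s i t : bool) (j : 'I_3) (w x : R).
Hypothesis unbalanced : llen (inr false) < llen (inr true).

Lemma not_branch_unbalanced : exists z : Gamma, forall z' : Gamma, ~ canonical_equiv [:: z; z; z'; z'].
Proof.
pose lab : label := inl (false, false).
have L0 : 0 < llen lab := leg_len_gt0 M (false, false).
(* At a quarter of the leg, two chips lie too far from the center for a tripod, and their distances
   at level potential add up to half the leg, not to an integer multiple of it. *)
pose c := (lab, llen lab / 4); exists (place c) => z'.
have c_ok : valid c by rewrite /valid (ok_leg M) /=; lra.
have [c' [c'_ok <-]] := label_placeP M z'.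
have l_ok : all valid [:: c; c; c'; c'] by rewrite /= c_ok c'_ok.
have tot0 e : 0 <= dist_end llen lab e c'.2 *+ (c'.1 == lab).
  case: eqP => [E|_]; rewrite ?mulr0n// mulr1n.
  by apply: (dist_end_ge0 (D := D) (ok := ok)); rewrite -E -surjective_pairing.
move=> /(@unbalanced_cases _ _ _ _ _ M unbalanced [:: c; c; c'; c'] l_ok).
case=> [[s [h [h0 l_s lenE]]]|[F [ o [l_on rs flat]]]].
  have : lab \in [:: inl (s, false); inl (s, true); inr true].
    by apply: l_s; rewrite !chipsE eqxx; case: (_ == _).
  move=> lab_s; have sE : s = false by move: lab_s; case: (s).
  move: (lenE ord0); rewrite /star_len /star_label /star_end /=.
  rewrite sE /= !total_distE eqxx !mulr1n -/lab.
  have := tot0 true; rewrite /dist_end /=; set y := _ *+ _; lra.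
have oE := flat_leg rs flat false false false.
have [k3|k2] := eqVneq c'.1 lab.
  have [|] := flat_triple_third M unbalanced (lab := lab) l_on rs flat; rewrite !chipsE ?k3 ?eqxx //.
move: oE; rewrite -/lab !total_distE eqxx (negbTE k2) !mulr1n !mulr0n {1 2}/dist_end /=.
set n := o _ _; have [n0|n1] := lerP n 0.
  by have := ler_intM (ltW L0) n0; rewrite mul0r; lra.
by have := ler_intM (ltW L0) (n1 : 1 <= n); rewrite mul1r; lra.
Qed.

Lemma star_ray_path s j w : star_ray s j w = dart_path (dart_at D (star_label s j) (star_end s j)) w.
Proof. by apply: place_dist_end; exact: (star_ok M unbalanced). Qed.

Lemma star_ray0 s j : star_ray s j 0 = vpoint (v (s, true)).
Proof.
rewrite star_ray_path dart_path0 (endpoint_at M) ?(star_ok M unbalanced)//; congr (vpoint (v _)).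
have := star_label_mem s j; rewrite /star_end !inE.
by move=> /orP[/eqP->|/orP[/eqP->|/eqP->]].
Qed.

Lemma center_inj s s' : v (s, true) = v (s', true) -> s = s'.
Proof.
case/(v_eqP M) => [[]//|[_]] /=; by rewrite (ok_true unbalanced).
Qed.

Lemma star_ray_itv s j w : 0 < w -> 3 * w < star_len s j -> 0 < w < llen (star_label s j).
Proof. by move=> w0 wl; have := star_len_le D ok s j; lra. Qed.

Lemma star_ray_vertex s j w u : 0 < w -> 3 * w < star_len s j -> star_ray s j w <> vpoint u.
Proof.
move=> w0 wl; rewrite star_ray_path; apply: dart_path_vpoint; rewrite edge_at.
by have := star_ray_itv w0 wl; rewrite /label_len (star_ok M unbalanced).
Qed.

Lemma star_ray_place s j w c : valid c -> 0 < w -> 3 * w < star_len s j ->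
  star_ray s j w = place c -> star_label s j = c.1 /\ w = dist_end llen c.1 (star_end s j) c.2.
Proof.
move=> c_ok w0 wl E; have wi := star_ray_itv w0 wl.
have wi' : 0 < dist_end llen (star_label s j) (star_end s j) w < llen (star_label s j).
  by move: wi; rewrite /dist_end; case: (star_end s j); lra.
case: c c_ok E => lab x c_ok E.
have [<- <-] := label_place_inj M (star_ok M unbalanced s j) wi' c_ok E.
by rewrite dist_endK.
Qed.

Lemma star_ray_inj s j w s' j' w' : 0 <= w -> 3 * w < star_len s j ->
  0 <= w' -> 3 * w' < star_len s' j' -> star_ray s j w = star_ray s' j' w' ->
  s = s' /\ ((j = j' /\ w = w') \/ (w = 0 /\ w' = 0)).
Proof.
move=> w0 wl w'0 w'l.
have [->|wN] := eqVneq w 0.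
  rewrite star_ray0; have [->|w'N] := eqVneq w' 0.
    by rewrite star_ray0 => /vpoint_inj/center_inj; split=> //; right.
  by move=> /esym/star_ray_vertex[]; rewrite // lt0r w'N.
have [->|w'N] := eqVneq w' 0.
  by rewrite star_ray0 => /star_ray_vertex[]; rewrite // lt0r wN.
have wp : 0 < w by rewrite lt0r wN.
have w'p : 0 < w' by rewrite lt0r w'N.
move=> E; have [|ll wE] := star_ray_place _ wp wl E.
  rewrite valid_dist_end /valid (star_ok M unbalanced) /=.
  by have := star_ray_itv w'p w'l; lra.
move: ll wE => /= ll wE; have ss : s = s'.
  have [//|lE] := star_label_side ll.
  have [//|/bool_neq s's] := eqVneq s s'; exfalso.
  (* Both tripods use the longer connector, each less than a third of it from its own end. *)
  have lE' : star_label s' j' = inr true by rewrite -ll.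
  move: wl w'l wE; rewrite /star_len /star_end /= lE lE' s's /dist_end /=.
  by have := connector_len_ge0 D ok false; case: (s') => /=; lra.
split=> //; left; move: ll wE; rewrite -ss => /star_label_inj jj; split=> //.
by move: wE; rewrite -jj dist_endK.
Qed.

Lemma third_valid si : valid (inl si, llen (inl si) / 3).
Proof. by rewrite /valid (ok_leg M) /=; have := leg_len_gt0 M si; lra. Qed.

Lemma third_itv si : 0 < llen (inl si) / 3 < llen (inl si).
Proof. by have := leg_len_gt0 M si; lra. Qed.

Lemma thirds_uniq : uniq thirds.
Proof.
rewrite map_inj_in_uniq ?enum_uniq// => si si' _ _ E.
by have [[]] := label_place_inj M (ok_leg M si) (third_itv si) (third_valid si') E.
Qed.

Lemma star_ray_thirds s j w : 0 <= w -> 3 * w < star_len s j -> star_ray s j w \notin thirds.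
Proof.
move=> w0 wl; apply/mapP => -[si _]; have [->|wN] := eqVneq w 0.
  rewrite star_ray0; apply/nesym/dart_path_vpoint.
  by have := third_itv si; rewrite /label_len (ok_leg M).
have wp : 0 < w by rewrite lt0r wN.
move=> E; have [ll wE] := star_ray_place (third_valid si) wp wl E.
move: wl wE; rewrite /star_len /star_end ll /dist_end /=; have := leg_len_gt0 M si; lra.
Qed.

(** The first two thirds of the leg contain no other flex: those of the tripod lie within a third of
    the leg from its opposite end. *)
Lemma third_isolated q : q \in thirds ->
  exists U : set Gamma, [/\ open U, U q & forall p, U p -> flex p -> p = q].
Proof.
move=> /mapP[si _ ->].
have L0 := leg_len_gt0 M si.
have LE : llen (inl si) = len (D (inl si)).1 by rewrite /label_len (ok_leg M).
exists (dart_path (D (inl si)) @` [set x | 0 < x < llen (inl si) * (2 / 3)]); split.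
- by apply: open_dart_arc; rewrite // -LE; lra.
- by exists (llen (inl si) / 3) => //=; lra.
move=> _ [x /= xl <-] /(flex_unbalanced M unbalanced).
have xv : valid (inl si, x) by rewrite /valid (ok_leg M) /=; lra.
case=> [/mapP[si' _ E]|[s [j [w [w0 E sf]]]]].
  have xi : 0 < x < llen (inl si) by lra.
  have [[siE] xE] := label_place_inj M (ok_leg M si) xi (third_valid si') E.
  by rewrite E siE.
have wl := star_flex_itv w0 sf; have [w00|wN] := eqVneq w 0.
  move: E; rewrite w00 star_ray0 => /dart_path_vpoint[]; rewrite -LE; lra.
have wp : 0 < w by rewrite lt0r wN.
have [/= ll wE] := star_ray_place xv wp wl (esym E).
exfalso; move: wl wE; rewrite /star_len /star_end ll /dist_end /=.
by lra.
Qed.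

(** Two tripods of weight 2 and four thirds of weight 1 make 8. *)
Lemma nonhyperelliptic_unbalanced : nonhyperelliptic_facts Gamma.
Proof.
split; first exact: not_branch_unbalanced.
apply: (@assemble_stars R Gamma bool star_len star_ray thirds) => //.
- exact: (star_len_gt0 M unbalanced).
- exact: (flex_unbalanced M unbalanced).
- exact: (hyperflex_unbalanced M unbalanced).
- by move=> s j j'; rewrite !star_ray0.
- by move=> s j; rewrite (funext (star_ray_path s j)); exact: dart_path_continuous.
- exact: star_ray_inj.
- move=> s j; rewrite (funext (star_ray_path s j)); apply: open_dart_arc; rewrite ?lexx//.
  have := star_len_le D ok s j; have := star_len_gt0 M unbalanced s j.
  by rewrite edge_at /label_len (star_ok M unbalanced); lra.
- exact: thirds_uniq.
- exact: star_ray_thirds.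
- exact: third_isolated.
- by rewrite size_map -cardE card_prod !card_bool.
Qed.

End UnbalancedFacts.

(** * Equal connectors: the hyperelliptic case *)

Section BalancedFacts.
Context {R : realType} {Gamma : tropical_curve R}.
Local Notation V := (vertex Gamma).
Variables (D : label -> edge Gamma * bool) (ok : pred label) (v : bool * bool -> V).
Hypothesis M : model D ok v.
Local Notation llen := (label_len D ok).
Local Notation place := (label_place D).
Local Notation valid := (valid D ok).
Implicit Types (p q : Gamma) (s i t : bool) (w x u : R).
Hypothesis balanced : llen (inr false) = llen (inr true).

Definition middles : seq Gamma :=
  [seq place (inl si, llen (inl si) / 2) | si <- enum ((bool * bool)%type : finType)].

Definition middle_third (c : label * R) : Prop :=
  exists2 si, c.1 = inl si & llen (inl si) <= 3 * c.2 <= 2 * llen (inl si).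

Lemma leg_valid si u : 0 <= u <= llen (inl si) -> valid (inl si, u).
Proof. by rewrite /valid (ok_leg M). Qed.

(** A tripod would need connectors of different lengths, so the potential is level on each side and
    [flat_triple] applies. *)
Lemma triple_middle (c c' : label * R) : valid c -> valid c' ->
  canonical_equiv (map place [:: c; c; c; c']) -> middle_third c /\
  (c = c' -> exists2 si, c.1 = inl si & 2 * c.2 = llen (inl si)).
Proof.
move=> c_ok c'_ok; have l_ok : all valid [:: c; c; c; c'] by rewrite /= c_ok c'_ok.
move=> /(raw_canonical M l_ok)[F [ o [l_on rs]]].
case: (tripod_or_flat F) => [[s [t lt]]|flat].
  have [h h0 [_ XE _ _]] := raw_tripod (leg_len_gt0 M) (connector_len_ge0 D ok) l_on rs lt.
  exfalso; have := total_dist_ge0 (inr t) s l_on.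
  by case: t {lt} XE => /=; move: balanced; lra.
have k3 : 3 <= label_chips [:: c; c; c; c'] c.1 by rewrite !chipsE eqxx; case: (_ == _).
move: c c_ok c'_ok l_ok l_on rs k3 => [lab u] /andP[/= _ u_in] c'_ok l_ok l_on rs k3.
case: lab u_in l_ok l_on rs k3 => [[s i]|t] u_in l_ok l_on rs k3; last first.
  by have := flat_connector_chips (leg_len_gt0 M) l_on rs flat t; lia.
have c'_in e : c'.1 = inl (s, i) -> 0 <= dist_end llen (inl (s, i)) e c'.2 <= llen (inl (s, i)).
  case: c' c'_ok {l_ok l_on rs k3} => lab' u' /andP[_ /=] + E; rewrite E /dist_end.
  by case: e; lra.
have := flat_triple (leg_len_gt0 M) (connector_len_ge0 D ok) l_on rs flat k3.
rewrite !chipsE eqxx.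
have third e : (c'.1 == inl (s, i)) = false -> 3 * dist_end llen (inl (s, i)) e u = llen (inl (s, i)) ->
    middle_third (inl (s, i), u) /\ ((inl (s, i), u) = c' ->
      exists2 si, inl (s, i) = inl si :> label & 2 * u = llen (inl si)).
  move=> c'N H; split=> [|E]; last by rewrite -E eqxx in c'N.
  by exists (s, i) => //=; move: H; rewrite /dist_end; case: e; lra.
case=> [[t [kE dE _]]|[_ [[kE dE]|[kE [t dE]]]]].
- have c'N : (c'.1 == inl (s, i)) = false by case: eqP kE.
  by move: dE; rewrite !total_distE eqxx c'N !mulr1n mulr0n => dE; apply: (third t) => //; lra.
- have c'E : c'.1 = inl (s, i) by apply/eqP; case: eqP kE.
  move: dE; rewrite !total_distE c'E eqxx !mulr1n; have := c'_in false c'E; rewrite /dist_end /= => u'_in dE.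
  split=> [|E]; exists (s, i) => //=; first by lra.
  by move: dE; rewrite -E /=; lra.
- have c'N : (c'.1 == inl (s, i)) = false by case: eqP kE.
  by move: dE; rewrite !total_distE eqxx c'N !mulr1n mulr0n => dE; apply: (third t) => //; lra.
Qed.

Lemma pairs_canonical l (n : bool * bool -> int) (k : int) (N : bool -> R) : all valid l ->
  (forall si, label_chips l (inl si) = n si + n si) ->
  (forall si e, total_dist llen l (inl si) e = (n si)%:~R * llen (inl si)) ->
  (forall t, label_chips l (inr t) = k) ->
  (forall t s, total_dist llen l (inr t) s = N s) ->
  n (false, false) + n (false, true) + n (true, false) + n (true, true) + k = 2 ->
  canonical_equiv (map place l).
Proof. by move=> l_ok *; apply/(label_equiv M l_ok)/(@raw_pairs _ llen l n k N). Qed.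

(** The mean of the four chips is the midpoint of the leg, and the bounds on [u] keep the fourth
    chip on the leg. *)
Lemma middle_flex si u : llen (inl si) <= 3 * u <= 2 * llen (inl si) ->
  canonical_equiv (map place [:: (inl si, u); (inl si, u); (inl si, u);
    (inl si, 2 * llen (inl si) - 3 * u)]).
Proof.
move=> u_in; have L0 := leg_len_gt0 M si.
apply: (@pairs_canonical _ (fun a => (a == si)%:Z + (a == si)%:Z) 0 (fun=> 0)).
- by rewrite /= !leg_valid //; lra.
- by move=> a; rewrite !chipsE (inj_eq inl_inj) [_ == a]eq_sym; case: (a == si).
- move=> a e; rewrite !total_distE (inj_eq inl_inj) [_ == a]eq_sym /=.
  by case: eqP => [->|_]; rewrite intrD ?mulr1n ?mulr0n /dist_end /= ?mulr1z ?mulr0z; case: e; lra.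
- by move=> t; rewrite !chipsE.
- by move=> t s; rewrite !total_distE !mulr0n !addr0.
- by case: (si) => -[] [].
Qed.

(** [z'] is the image of [z] under the involution that reverses every leg and exchanges the two
    connectors. *)
Lemma middle_branch si z : exists z', canonical_equiv
  [:: place (inl si, llen (inl si) / 2); place (inl si, llen (inl si) / 2); z; z'].
Proof.
have [[lab u] [c_ok <-]] := label_placeP M z; have L0 := leg_len_gt0 M si.
set c := (inl si : label, llen (inl si) / 2).
have m_ok : valid c by rewrite leg_valid//; lra.
case: lab c_ok => [si'|t] c_ok.
  exists (place (inl si', llen (inl si') - u)).
  apply: (@pairs_canonical [:: c; c; (inl si', u); (inl si', llen (inl si') - u)]
    (fun a => (a == si)%:Z + (a == si')%:Z) 0 (fun=> 0)).
  - by rewrite /= c_ok m_ok leg_valid//; move: c_ok => /andP[_] /=; lra.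
  - move=> a; rewrite !chipsE !(inj_eq inl_inj) ![_ == a]eq_sym.
    by case: (a == si); case: (a == si').
  - move=> a e; rewrite !total_distE !(inj_eq inl_inj) ![_ == a]eq_sym /=.
    by case: eqP => [->|_]; case: eqP => [->|_];
      rewrite intrD ?mulr1n ?mulr0n /dist_end /= ?mulr1z ?mulr0z; case: e; lra.
  - by move=> t; rewrite !chipsE.
  - by move=> t s; rewrite !total_distE !mulr0n !addr0.
  - by case: (si) => -[] []; case: (si') => -[] [].
have XE t' : llen (inr t') = llen (inr true) by case: t'.
have oN : ok (inr (~~ t)).
  have : 0 < llen (inr t) by rewrite /label_len; case/andP: c_ok => -> _; exact: len_gt0.
  by rewrite XE -(XE (~~ t)) {1}/label_len; case: ifP; rewrite ?ltxx.
exists (place (inr (~~ t), u)).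
apply: (@pairs_canonical [:: c; c; (inr t, u); (inr (~~ t), u)]
  (fun a => (a == si)%:Z) 1 (fun s => dist_end llen (inr true) s u)).
- by rewrite /= m_ok c_ok /= andbT; move: c_ok; rewrite /valid /= !XE oN => /andP[_ ->].
- by move=> a; rewrite !chipsE !(inj_eq inl_inj) [_ == a]eq_sym; case: (a == si).
- move=> a e; rewrite !total_distE !(inj_eq inl_inj) [_ == a]eq_sym /=.
  by case: eqP => [->|_]; rewrite ?mulr1n ?mulr0n /dist_end /= ?mulr1z ?mulr0z; case: e; lra.
- by move=> t'; rewrite !chipsE; case: (t); case: t'.
- move=> t' s; rewrite !total_distE /dist_end XE; case: (t); case: t'; rewrite !eqE /= ?mulr1n ?mulr0n ?addr0 ?add0r //; lra.
- by case: (si) => -[] [].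
Qed.

(** The flexes are the middle thirds of the legs, segments that link each of them to a midpoint. *)
Lemma hyperelliptic_balanced : hyperelliptic_facts Gamma.
Proof.
have half_itv si : 0 < llen (inl si) / 2 < llen (inl si).
  by have := leg_len_gt0 M si; lra.
have half_valid si : valid (inl si, llen (inl si) / 2).
  by apply: leg_valid; have := leg_len_gt0 M si; lra.
have middleP p : p \in middles <-> exists si, p = place (inl si, llen (inl si) / 2).
  split=> [/mapP[si _ ->]|[si ->]]; first by exists si.
  by apply: map_f; rewrite mem_enum.
exists middles; split.
- rewrite map_inj_in_uniq ?enum_uniq// => si si' _ _ E.
  by have [[]] := label_place_inj M (ok_leg M si) (half_itv si) (half_valid si') E.
- by rewrite size_map -cardE card_prod !card_bool.
- by move=> p /middleP[si ->] z; exact: middle_branch.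
- move=> p; split=> [|/middleP[si ->]]; last first.
    have := @middle_flex si (llen (inl si) / 2).
    have -> : 2 * llen (inl si) - 3 * (llen (inl si) / 2) = llen (inl si) / 2 by lra.
    by apply; have := leg_len_gt0 M si; lra.
  have [[lab u] [c_ok <-]] := label_placeP M p.
  move=> /(triple_middle (c := (lab, u)) (c' := (lab, u)) c_ok c_ok)[_ /(_ erefl)[si /= -> uE]].
  by apply/middleP; exists si; congr (place (_, _)); lra.
- move=> p [q]; have [[lab u] [c_ok <-]] := label_placeP M p.
  have [c' [c'_ok <-]] := label_placeP M q.
  move=> /(triple_middle (c := (lab, u)) c_ok c'_ok)[[si /= -> u_in] _].
  exists (place (inl si, llen (inl si) / 2)); first by apply/middleP; exists si.
  have L0 := leg_len_gt0 M si.
  exists (dart_path (D (inl si)) @` `[llen (inl si) / 3, llen (inl si) * (2 / 3)]); split.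
  + apply: connected_continuous_connected; first exact/connected_intervalP/interval_is_interval.
    by apply: continuous_subspaceT; exact: dart_path_continuous.
  + by exists u => //=; rewrite in_itv /=; lra.
  + by exists (llen (inl si) / 2) => //=; rewrite in_itv /=; lra.
  + move=> _ [x /= + <-]; rewrite in_itv /= => x_in.
    exists (place (inl si, 2 * llen (inl si) - 3 * x)); apply: (@middle_flex si x); lra.
Qed.

End BalancedFacts.

Section FlipModel.
Context {R : realType} {Gamma : tropical_curve R}.
Variables (D : label -> edge Gamma * bool) (ok : pred label) (v : bool * bool -> vertex Gamma).
Hypothesis M : model D ok v.

Let D' (lab : label) := match lab with
  | inl si => reverse (D (inl si)) | inr t => D (inr (~~ t)) end.
Let ok' (lab : label) := if lab is inr t then ok (inr (~~ t)) else true.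
Let v' (st : bool * bool) := v (st.1, ~~ st.2).

(** Reversing the legs exchanges the roles of the two connectors, so either one may be taken as the
    longer. *)
Lemma flip_model : model D' ok' v'.
Proof.
have okl := ok_leg M; split=> //.
- case=> [[s i]|t] /=; first by rewrite endpoint_reverse (other_D M).
  exact: endpoint_D M _.
- case=> [[s i]|t] /=; first by rewrite other_reverse (endpoint_D M).
  exact: other_D M _.
- move=> [si|t] [si'|t'] /= o1 o2 E.
  + by have [->] := D_inj M (okl _) (okl _) E.
  + by have := D_inj M (okl _) o2 E.
  + by have := D_inj M o1 (okl _) E.
  + by have [/negb_inj ->] := D_inj M o1 o2 E.
- move=> e; have [[si|t] o E] := D_onto M e; first by exists (inl si).
  by exists (inr (~~ t)); rewrite /= negbK.
- move=> [s t] [s' t'] /(v_eqP M) /= [[-> /negb_inj->]|[/negb_inj-> n]]; [by left|by right].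
- by move=> s t /= no; rewrite /v' /= (v_glue M).
Qed.

End FlipModel.

Lemma model_classified (R : realType) (Gamma : tropical_curve R)
  (D : label -> edge Gamma * bool) (ok : pred label) (v : bool * bool -> vertex Gamma) :
  model D ok v -> classified Gamma.
Proof.
move=> M; have [lt|gt|eq] := ltgtP (label_len D ok (inr false)) (label_len D ok (inr true)).
- by left; exact: nonhyperelliptic_unbalanced M lt.
- by left; exact: nonhyperelliptic_unbalanced (flip_model M) gt.
- by right; exact: hyperelliptic_balanced M eq.
Qed.

(** * Recognizing the models by multiplicities of edges *)

Section MakeModel.
Context {R : realType} {Gamma : tropical_curve R}.
Local Notation V := (vertex Gamma).
Implicit Types (u w : V).

Definition darts u w : {set edge Gamma * bool} :=
  [set nu | (endpoint nu == u) && (other nu == w)]%SET.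

Variables (b : pred bool) (v : bool * bool -> V).
Hypothesis v_eqE : forall st st',
  (v st == v st') = (st == st') || (st.2 == st'.2) && ~~ b st.2.

Let ok (lab : label) := if lab is inr t then b t else true.

(** The rank of a leg among the edges parallel to it. With both connectors missing the two sides
    join the same vertices, and side [true] takes the third and fourth edge. *)
Let place_of (s i : bool) : nat := i + (if b false || b true then 0 else s.*2)%N.

Hypothesis legs : forall s, (place_of s true < #|darts (v (s, false)) (v (s, true))|)%N.
Hypothesis connectors : forall t, b t -> (0 < #|darts (v (false, t)) (v (true, t))|)%N.
Hypothesis card_edges : #|edge Gamma| = (4 + b false + b true)%N.

(** Distinct labels get distinct edges, and by [card_edges] there are as many labels as edges, so no
    edge is left out. *)
Lemma make_model : exists D, model D ok v.
Proof.
have [nu0 _] : exists nu : edge Gamma * bool, true.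
  by have /card_gt0P[e _] := edge_inhabited Gamma; exists (e, false).
pose D (lab : label) := match lab with
  | inl (s, i) => nth nu0 (enum (darts (v (s, false)) (v (s, true)))) (place_of s i)
  | inr t => nth nu0 (enum (darts (v (false, t)) (v (true, t)))) 0 end.
have place_lt s i : (place_of s i < size (enum (darts (v (s, false)) (v (s, true)))))%N.
  by rewrite -cardE; apply: leq_ltn_trans (legs s); case: i; rewrite /place_of.
have D_mem lab : ok lab -> D lab \in darts (v (end_of lab false)) (v (end_of lab true)).
  by case: lab => [[s i] _|t bt]; rewrite -mem_enum mem_nth// -cardE connectors.
have D_ends lab : ok lab -> endpoint (D lab) = v (end_of lab false) /\
    other (D lab) = v (end_of lab true).
  by move=> /D_mem; rewrite inE => /andP[/eqP-> /eqP->].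
have D_leg s i s' i' : D (inl (s, i)) = D (inl (s', i')) -> (s, i) = (s', i').
  move=> E; have [e1 e2] := D_ends (inl (s, i)) isT; have [e1' e2'] := D_ends (inl (s', i')) isT.
  have v1 : v (s, false) = v (s', false) by rewrite -[LHS]e1 -[RHS]e1' E.
  have v2 : v (s, true) = v (s', true) by rewrite -[LHS]e2 -[RHS]e2' E.
  move: E; rewrite /D v1 v2 => /eqP; rewrite nth_uniq ?enum_uniq ?place_lt //; last first.
    by rewrite -v1 -v2 place_lt.
  clear e1 e2 e1' e2'; move: v1 v2 => /eqP + /eqP; rewrite !v_eqE /place_of.
  by case: (b false); case: (b true); case: s; case: s'; case: i; case: i'.
have D_inj lab lab' : ok lab -> ok lab' -> (D lab).1 = (D lab').1 -> lab = lab'.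
  move=> o o' /same_edge E; have [e1 e2] := D_ends lab o; have [e1' e2'] := D_ends lab' o'.
  have {E}[[/eqP v1 /eqP v2 E]|[/eqP v1 /eqP v2]] :
      [/\ v (end_of lab false) = v (end_of lab' false),
          v (end_of lab true) = v (end_of lab' true) & D lab = D lab'] \/
      (v (end_of lab false) = v (end_of lab' true) /\
       v (end_of lab true) = v (end_of lab' false)).
    by rewrite -e1 -e2 -e1' -e2'; case: E => ->; [left|right; rewrite other_reverse].
  - clear e1 e2 e1' e2'; case: lab lab' o o' v1 v2 E => [[s i]|t] [[s' i']|t'] /= o o';
      rewrite !v_eqE; first by move=> _ _ /D_leg ->.
    + by case: t' o'; case: s => /= bt; rewrite ?bt.
    + by case: t o; case: s' => /= bt; rewrite ?bt.
    + by case: t o; case: t' o'.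
  - clear e1 e2 e1' e2'; case: lab lab' o o' v1 v2 => [[s i]|t] [[s' i']|t'] /= o o'; rewrite !v_eqE.
    + by case: s; case: s'.
    + by case: t' o'; case: s => /= bt; rewrite ?bt.
    + by case: t o; case: s' => /= bt; rewrite ?bt.
    + by case: t o; case: t' o' => /= bt; rewrite ?bt.
exists D; split=> //.
- by move=> lab /D_ends[].
- by move=> lab /D_ends[].
- move=> e; have imE : [set (D lab).1 | lab in [set lab | ok lab]]%SET = [set: edge Gamma]%SET.
    apply/eqP; rewrite eqEcard finset.subsetT cardsT card_edges card_in_imset.
      rewrite -sum1dep_card big_mkcond big_sumType /= sum1_card card_prod card_bool big_bool /=.
      by case: (b false); case: (b true).
    by move=> lab lab'; rewrite !inE; exact: D_inj.
  have : e \in [set: edge Gamma]%SET by rewrite inE.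
  by rewrite -imE => /imsetP[lab]; rewrite inE => o ->; exists lab.
- move=> st st' /eqP; rewrite v_eqE => /orP[/eqP->|/andP[/eqP-> n]]; [by left|by right].
- by move=> s t n; apply/eqP; rewrite v_eqE /= n eqxx orbT.
Qed.

End MakeModel.

(** Trivalence makes opposite pairs equally multiple, so three multiplicities add up to 3.
    Connectedness excludes 3,0,0; the case 1,1,1 is the complete graph, and the six orders of 2,1,0
    are the others. *)
Lemma cubic_multiplicities (ab ac ad bc bd cd : nat) :
  (ab + ac + ad = 3 -> ab + bc + bd = 3 -> ac + bc + cd = 3 -> ad + bd + cd = 3 ->
  0 < ac + ad + bc + bd -> 0 < ab + ad + bc + cd -> 0 < ab + ac + bd + cd ->
  [/\ 0 < ab, 0 < ac & 0 < ad] /\ [/\ 0 < bc, 0 < bd & 0 < cd] \/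
  [\/ [/\ 1 < ab, 1 < cd, 0 < ac & 0 < bd], [/\ 1 < ab, 1 < cd, 0 < ad & 0 < bc] |
   [\/ [/\ 1 < ac, 1 < bd, 0 < ab & 0 < cd], [/\ 1 < ac, 1 < bd, 0 < ad & 0 < bc] |
    [/\ 1 < ad, 1 < bc, 0 < ab & 0 < cd] \/ [/\ 1 < ad, 1 < bc, 0 < ac & 0 < bd]]])%N.
Proof.
move=> e1 e2 e3 e4 c1 c2 c3.
have [E1 E2 E3] : [/\ cd = ab, bd = ac & bc = ad] by split; lia.
subst cd bd bc; clear e2 e3 e4.
case: ab ac ad e1 c1 c2 c3 => [|[|[|[|ab]]]] [|[|[|[|ac]]]] [|[|[|[|ad]]]] //= e1 c1 c2 c3; try lia;
  by [left|right; constructor 1|right; constructor 2|right; constructor 3; constructor 1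
     |right; constructor 3; constructor 2|right; constructor 3; constructor 3; left
     |right; constructor 3; constructor 3; right].
Qed.

(** * Classification of the graphs *)

Section Classification.
Context {R : realType} (Gamma : tropical_curve R).
Local Notation V := (vertex Gamma).
Implicit Types (u w x y z t a b c d : V).
Hypothesis Gamma_good : good_curve Gamma.
Hypothesis valence_ge3 : forall v : V, (3 <= valence (vpoint v))%N.

Definition multiplicity u w := #|darts u w|.
Local Notation m := multiplicity.

Lemma multiplicityC u w : m u w = m w u.
Proof.
rewrite /m -(card_imset _ (inv_inj reverseK)); apply: eq_card => nu; rewrite !inE.
apply/imsetP/andP => [[mu + ->]|[/eqP nu1 /eqP nu2]].
  by rewrite inE => /andP[/eqP<- /eqP<-]; rewrite endpoint_reverse other_reverse.
by exists (reverse nu); rewrite ?reverseK// inE endpoint_reverse other_reverse nu1 nu2 !eqxx.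
Qed.

Lemma multiplicity_id u : m u u = 0%N.
Proof.
have [lp _ _] := Gamma_good; apply/eqP; rewrite cards_eq0 -finset.subset0.
apply/fintype.subsetP => nu; rewrite !inE => /andP[/eqP nu1 /eqP nu2].
by have := endpoint_other lp nu; rewrite nu1 nu2 eqxx.
Qed.

Lemma valence_sum u : valence (vpoint u) = (\sum_w m u w)%N.
Proof.
rewrite /valence -sum1_card (partition_big (@other R Gamma) xpredT)//=.
apply: eq_bigr => w _; rewrite /m -sum1_card; apply: eq_bigl => nu.
by rewrite mem_tangent inE.
Qed.

Lemma handshake : (\sum_(u : V) valence (vpoint u) = (#|edge Gamma|).*2)%N.
Proof.
rewrite -muln2 -[2%N]card_bool -card_prod -sum1_card (partition_big (@endpoint R Gamma) xpredT)//=.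
apply: eq_bigr => u _; rewrite /valence -sum1_card; apply: eq_bigl => nu.
by rewrite mem_tangent.
Qed.

Lemma cut_multiplicity (S : {set V}) a d : a \in S -> d \notin S ->
  exists u w, [/\ u \in S, w \notin S & (0 < m u w)%N].
Proof.
move=> aS dS; apply: contrapT => no; move: dS.
have := graph_connected a d; rewrite -/(adjacent _ _) => /connectP[p].
elim: p a aS => [|w p IH] a aS /=; first by move=> _ ->; rewrite aS.
move=> /andP[aw wp] dE; apply: IH wp dE; apply: contrapT => /negP wS; apply: no.
exists a, w; split=> //; rewrite /multiplicity; apply/card_gt0P.
have /adjacentP[e [[e1 e2]|[e1 e2]]] := aw; [exists (e, false)|exists (e, true)];
  by rewrite inE /other /endpoint /= e1 e2 !eqxx.
Qed.

(** The legs join [a] to [b] and [c] to [d]; the connectors join [a] to [c] and [b] to [d]. With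
    three or two vertices one or both connectors are contracted. *)
Lemma classified4 a b c d : uniq [:: a; b; c; d] -> #|V| = 4%N ->
  (2 <= m a b)%N -> (2 <= m c d)%N -> (1 <= m a c)%N -> (1 <= m b d)%N -> classified Gamma.
Proof.
move=> un V4 ab cd ac bd; have [_ _ euler] := Gamma_good.
pose v (st : bool * bool) := if st.1 then (if st.2 then d else c) else (if st.2 then b else a).
have [|s|t _||D M] := @make_model R Gamma xpredT v; last exact: model_classified M.
- move: un; rewrite /= !inE !negb_or !andbT => /andP[/and3P[n1 n2 n3] /andP[/andP[n4 n5] n6]].
  by move=> [[] []] [[] []]; rewrite /v /= ?eqxx // ?(negbTE n1) ?(negbTE n2) ?(negbTE n3)
    ?(negbTE n4) ?(negbTE n5) ?(negbTE n6) // eq_sym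
    ?(negbTE n1) ?(negbTE n2) ?(negbTE n3) ?(negbTE n4) ?(negbTE n5) ?(negbTE n6).
- by rewrite addn0; case: s.
- by case: t.
- by move: euler; rewrite V4 /=; lia.
Qed.

Lemma classified3 a b c : uniq [:: a; b; c] -> #|V| = 3%N ->
  (2 <= m a b)%N -> (2 <= m a c)%N -> (1 <= m b c)%N -> classified Gamma.
Proof.
move=> un V3 ab ac bc; have [_ _ euler] := Gamma_good.
pose v (st : bool * bool) := if st.2 then (if st.1 then c else b) else a.
have [|s|t bt||D M] := @make_model R Gamma id v; last exact: model_classified M.
- move: un; rewrite /= !inE !negb_or !andbT => /andP[/andP[n1 n2] n3].
  by move=> [[] []] [[] []]; rewrite /v /= ?eqxx // ?(negbTE n1) ?(negbTE n2) ?(negbTE n3) // eq_sym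
    ?(negbTE n1) ?(negbTE n2) ?(negbTE n3).
- by rewrite addn0; case: s.
- by case: t bt.
- by move: euler; rewrite V3 /=; lia.
Qed.

Lemma classified2 a b : a != b -> #|V| = 2%N -> (4 <= m a b)%N -> classified Gamma.
Proof.
move=> n V2 ab; have [_ _ euler] := Gamma_good.
pose v (st : bool * bool) := if st.2 then b else a.
have [|s|//||D M] := @make_model R Gamma xpred0 v; last exact: model_classified M.
- by move=> [[] []] [[] []]; rewrite /v /= ?eqxx // ?(negbTE n) // eq_sym (negbTE n).
- by apply: leq_trans ab; case: s.
- by move: euler; rewrite V2 /=; lia.
Qed.

Lemma complete_classified : #|V| = 4%N -> (forall v : V, valence (vpoint v) = 3%N) ->
  (forall u w, u != w -> (0 < m u w)%N) -> classified Gamma.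
Proof.
have [lp _ _] := Gamma_good => V4 val3 m1; left.
have [nu0 _] : exists nu : edge Gamma * bool, true.
  by have /card_gt0P[e _] := edge_inhabited Gamma; exists (e, false).
pose d u w := nth nu0 (enum (darts u w)) 0.
apply: (@nonhyperellipticK4 R Gamma lp V4 val3 d) => u w /m1 uw.
have : d u w \in darts u w by rewrite -mem_enum mem_nth// -cardE.
by rewrite inE => /andP[/eqP-> /eqP->].
Qed.

Lemma separated x y z t : [&& z != x, z != y, t != x & t != y] ->
  (forall w, [\/ w = x, w = y, w = z | w = t]) -> (0 < m x z + m x t + m y z + m y t)%N.
Proof.
move=> /and4P[zx zy tx ty] all_w.
have [||u [w [+ + uw]]] := @cut_multiplicity [set x; y]%SET x z.
- by rewrite !inE eqxx.
- by rewrite !inE negb_or zx zy.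
rewrite !addn_gt0 !inE => /orP[] /eqP uE; case: (all_w w) => wE; move: uw;
  by rewrite uE wE ?eqxx ?orbT // => ->; rewrite ?orbT.
Qed.

(** Valences at least 3 and Euler's relation give at most four vertices, and the absence of loops at
    least two. The sums of multiplicities at each vertex then determine the graph up to renaming. *)
Lemma all_classified : classified Gamma.
Proof.
have [lp _ euler] := Gamma_good.
have hs := handshake.
have V_ge2 : (2 <= #|V|)%N.
  have /card_gt0P[e _] := edge_inhabited Gamma.
  apply/card_gt1P; exists (endpoint (e, false)), (other (e, false)); split=> //.
  exact: endpoint_other.
have V_le4 : (#|V| <= 4)%N.
  have : (3 * #|V| <= (#|edge Gamma|).*2)%N.
    by rewrite -hs mulnC -sum_nat_const; apply: leq_sum => u _.
  by move: euler; lia.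
have [s sV] : exists s, s = enum V by exists (enum V).
have sumV (f : V -> nat) : (\sum_u f u = \sum_(u <- s) f u)%N by rewrite sV big_enum.
have un : uniq s by rewrite sV enum_uniq.
have cV : #|V| = size s by rewrite sV cardE.
have ms := multiplicityC; have m0 := multiplicity_id.
have vs u : valence (vpoint u) = (\sum_(w <- s) m u w)%N by rewrite valence_sum sumV.
move: hs V_ge2 V_le4 euler; rewrite sumV cV.
case: s sV un cV sumV vs => [|a [|b [|c [|d [|? ?]]]]] //= sV un cV sumV vs; rewrite !big_cons !big_nil.
- have n : a != b by move: un; rewrite inE andbT.
  have := vs a; have := vs b; rewrite !big_cons !big_nil !m0 (ms b a).
  by move=> vb va hs _ _ euler; apply: (@classified2 a b) => //; lia.
- have := vs a; have := vs b; have := vs c; rewrite !big_cons !big_nil !m0 (ms b a) (ms c a) (ms c b).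
  have := valence_ge3 a; have := valence_ge3 b; have := valence_ge3 c.
  move=> ga gb gc vc vb va hs _ _ euler.
  have [[? [? ?]]|[[? [? ?]]|[? [? ?]]]] : (2 <= m a b /\ 2 <= m a c /\ 1 <= m b c)%N \/
    (2 <= m b a /\ 2 <= m b c /\ 1 <= m a c)%N \/ (2 <= m c a /\ 2 <= m c b /\ 1 <= m a b)%N.
    by rewrite (ms b a) (ms c a) (ms c b); lia.
  + exact: (@classified3 a b c).
  + by apply: (@classified3 b a c) => //=; move: un; rewrite !inE !negb_or !andbT (eq_sym b a)
      => /andP[/andP[-> ->] ->].
  + apply: (@classified3 c a b) => //=; move: un; rewrite !inE !negb_or !andbT.
    by rewrite (eq_sym c a) (eq_sym c b) => /andP[/andP[-> ->] ->].
- have := vs a; have := vs b; have := vs c; have := vs d.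
  rewrite !big_cons !big_nil !m0 (ms b a) (ms c a) (ms c b) (ms d a) (ms d b) (ms d c).
  have := valence_ge3 a; have := valence_ge3 b; have := valence_ge3 c; have := valence_ge3 d.
  move=> gd gc gb ga vd vc vb va hs _ _ euler.
  have [[va3 vb3] [vc3 vd3]] : (valence (vpoint a) = 3%N /\ valence (vpoint b) = 3%N) /\
      (valence (vpoint c) = 3%N /\ valence (vpoint d) = 3%N) by lia.
  have s_all w : [\/ w = a, w = b, w = c | w = d].
    have : w \in [:: a; b; c; d] by rewrite sV mem_enum.
    by rewrite !inE => /or4P[] /eqP->; [constructor 1|constructor 2|constructor 3|constructor 4].
  move: un; rewrite !inE !negb_or !andbT => /andP[/and3P[ab ac ad] /andP[/andP[bc bd] cd]].
  have nE := (negbTE ab, negbTE ac, negbTE ad, negbTE bc, negbTE bd, negbTE cd).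
  have nE' : [/\ (b == a) = false, (c == a) = false & (d == a) = false] /\
      [/\ (c == b) = false, (d == b) = false & (d == c) = false].
    by split; split; rewrite eq_sym; exact: negbTE.
  have [[ba ca da] [cb db dc]] := nE'; have nnE := (nE, (ba, ca, da, cb, db, dc)).
  have uniqE w x y z : [&& w != x, w != y, w != z, x != y, x != z & y != z] -> uniq [:: w; x; y; z].
    by move=> /and5P[h1 h2 h3 h4 /andP[h5 h6]]; rewrite /= !inE !negb_or h1 h2 h3 h4 h5 h6.
  have perm2 w : [\/ w = a, w = c, w = b | w = d].
    by case: (s_all w); [constructor 1|constructor 3|constructor 2|constructor 4].
  have perm3 w : [\/ w = a, w = d, w = b | w = c].
    by case: (s_all w); [constructor 1|constructor 3|constructor 4|constructor 2].
  have c1 : (0 < m a c + m a d + m b c + m b d)%N.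
    by apply: separated => //; rewrite !nnE.
  have c2 : (0 < m a b + m a d + m b c + m c d)%N.
    by rewrite (ms b c); apply: separated => //; rewrite !nnE.
  have c3 : (0 < m a b + m a c + m b d + m c d)%N.
    by rewrite (ms b d) (ms c d); apply: separated => //; rewrite !nnE.
  have e1 : (m a b + m a c + m a d = 3)%N by rewrite -va3 va !(addn0, add0n, addnA).
  have e2 : (m a b + m b c + m b d = 3)%N by rewrite -vb3 vb !(addn0, add0n, addnA).
  have e3 : (m a c + m b c + m c d = 3)%N by rewrite -vc3 vc !(addn0, add0n, addnA).
  have e4 : (m a d + m b d + m c d = 3)%N by rewrite -vd3 vd !(addn0, add0n, addnA).
  case: (cubic_multiplicities e1 e2 e3 e4 c1 c2 c3).
    move=> [[ab1 ac1 ad1] [bc1 bd1 cd1]].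
    apply: complete_classified => [|w|u w]; first by rewrite cV.
      by case: (s_all w) => ->.
    by case: (s_all u) => ->; case: (s_all w) => ->; rewrite ?eqxx // => _; rewrite // ms.
  case=> [[ab2 cd2 ac1 bd1]|[ab2 cd2 ad1 bc1]|].
  + by apply: (@classified4 a b c d) => //; rewrite ?uniqE ?nnE.
  + by apply: (@classified4 a b d c) => //; rewrite ?uniqE ?nnE // ms.
  case=> [[ac2 bd2 ab1 cd1]|[ac2 bd2 ad1 bc1]|].
  + by apply: (@classified4 a c b d) => //; rewrite ?uniqE ?nnE.
  + by apply: (@classified4 a c d b) => //; rewrite ?uniqE ?nnE // ms.
  case=> [[ad2 bc2 ab1 cd1]|[ad2 bc2 ac1 bd1]].
  + by apply: (@classified4 a d b c) => //; rewrite ?uniqE ?nnE // ms.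
  + by apply: (@classified4 a d c b) => //; rewrite ?uniqE ?nnE // ms.
Qed.

End Classification.

Theorem theorem1p8 (R : realType) (Gamma : tropical_curve R)
  (Hbridgeless : bridgeless Gamma)
  (Hgenus : genus Gamma = 3%N)
  (Hcut : forall v : Gamma, ~ cut_vertex v) :
  (forall B : set Gamma, maximal_weierstrass_locus B ->
     exists p, B = [set p]%classic) /\
  exists ps : seq Gamma,
    [/\ uniq ps,
        forall p : Gamma, p \in ps <-> maximal_weierstrass_point p,
        hyperelliptic Gamma ->
          [/\ size ps = 4%N, \sum_(p <- ps) weight p = 12
            & 12 = (((genus Gamma)%:Z ^+ 3 - (genus Gamma)%:Z) %/ 2)%Z]
      & ~ hyperelliptic Gamma ->
          [/\ (4 <= size ps <= 8)%N, \sum_(p <- ps) weight p = 8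
            & 8 = (genus Gamma)%:Z ^+ 2 - 1]].
Proof.
have euler := euler_genus3 Hgenus.
have good := no_cut_good Hcut euler.
have conn := no_cut_connected Hcut.
have [facts|facts] := smoothing_induction (@all_classified R) Hcut euler.
- exact: nonhyperelliptic_conclusion facts.
- exact: hyperelliptic_conclusion facts.
Qed.
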